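(* Let $M,T,B>0$ and let $f\in\mathbb A_{M,T,B}$. Then there exist $\mu_0>0$ and real numbers $g_i\in[0,1]$, $i\ge 1$, such that $$f(z)=M\left(1-\frac{2}{\mu_0\sqrt{1+\Phi(z)}\,\{g_1,g_2,\dots\mid \Phi(z)\}+1}\right),\qquad z\in R_{T,B}.$$
   Context: $R_{T,B}\subset\mathbb C$ is the open rectangle $\{z: |\mathrm{Re}\,z|<T,\ |\mathrm{Im}\,z|<B\}$. $\mathbb A_{M,T,B}$ is the set of functions $f$ analytic in $R_{T,B}$, real valued on $(-T,T)$, with $|f(z)|<M$ for all $z\in R_{T,B}$. $\mathbb H=\mathbb C\setminus(-\infty,-1]$ (the union of the open upper half-plane, the open lower half-plane and $(-1,+\infty)$). On $\mathbb H$, $\sqrt{1+w}$ is the branch positive for $w\in(-1,+\infty)$. Let $q=e^{-\pi B/T}$, $\theta_2(0,q)=2\sum_{n\ge0}q^{(n+1/2)^2}$, $\theta_3(0,q)=1+2\sum_{n\ge1}q^{n^2}$, $K=\frac{\pi}{2}\theta_3(0,q)^2$ and $k=\theta_2(0,q)^2/\theta_3(0,q)^2\in(0,1)$. Let $\mathrm{sn}(\cdot,k)$ be the Jacobi elliptic function of modulus $k$ and $$\Phi(z)=\frac{2\,\mathrm{sn}(Kz/T,k)}{1-\mathrm{sn}(Kz/T,k)},$$ which maps $R_{T,B}$ into $\mathbb H$. For $g_i\in[0,1]$, the continued $g$-fraction is $$\{g_1,g_2,\dots\mid w\}=\cfrac{1}{1+\cfrac{g_1w}{1+\cfrac{(1-g_1)g_2w}{1+\cfrac{(1-g_2)g_3w}{1+\cdots}}}},\qquad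 w\in\mathbb H,$$ which converges uniformly on compact subsets of $\mathbb H$ to an analytic function. *)

(* Defs.v *)
From Stdlib Require Import Reals Lra ClassicalEpsilon.
From Coquelicot Require Import Coquelicot.

Open Scope R_scope.

(** * Bounded real analytic functions on a rectangle *)

Definition rect (T B : R) (z : C) : Prop := Rabs (Re z) < T /\ Rabs (Im z) < B.

(** Functions are total on [C]; only the values on [rect T B] matter.
    Analytic means complex differentiable at every point of the (open)
    rectangle. *)
Definition analytic_class (M T B : R) (f : C -> C) : Prop :=
  (forall z : C, rect T B z -> @ex_derive C_AbsRing C_NormedModule f z) /\
  (forall x : R, - T < x < T -> Im (f (RtoC x)) = 0) /\
  (forall z : C, rect T B z -> Cmod (f z) < M).

(** * Complex elementary functions *)

Definition Csin (z : C) : C :=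
  (sin (Re z) * cosh (Im z), cos (Re z) * sinh (Im z)).

Definition Ccos (z : C) : C :=
  (cos (Re z) * cosh (Im z), - (sin (Re z) * sinh (Im z))).

(** The principal square root: on the plane cut along [(-oo, 0]] this is the
    holomorphic branch which is positive on [(0, +oo)]. *)
Definition Csqrt (z : C) : C :=
  (sqrt ((Cmod z + Re z) / 2),
   (if Rlt_dec (Im z) 0 then -1 else 1) * sqrt ((Cmod z - Re z) / 2)).

Lemma Csqrt_sqr (z : C) : Cmult (Csqrt z) (Csqrt z) = z.
Proof.
destruct z as [x y].
assert (Hx := re_le_Cmod (x, y)); simpl in Hx.
apply Rabs_le_between in Hx.
assert (Hm : Cmod (x, y) * Cmod (x, y) = x * x + y * y).
{ unfold Cmod; simpl; rewrite sqrt_sqrt; [ring|nra]. }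
unfold Csqrt, Cmult, Re, Im; simpl.
set (m := Cmod (x, y)) in *.
assert (Hp : sqrt ((m + x) / 2) * sqrt ((m + x) / 2) = (m + x) / 2)
  by (apply sqrt_sqrt; lra).
assert (Hn : sqrt ((m - x) / 2) * sqrt ((m - x) / 2) = (m - x) / 2)
  by (apply sqrt_sqrt; lra).
assert (Hpn : sqrt ((m + x) / 2) * sqrt ((m - x) / 2) = Rabs y / 2).
{ rewrite <- sqrt_mult by lra.
  replace ((m + x) / 2 * ((m - x) / 2)) with ((y / 2)²) by (unfold Rsqr; nra).
  rewrite sqrt_Rsqr_abs; unfold Rdiv; rewrite Rabs_mult, (Rabs_right (/ 2));
    lra. }
destruct (Rlt_dec y 0) as [Hy|Hy].
- rewrite Rabs_left in Hpn by lra; f_equal; nra.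
- rewrite Rabs_right in Hpn by lra; f_equal; nra.
Qed.

Lemma Csqrt_Re_pos (z : C) : ~ (Im z = 0 /\ Re z <= 0) -> 0 < Re (Csqrt z).
Proof.
destruct z as [x y]; simpl; intros Hz.
apply sqrt_lt_R0.
assert (Hm : Cmod (x, y) * Cmod (x, y) = x * x + y * y).
{ unfold Cmod; simpl; rewrite sqrt_sqrt; [ring|nra]. }
assert (H0 := Cmod_ge_0 (x, y)).
unfold Re; simpl.
destruct (Rle_dec x 0) as [Hx|Hx]; [|lra].
assert (Hy : y <> 0) by tauto.
assert (0 < y * y) by nra.
nra.
Qed.

(** * Theta functions with real nome [q] in [(0, 1)] *)

Definition CSeries (a : nat -> C) : C :=
  (Series (fun n => Re (a n)), Series (fun n => Im (a n))).

Definition theta1 (z : C) (q : R) : C :=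
  Cmult 2 (CSeries (fun n =>
    Cmult (RtoC ((-1) ^ n * Rpower q ((INR n + 1 / 2) ^ 2)))
          (Csin (Cmult (RtoC (2 * INR n + 1)) z)))).

Definition theta4 (z : C) (q : R) : C :=
  Cplus 1 (Cmult 2 (CSeries (fun n =>
    Cmult (RtoC ((-1) ^ (S n) * q ^ (S n * S n)))
          (Ccos (Cmult (RtoC (2 * INR (S n))) z))))).

(** [theta_2(0, q)] and [theta_3(0, q)]. *)
Definition theta2_0 (q : R) : R :=
  2 * Series (fun n => Rpower q ((INR n + 1 / 2) ^ 2)).

Definition theta3_0 (q : R) : R :=
  1 + 2 * Series (fun n => q ^ (S n * S n)).

(** * The Jacobi elliptic function sn *)

Definition modulus (q : R) : R := (theta2_0 q) ^ 2 / (theta3_0 q) ^ 2.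

Definition quarter_period (q : R) : R := PI / 2 * (theta3_0 q) ^ 2.

(** [modulus] is an increasing bijection of [(0, 1)] onto itself;
    [nome] is its inverse. *)
Definition nome (k : R) : R :=
  epsilon (inhabits 0) (fun q => 0 < q < 1 /\ modulus q = k).

(** The elliptic function [sn(u, k)] of modulus [k] in [(0, 1)], as a quotient
    of theta functions (Whittaker and Watson, 22.11; DLMF 22.2.4). *)
Definition jacobi_sn (u : C) (k : R) : C :=
  let q := nome k in
  let zeta := Cdiv u (RtoC ((theta3_0 q) ^ 2)) in
  Cmult (RtoC (theta3_0 q / theta2_0 q)) (Cdiv (theta1 zeta q) (theta4 zeta q)).

Definition Phi (T B : R) (z : C) : C :=
  let q := exp (- PI * B / T) in
  let s := jacobi_sn (Cdiv (Cmult (RtoC (quarter_period q)) z) (RtoC T))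
                     (modulus q) in
  Cdiv (Cmult 2 s) (Cminus 1 s).

(** * Continued g-fractions *)

(** The parameters are [g 1], [g 2], ...; [g 0] is not used. The partial
    numerators are [gcoef g i * w] for [i = 0, 1, ...], that is
    [g 1 * w], [(1 - g 1) * g 2 * w], [(1 - g 2) * g 3 * w], ... *)
Definition gcoef (g : nat -> R) (i : nat) : R :=
  match i with
  | O => g 1%nat
  | S _ => (1 - g i) * g (S i)
  end.

(** [1 + a_i w / (1 + a_{i+1} w / (... / (1 + a_{i+n-1} w)))], where [a] is
    [gcoef g]. For [w] off [(-oo, -1]] and parameters in [[0, 1]], none of the
    denominators vanishes. *)
Fixpoint gfrac_tail (g : nat -> R) (w : C) (i n : nat) : C :=
  match n with
  | O => 1%C
  | S n' =>
      Cplus 1 (Cdiv (Cmult (RtoC (gcoef g i)) w) (gfrac_tail g w (S i) n'))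
  end.

Definition gfrac_approx (g : nat -> R) (w : C) (n : nat) : C :=
  Cdiv 1 (gfrac_tail g w 0 n).

(** The g-fraction [{g_1, g_2, ... | w}] converges to [v]. *)
Definition is_gfrac (g : nat -> R) (w v : C) : Prop :=
  filterlim (gfrac_approx g w) eventually (locally v).

(* Main.v *)
Require Import Defs.
From Stdlib Require Import Reals Lra Lia Psatz ZArith Arith List Permutation.
From Stdlib Require Import ClassicalEpsilon FunctionalExtensionality.
From Coquelicot Require Import Coquelicot.

(** Write [f = M phi] with [|phi| < 1]. The Schur algorithm, run in a coordinate
    [u] that identifies the rectangle with the unit disk, yields numbers
    [gamma_i] in [[-1, 1]], real because [f] is real on the real axis, and
    functions [s_i] bounded by 1 such that
      [s_0 = phi],  [s_i = (gamma_i - u s_(i+1)) / (1 - gamma_i u s_(i+1))]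
    ([schur_step]). In the variable [w = 4 u / (1 - u)^2], for which
    [sqrt (1 + w) = (1 + u) / (1 - u)], one step of this recursion is one step of
    the g-fraction with [g_i = (1 + gamma_i) / 2] ([gfrac_tail_schur]), and the
    formula for [phi = s_0] in terms of [u s_1] is the representation, with
    [mu0 = (1 + gamma_0) / (1 - gamma_0)]. The approximants of the fraction arise
    when a remote [s_i] is replaced by [-1]; multiplication by [u] strictly
    contracts the pseudo-hyperbolic distance, hence they converge
    ([gfrac_converges]).

    The Schur step rests on a Schwarz lemma for the rectangle
    ([schwarz_quotient]): a bounded [h] with [h 0 = 0] is [u] times a function
    with the same bound. No inverse of [u] enters; it suffices that [u] is
    unimodular on the boundary and has a single, simple zero ([disk_coord]). The
    ingredients are Goursat's theorem for rectangles, Cauchy's formula, removable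
    singularities and the maximum principle.

    It remains to produce a [disk_coord] with [Phi = 4 u / (1 - u)^2], that is
    [sn = 2 u / (1 + u^2)]. It is
      [u = i Theta_r(- E) / Theta_r(E)],  [E = exp (i pi z / (2 T))],  [r = - q],
    where [Theta_r(x)] is the sum of [r^(n(n-1)/2) x^n] over all integers [n]. The
    functional equations of [Theta] give [|u| = 1] on the boundary. Everything
    else comes from the product formula [Theta_mult], which passes from [r] to
    [r^2]: the relation between [sn] and [u] (a Landen transformation,
    [Phi_disk_map]), the zeros of [Theta] ([Theta_simple_zeros]) and the
    injectivity of the modulus ([nome_modulus]), without which the nome used by
    [jacobi_sn] could not be recognized as [q]. *)

(** * Complex numbers *)

Lemma RtoC_neq_0 r : r <> 0 -> RtoC r <> 0.
Proof. intros H E; apply H; now apply (f_equal fst) in E. Qed.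

Lemma Cm1_neq_0 : RtoC (-1) <> 0.
Proof. apply RtoC_neq_0; lra. Qed.

Lemma C2_neq_0 : RtoC 2 <> 0.
Proof. apply RtoC_neq_0; lra. Qed.

Lemma Ci_neq_0 : Ci <> 0.
Proof. intros H; apply (f_equal snd) in H; simpl in H; lra. Qed.

Lemma Ci_sqr : (Ci * Ci)%C = RtoC (-1).
Proof. unfold Ci, Cmult, RtoC; simpl; f_equal; ring. Qed.

Lemma Cinv_neq_0 (x : C) : x <> 0 -> (/ x)%C <> 0.
Proof.
intros Hx E; apply (f_equal (Cmult x)) in E.
rewrite Cinv_r, Cmult_0_r in E by assumption.
now apply (RtoC_neq_0 1 R1_neq_R0).
Qed.

Lemma Copp_neq_0 (z : C) : z <> 0 -> (- z)%C <> 0.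
Proof. intros H E; apply H; replace z with (- - z)%C by ring; rewrite E; ring. Qed.

Lemma Cconj_real a : Cconj (RtoC a) = RtoC a.
Proof. unfold Cconj, RtoC; simpl; f_equal; ring. Qed.

Lemma Cminus_neq z w : z <> w -> (z - w)%C <> 0.
Proof.
intros H E; apply H; replace z with ((z - w) + w)%C by ring; rewrite E; ring.
Qed.

Lemma Cmod_minus_sym z w : Cmod (z - w) = Cmod (w - z).
Proof. rewrite <- Cmod_opp; f_equal; ring. Qed.

Lemma Cmod_triangle_rev z w : Cmod z - Cmod w <= Cmod (z - w).
Proof.
assert (H := Cmod_triangle (z - w) w).
replace (z - w + w)%C with z in H by ring; lra.
Qed.

Lemma Cmod_triangle_sub z w : Cmod (z - w) <= Cmod z + Cmod w.
Proof. rewrite <- (Cmod_opp w); apply Cmod_triangle. Qed.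

Lemma Cmod_fst z : Rabs (fst z) <= Cmod z.
Proof. apply re_le_Cmod. Qed.

Lemma Cmod_snd z : Rabs (snd z) <= Cmod z.
Proof. eapply Rle_trans; [apply Rmax_r|apply Rmax_Cmod]. Qed.

Lemma Cmod_le_sum z : Cmod z <= Rabs (fst z) + Rabs (snd z).
Proof.
replace z with (RtoC (fst z) + Ci * RtoC (snd z))%C at 1
  by (destruct z; unfold Cplus, Cmult; simpl; f_equal; ring).
eapply Rle_trans; [apply Cmod_triangle|].
rewrite Cmod_mult, Cmod_Ci, !Cmod_R; lra.
Qed.

(** * Continuity and complex differentiability *)

Definition Ccont (f : C -> C) (z : C) : Prop :=
  forall eps, 0 < eps -> exists del, 0 < del /\
    forall w, Cmod (w - z) < del -> Cmod (f w - f z) < eps.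

Definition near (z : C) (P : C -> Prop) : Prop :=
  exists del, 0 < del /\ forall w, Cmod (w - z) < del -> P w.

Lemma near_and z P Q : near z P -> near z Q -> near z (fun w => P w /\ Q w).
Proof.
intros [d [Hd HP]] [e [He HQ]]; exists (Rmin d e); split.
- now apply Rmin_glb_lt.
- intros w Hw; split; [apply HP|apply HQ];
    eapply Rlt_le_trans; eauto using Rmin_l, Rmin_r.
Qed.

Lemma near_imp z (P Q : C -> Prop) :
  (forall w, P w -> Q w) -> near z P -> near z Q.
Proof. intros H [d [Hd HP]]; exists d; eauto. Qed.

Lemma near_at z P : near z P -> P z.
Proof.
intros [d [Hd HP]]; apply HP.
replace (z - z)%C with (RtoC 0) by ring; now rewrite Cmod_0.
Qed.

Lemma Ccont_near f z e : Ccont f z -> 0 < e ->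
  near z (fun w => Cmod (f w - f z) < e).
Proof. intros H He; exact (H e He). Qed.

Lemma Ccont_ext_near f g z : near z (fun w => f w = g w) -> Ccont f z -> Ccont g z.
Proof.
intros Hfg Hf e He.
assert (H0 := near_at _ _ Hfg); simpl in H0.
destruct (near_and _ _ _ Hfg (Ccont_near _ _ _ Hf He)) as [d [Hd H]].
exists d; split; [assumption|]; intros w Hw.
destruct (H w Hw) as [H1 H2]; rewrite <- H0, <- H1; exact H2.
Qed.

Lemma Ccont_const c z : Ccont (fun _ => c) z.
Proof.
intros e He; exists 1; split; [lra|]; intros w _.
replace (c - c)%C with (RtoC 0) by ring; now rewrite Cmod_0.
Qed.

Lemma Ccont_id z : Ccont (fun w => w) z.
Proof. intros e He; exists e; auto. Qed.

Lemma Ccont_plus f g z : Ccont f z -> Ccont g z -> Ccont (fun w => f w + g w)%C z.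
Proof.
intros Hf Hg e He.
destruct (near_and _ _ _ (Ccont_near _ _ (e / 2) Hf ltac:(lra))
  (Ccont_near _ _ (e / 2) Hg ltac:(lra))) as [d [Hd H]].
exists d; split; [assumption|]; intros w Hw; destruct (H w Hw) as [H1 H2].
replace (f w + g w - (f z + g z))%C with ((f w - f z) + (g w - g z))%C by ring.
eapply Rle_lt_trans; [apply Cmod_triangle|lra].
Qed.

Lemma Ccont_bounded f z : Ccont f z -> near z (fun w => Cmod (f w) < Cmod (f z) + 1).
Proof.
intros Hf; apply (near_imp _ (fun w => Cmod (f w - f z) < 1)).
- intros w Hw; assert (H := Cmod_triangle_rev (f w) (f z)); lra.
- apply Ccont_near; [assumption|lra].
Qed.

Lemma Ccont_mult f g z : Ccont f z -> Ccont g z -> Ccont (fun w => f w * g w)%C z.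
Proof.
intros Hf Hg e He.
set (A := Cmod (f z) + 1); set (K := Cmod (g z) + 1).
assert (HA : 0 < A) by (unfold A; generalize (Cmod_ge_0 (f z)); lra).
assert (HK : 0 < K) by (unfold K; generalize (Cmod_ge_0 (g z)); lra).
assert (HeA : 0 < e / (2 * A)) by (apply Rdiv_lt_0_compat; lra).
assert (HeK : 0 < e / (2 * K)) by (apply Rdiv_lt_0_compat; lra).
destruct (near_and _ _ _ (Ccont_bounded _ _ Hf) (near_and _ _ _
  (Ccont_near _ _ _ Hf HeK) (Ccont_near _ _ _ Hg HeA))) as [d [Hd H]].
exists d; split; [assumption|]; intros w Hw; destruct (H w Hw) as [H0 [H1 H2]].
replace (f w * g w - f z * g z)%C
  with (f w * (g w - g z) + (f w - f z) * g z)%C by ring.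
eapply Rle_lt_trans; [apply Cmod_triangle|]; rewrite !Cmod_mult.
assert (Cmod (f w) * Cmod (g w - g z) <= A * (e / (2 * A))).
{ apply Rmult_le_compat; try apply Cmod_ge_0; unfold A in *; lra. }
assert (Cmod (f w - f z) * Cmod (g z) <= e / (2 * K) * (K - 1)).
{ apply Rmult_le_compat; try apply Cmod_ge_0; unfold K in *; lra. }
replace (A * (e / (2 * A))) with (e / 2) in * by (field; lra).
replace (e / (2 * K) * (K - 1)) with (e / 2 - e / (2 * K)) in * by (field; lra).
lra.
Qed.

Lemma Ccont_opp f z : Ccont f z -> Ccont (fun w => - f w)%C z.
Proof.
intros Hf e He; destruct (Hf e He) as [d [Hd H]]; exists d; split; [assumption|].
intros w Hw; replace (- f w - - f z)%C with (- (f w - f z))%C by ring.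
rewrite Cmod_opp; auto.
Qed.

Lemma Ccont_minus f g z : Ccont f z -> Ccont g z -> Ccont (fun w => f w - g w)%C z.
Proof. intros Hf Hg; apply Ccont_plus; [|apply Ccont_opp]; assumption. Qed.

Lemma Ccont_nz f z : Ccont f z -> f z <> 0 ->
  near z (fun w => Cmod (f z) / 2 < Cmod (f w)).
Proof.
intros Hf Hz; apply Cmod_gt_0 in Hz.
apply (near_imp _ (fun w => Cmod (f w - f z) < Cmod (f z) / 2)).
- intros w Hw; rewrite Cmod_minus_sym in Hw.
  assert (H := Cmod_triangle_rev (f z) (f w)); lra.
- apply Ccont_near; [assumption|lra].
Qed.

Lemma Ccont_neq_0 f z : Ccont f z -> f z <> 0 -> near z (fun w => f w <> 0).
Proof.
intros Hf Hz; generalize (Ccont_nz _ _ Hf Hz); apply near_imp; intros w Hw.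
apply Cmod_gt_0; generalize (Cmod_ge_0 (f z)); lra.
Qed.

Lemma Ccont_inv f z : Ccont f z -> f z <> 0 -> Ccont (fun w => / f w)%C z.
Proof.
intros Hf Hz e He.
assert (Hm := proj1 (Cmod_gt_0 _) Hz); set (m := Cmod (f z)) in *.
assert (He' : 0 < e * (m * m) / 2)
  by (apply Rdiv_lt_0_compat; [repeat apply Rmult_lt_0_compat; lra|lra]).
destruct (near_and _ _ _ (Ccont_nz _ _ Hf Hz) (Ccont_near _ _ _ Hf He'))
  as [d [Hd H]].
exists d; split; [assumption|]; intros w Hw; destruct (H w Hw) as [H1 H2].
fold m in H1.
assert (Hw0 : f w <> 0) by (apply Cmod_gt_0; lra).
replace (/ f w - / f z)%C with (- (f w - f z) / (f w * f z))%C by (field; auto).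
rewrite Cmod_div, Cmod_opp, Cmod_mult by (apply Cmult_neq_0; auto); fold m.
apply Rlt_div_l; [apply Rmult_lt_0_compat; lra|].
eapply Rlt_le_trans; [exact H2|].
apply Rle_trans with (e * (m / 2 * m)); [lra|].
apply Rmult_le_compat_l; [lra|]; apply Rmult_le_compat_r; lra.
Qed.

Lemma Ccont_div f g z :
  Ccont f z -> Ccont g z -> g z <> 0 -> Ccont (fun w => f w / g w)%C z.
Proof. intros; apply Ccont_mult; [|apply Ccont_inv]; assumption. Qed.

Lemma Ccont_comp f g z : Ccont g z -> Ccont f (g z) -> Ccont (fun w => f (g w)) z.
Proof.
intros Hg Hf e He; destruct (Hf e He) as [d [Hd H]].
destruct (Hg d Hd) as [d' [Hd' H']]; exists d'; auto.
Qed.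

Lemma Ccont_pow f n z : Ccont f z -> Ccont (fun w => f w ^ n)%C z.
Proof.
intros Hf; induction n as [|n IH]; [exact (Ccont_const 1 z)|].
now apply (Ccont_mult f (fun w => f w ^ n)%C).
Qed.

(** Two functions that are continuous at a point and agree at the other points
    near it agree there. *)
Lemma Ccont_eq_at f g z : Ccont f z -> Ccont g z ->
  near z (fun w => w <> z -> f w = g w) -> f z = g z.
Proof.
intros Hf Hg Hfg.
destruct (excluded_middle_informative (f z = g z)) as [|Hne]; [assumption|exfalso].
assert (Hne' : (f z - g z)%C <> 0).
{ intros H; apply Hne; replace (f z) with ((f z - g z) + g z)%C by ring.
  rewrite H; ring. }
destruct (near_and _ _ _ Hfg (Ccont_neq_0 _ _ (Ccont_minus _ _ _ Hf Hg) Hne'))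
  as [d [Hd H]].
set (w := (z + RtoC (d / 2))%C).
assert (Hw : (w - z)%C = RtoC (d / 2)) by (unfold w; ring).
destruct (H w) as [H1 H2].
{ rewrite Hw, Cmod_R, Rabs_right; lra. }
apply H2; rewrite H1; [ring|].
intros E; rewrite E in Hw; apply (f_equal fst) in Hw; simpl in Hw; lra.
Qed.

(** The difference quotient, completed at [z] so that it can be integrated across
    that point. *)
Definition slope (f : C -> C) (z d w : C) : C :=
  if excluded_middle_informative (w = z) then d else ((f w - f z) / (w - z))%C.

Definition is_Cderiv (f : C -> C) (z d : C) : Prop := Ccont (slope f z d) z.

Definition Cdiff (f : C -> C) (z : C) : Prop := exists d, is_Cderiv f z d.

Lemma slope_at f z d : slope f z d z = d.
Proof. unfold slope; destruct (excluded_middle_informative (z = z)); tauto. Qed.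

Lemma slope_ne f z d w : w <> z -> slope f z d w = ((f w - f z) / (w - z))%C.
Proof. unfold slope; destruct (excluded_middle_informative (w = z)); tauto. Qed.

Lemma slope_eq f z d w : f w = (f z + slope f z d w * (w - z))%C.
Proof.
destruct (excluded_middle_informative (w = z)) as [->|H].
- rewrite slope_at; ring.
- rewrite slope_ne by assumption; field; now apply Cminus_neq.
Qed.

(** Caratheodory's form of differentiability: it suffices to factor the
    increment near [z] with a continuous factor. *)
Lemma is_Cderiv_intro f z phi : Ccont phi z ->
  near z (fun w => f w = (f z + phi w * (w - z))%C) -> is_Cderiv f z (phi z).
Proof.
intros Hphi Hf; unfold is_Cderiv.
apply (Ccont_ext_near phi); [|assumption].
revert Hf; apply near_imp; intros w Hw.
destruct (excluded_middle_informative (w = z)) as [->|H].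
- now rewrite slope_at.
- rewrite slope_ne by assumption; rewrite Hw; field; now apply Cminus_neq.
Qed.

Lemma is_Cderiv_unique f z d d' : is_Cderiv f z d -> is_Cderiv f z d' -> d = d'.
Proof.
intros H H'; rewrite <- (slope_at f z d), <- (slope_at f z d').
apply Ccont_eq_at; [assumption..|].
exists 1; split; [lra|]; intros w _ Hw; now rewrite !slope_ne.
Qed.

Lemma Cdiff_cont f z : Cdiff f z -> Ccont f z.
Proof.
intros [d H].
apply (Ccont_ext_near (fun w => f z + slope f z d w * (w - z))%C).
- exists 1; split; [lra|]; intros w _; now rewrite <- slope_eq.
- apply Ccont_plus; [apply Ccont_const|apply Ccont_mult; [assumption|]].
  apply Ccont_minus; [apply Ccont_id|apply Ccont_const].
Qed.

Lemma is_Cderiv_ext_near f g z d :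
  near z (fun w => f w = g w) -> is_Cderiv f z d -> is_Cderiv g z d.
Proof.
intros Hfg Hf; rewrite <- (slope_at f z d); apply is_Cderiv_intro; [assumption|].
assert (H0 := near_at _ _ Hfg); simpl in H0.
revert Hfg; apply near_imp; intros w Hw.
rewrite <- Hw, <- H0; apply slope_eq.
Qed.

Lemma Cdiff_ext_near f g z : near z (fun w => f w = g w) -> Cdiff f z -> Cdiff g z.
Proof. intros H [d Hd]; exists d; eapply is_Cderiv_ext_near; eauto. Qed.

Lemma is_Cderiv_const c z : is_Cderiv (fun _ => c) z 0.
Proof.
apply (is_Cderiv_intro _ z (fun _ => RtoC 0)); [apply Ccont_const|].
exists 1; split; [lra|]; intros w _; ring.
Qed.

Lemma is_Cderiv_id z : is_Cderiv (fun w => w) z 1.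
Proof.
apply (is_Cderiv_intro _ z (fun _ => RtoC 1)); [apply Ccont_const|].
exists 1; split; [lra|]; intros w _; ring.
Qed.

Lemma near_all z (P : C -> Prop) : (forall w, P w) -> near z P.
Proof. intros H; exists 1; split; [lra|auto]. Qed.

Lemma is_Cderiv_plus f g z d e : is_Cderiv f z d -> is_Cderiv g z e ->
  is_Cderiv (fun w => f w + g w)%C z (d + e).
Proof.
intros Hf Hg.
replace (d + e)%C with (slope f z d z + slope g z e z)%C by now rewrite !slope_at.
apply (is_Cderiv_intro _ z (fun w => slope f z d w + slope g z e w)%C).
- now apply Ccont_plus.
- apply near_all; intros w.
  rewrite (slope_eq f z d w), (slope_eq g z e w) at 1; ring.
Qed.

Lemma is_Cderiv_mult f g z d e : is_Cderiv f z d -> is_Cderiv g z e ->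
  is_Cderiv (fun w => f w * g w)%C z (d * g z + f z * e).
Proof.
intros Hf Hg.
replace (d * g z + f z * e)%C
  with (slope f z d z * g z + f z * slope g z e z)%C by now rewrite !slope_at.
apply (is_Cderiv_intro _ z (fun w => slope f z d w * g w + f z * slope g z e w)%C).
- apply Ccont_plus; apply Ccont_mult; try assumption; [|apply Ccont_const].
  apply Cdiff_cont; now exists e.
- apply near_all; intros w.
  rewrite (slope_eq f z d w) at 1; rewrite (slope_eq g z e w); ring.
Qed.

Lemma is_Cderiv_scal c f z d : is_Cderiv f z d -> is_Cderiv (fun w => c * f w)%C z (c * d).
Proof.
intros H; replace (c * d)%C with (c * slope f z d z)%C by now rewrite slope_at.
apply (is_Cderiv_intro _ z (fun w => c * slope f z d w)%C).
- apply Ccont_mult; [apply Ccont_const|assumption].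
- apply near_all; intros w; rewrite (slope_eq f z d w) at 1; ring.
Qed.

Lemma is_Cderiv_comp f g z d e : is_Cderiv g z d -> is_Cderiv f (g z) e ->
  is_Cderiv (fun w => f (g w)) z (e * d).
Proof.
intros Hg Hf.
replace (e * d)%C with (slope f (g z) e (g z) * slope g z d z)%C
  by now rewrite !slope_at.
apply (is_Cderiv_intro _ z (fun w => slope f (g z) e (g w) * slope g z d w)%C).
- apply Ccont_mult; [|assumption].
  apply Ccont_comp; [apply Cdiff_cont; now exists d|assumption].
- apply near_all; intros w.
  rewrite (slope_eq f (g z) e (g w)) at 1; rewrite (slope_eq g z d w) at 2; ring.
Qed.

Lemma is_Cderiv_inv (z : C) : z <> 0 -> is_Cderiv Cinv z (- / (z * z)).
Proof.
intros Hz; apply (is_Cderiv_intro _ z (fun w => - / (w * z))%C).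
- apply Ccont_opp, (Ccont_inv (fun w => w * z)%C); [|apply Cmult_neq_0; assumption].
  apply Ccont_mult; [apply Ccont_id|apply Ccont_const].
- generalize (Ccont_neq_0 _ _ (Ccont_id z) Hz); apply near_imp; intros w Hw.
  field; auto.
Qed.

Lemma Cdiff_const c z : Cdiff (fun _ => c) z.
Proof. exists 0; apply is_Cderiv_const. Qed.

Lemma Cdiff_id z : Cdiff (fun w => w) z.
Proof. exists 1; apply is_Cderiv_id. Qed.

Lemma Cdiff_plus f g z : Cdiff f z -> Cdiff g z -> Cdiff (fun w => f w + g w)%C z.
Proof. intros [d Hd] [e He]; eexists; apply is_Cderiv_plus; eassumption. Qed.

Lemma Cdiff_mult f g z : Cdiff f z -> Cdiff g z -> Cdiff (fun w => f w * g w)%C z.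
Proof. intros [d Hd] [e He]; eexists; apply is_Cderiv_mult; eassumption. Qed.

Lemma Cdiff_comp f g z : Cdiff g z -> Cdiff f (g z) -> Cdiff (fun w => f (g w)) z.
Proof. intros [d Hd] [e He]; eexists; eapply is_Cderiv_comp; eauto. Qed.

Lemma Cdiff_opp f z : Cdiff f z -> Cdiff (fun w => - f w)%C z.
Proof.
intros Hf; apply (Cdiff_ext_near (fun w => -1 * f w)%C).
- apply near_all; intros w; ring.
- apply Cdiff_mult; [apply Cdiff_const|assumption].
Qed.

Lemma Cdiff_minus f g z : Cdiff f z -> Cdiff g z -> Cdiff (fun w => f w - g w)%C z.
Proof. intros Hf Hg; apply Cdiff_plus; [|apply Cdiff_opp]; assumption. Qed.

Lemma Cdiff_inv f z : Cdiff f z -> f z <> 0 -> Cdiff (fun w => / f w)%C z.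
Proof.
intros Hf Hz; apply (Cdiff_comp Cinv); [assumption|].
eexists; apply is_Cderiv_inv; assumption.
Qed.

Lemma Cdiff_div f g z :
  Cdiff f z -> Cdiff g z -> g z <> 0 -> Cdiff (fun w => f w / g w)%C z.
Proof. intros; apply Cdiff_mult; [|apply Cdiff_inv]; assumption. Qed.

Lemma Cdiff_pow f n z : Cdiff f z -> Cdiff (fun w => f w ^ n)%C z.
Proof.
intros Hf; induction n as [|n IH]; [exact (Cdiff_const 1 z)|].
exact (Cdiff_mult f (fun w => f w ^ n)%C z Hf IH).
Qed.

Lemma ex_derive_Cdiff (f : C -> C) (z : C) :
  @ex_derive C_AbsRing C_NormedModule f z -> Cdiff f z.
Proof.
intros [d [_ Hd]]; exists d; intros e He.
assert (He2 : 0 < e / 2) by lra.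
destruct (Hd z (fun P HP => HP) (mkposreal _ He2)) as [del H]; simpl in H.
exists (pos del); split; [apply cond_pos|].
intros w Hw; rewrite slope_at.
destruct (excluded_middle_informative (w = z)) as [->|Hne].
- rewrite slope_at; replace (d - d)%C with (RtoC 0) by ring; now rewrite Cmod_0.
- rewrite slope_ne by assumption.
  assert (Hb : @ball (AbsRing_UniformSpace C_AbsRing) z del w) by exact Hw.
  specialize (H w Hb).
  change (Cmod ((f w - f z) - (w - z) * d)%C <= e / 2 * Cmod (w - z)) in H.
  assert (Hp := proj1 (Cmod_gt_0 _) (Cminus_neq _ _ Hne)).
  replace ((f w - f z) / (w - z) - d)%C
    with (((f w - f z) - (w - z) * d) / (w - z))%C by (field; now apply Cminus_neq).
  rewrite Cmod_div by now apply Cminus_neq.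
  apply Rlt_div_l; [assumption|].
  assert (0 < e / 2 * Cmod (w - z)) by now apply Rmult_lt_0_compat.
  lra.
Qed.

(** * Integration along the boundary of a rectangle *)

Definition Cint (f : R -> C) (a b : R) : C :=
  (RInt (fun t => fst (f t)) a b, RInt (fun t => snd (f t)) a b).

Definition path_cont (f : R -> C) (a b : R) : Prop :=
  forall t, a <= t <= b ->
    continuous (fun t => fst (f t)) t /\ continuous (fun t => snd (f t)) t.

Lemma path_cont_ex_RInt f a b : a <= b -> path_cont f a b ->
  ex_RInt (fun t => fst (f t)) a b /\ ex_RInt (fun t => snd (f t)) a b.
Proof.
intros Hab Hf; split; apply (ex_RInt_continuous (V := R_CompleteNormedModule));
  intros t Ht; rewrite Rmin_left, Rmax_right in Ht by assumption; apply Hf, Ht.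
Qed.

Lemma path_cont_sub f a b a' b' : a <= a' -> b' <= b -> path_cont f a b -> path_cont f a' b'.
Proof. intros Ha Hb Hf t Ht; apply Hf; lra. Qed.

Lemma Cint_ext f g a b : a <= b -> (forall t, a <= t <= b -> f t = g t) ->
  Cint f a b = Cint g a b.
Proof.
intros Hab H; unfold Cint; f_equal; apply RInt_ext; intros t Ht;
  rewrite Rmin_left, Rmax_right in Ht by assumption; rewrite H; (reflexivity || lra).
Qed.

Lemma Cint_plus f g a b : a <= b -> path_cont f a b -> path_cont g a b ->
  Cint (fun t => f t + g t)%C a b = (Cint f a b + Cint g a b)%C.
Proof.
intros Hab Hf Hg.
destruct (path_cont_ex_RInt _ _ _ Hab Hf), (path_cont_ex_RInt _ _ _ Hab Hg).
unfold Cint, Cplus; simpl; f_equal;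
  apply (RInt_plus (V := R_CompleteNormedModule)); assumption.
Qed.

Lemma Cint_scal c f a b : a <= b -> path_cont f a b ->
  Cint (fun t => c * f t)%C a b = (c * Cint f a b)%C.
Proof.
intros Hab Hf; destruct (path_cont_ex_RInt _ _ _ Hab Hf) as [H1 H2].
unfold Cint, Cmult; simpl; f_equal.
- apply is_RInt_unique.
  apply (is_RInt_minus (V := R_NormedModule)
    (fun t => fst c * fst (f t)) (fun t => snd c * snd (f t)));
    apply (is_RInt_scal (V := R_NormedModule));
    now apply (RInt_correct (V := R_CompleteNormedModule)).
- apply is_RInt_unique.
  apply (is_RInt_plus (V := R_NormedModule)
    (fun t => fst c * snd (f t)) (fun t => snd c * fst (f t)));
    apply (is_RInt_scal (V := R_NormedModule));
    now apply (RInt_correct (V := R_CompleteNormedModule)).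
Qed.

Lemma Cint_Chasles f a m b : a <= m -> m <= b -> path_cont f a b ->
  Cint f a b = (Cint f a m + Cint f m b)%C.
Proof.
intros Ham Hmb Hf.
destruct (path_cont_ex_RInt _ _ _ Ham (path_cont_sub _ _ _ a m (Rle_refl _) Hmb Hf)).
destruct (path_cont_ex_RInt _ _ _ Hmb (path_cont_sub _ _ _ m b Ham (Rle_refl _) Hf)).
unfold Cint, Cplus; simpl; f_equal; symmetry;
  apply (RInt_Chasles (V := R_CompleteNormedModule)); assumption.
Qed.

Lemma Cint_bound f a b M : a <= b -> path_cont f a b ->
  (forall t, a <= t <= b -> Cmod (f t) <= M) ->
  Cmod (Cint f a b) <= 2 * (M * (b - a)).
Proof.
intros Hab Hf HM; destruct (path_cont_ex_RInt _ _ _ Hab Hf) as [H1 H2].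
eapply Rle_trans; [apply Cmod_le_sum|]; unfold Cint; simpl.
assert (Rabs (RInt (fun t => fst (f t)) a b) <= (b - a) * M).
{ apply abs_RInt_le_const; try assumption; intros t Ht.
  eapply Rle_trans; [apply Cmod_fst|auto]. }
assert (Rabs (RInt (fun t => snd (f t)) a b) <= (b - a) * M).
{ apply abs_RInt_le_const; try assumption; intros t Ht.
  eapply Rle_trans; [apply Cmod_snd|auto]. }
lra.
Qed.

(** Counterclockwise integral along the boundary of [[a, b] x [c, d]]. *)
Definition oint (k : C -> C) (a b c d : R) : C :=
  (Cint (fun x => k (x, c)) a b + Ci * Cint (fun y => k (b, y)) c d
   - Cint (fun x => k (x, d)) a b - Ci * Cint (fun y => k (a, y)) c d)%C.

Definition in_rect (a b c d : R) (z : C) : Prop :=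
  a <= fst z <= b /\ c <= snd z <= d.

Definition on_boundary (a b c d : R) (z : C) : Prop :=
  in_rect a b c d z /\ (fst z = a \/ fst z = b \/ snd z = c \/ snd z = d).

Ltac edge := unfold on_boundary, in_rect; simpl; intuition lra.

Lemma Cmod_horizontal (x x' y : R) : Cmod ((x', y) - (x, y)) = Rabs (x' - x).
Proof.
replace ((x', y) - (x, y))%C with (RtoC (x' - x)).
- apply Cmod_R.
- unfold Cminus, Cplus, Copp, RtoC; simpl; f_equal; ring.
Qed.

Lemma Cmod_vertical (x y y' : R) : Cmod ((x, y') - (x, y)) = Rabs (y' - y).
Proof.
replace ((x, y') - (x, y))%C with (Ci * RtoC (y' - y))%C.
- rewrite Cmod_mult, Cmod_Ci, Cmod_R; ring.
- unfold Cminus, Cplus, Copp, RtoC, Cmult; simpl; f_equal; ring.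
Qed.

Lemma Ccont_line (k : C -> C) (l : R -> C) (t : R) :
  (forall s, Cmod (l s - l t) = Rabs (s - t)) -> Ccont k (l t) ->
  continuous (fun s => fst (k (l s))) t /\ continuous (fun s => snd (k (l s))) t.
Proof.
intros Hl Hk; split; apply filterlim_locally; intros eps;
  destruct (Hk eps (cond_pos eps)) as [del [Hd H]];
  exists (mkposreal del Hd); intros s Hs; simpl in Hs.
- eapply Rle_lt_trans; [apply (Cmod_fst (k (l s) - k (l t))%C)|].
  apply H; rewrite Hl; exact Hs.
- eapply Rle_lt_trans; [apply (Cmod_snd (k (l s) - k (l t))%C)|].
  apply H; rewrite Hl; exact Hs.
Qed.

Lemma path_cont_h k a b y : (forall x, a <= x <= b -> Ccont k (x, y)) ->
  path_cont (fun x => k (x, y)) a b.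
Proof.
intros H t Ht; apply (Ccont_line k (fun x => (x, y))); [|now apply H].
intros s; apply Cmod_horizontal.
Qed.

Lemma path_cont_v k c d x : (forall y, c <= y <= d -> Ccont k (x, y)) ->
  path_cont (fun y => k (x, y)) c d.
Proof.
intros H t Ht; apply (Ccont_line k (fun y => (x, y))); [|now apply H].
intros s; apply Cmod_vertical.
Qed.

Lemma edges_Pcont k a b c d : a <= b -> c <= d ->
  (forall z, on_boundary a b c d z -> Ccont k z) ->
  path_cont (fun x => k (x, c)) a b /\ path_cont (fun y => k (b, y)) c d /\
  path_cont (fun x => k (x, d)) a b /\ path_cont (fun y => k (a, y)) c d.
Proof.
intros Hab Hcd H; split; [|split; [|split]];
  [apply path_cont_h|apply path_cont_v|apply path_cont_h|apply path_cont_v];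
  intros; apply H; edge.
Qed.

Lemma oint_ext k l a b c d : a <= b -> c <= d ->
  (forall z, on_boundary a b c d z -> k z = l z) -> oint k a b c d = oint l a b c d.
Proof.
intros Hab Hcd H; unfold oint; f_equal; [f_equal; [f_equal; [|f_equal]|]|f_equal];
  apply Cint_ext; try assumption; intros t Ht; apply H; edge.
Qed.

Lemma oint_plus k l a b c d : a <= b -> c <= d ->
  (forall z, on_boundary a b c d z -> Ccont k z) ->
  (forall z, on_boundary a b c d z -> Ccont l z) ->
  oint (fun w => k w + l w)%C a b c d = (oint k a b c d + oint l a b c d)%C.
Proof.
intros Hab Hcd Hk Hl.
destruct (edges_Pcont _ _ _ _ _ Hab Hcd Hk) as (H1 & H2 & H3 & H4).
destruct (edges_Pcont _ _ _ _ _ Hab Hcd Hl) as (L1 & L2 & L3 & L4).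
unfold oint.
rewrite (Cint_plus (fun x => k (x, c))), (Cint_plus (fun y => k (b, y))),
  (Cint_plus (fun x => k (x, d))), (Cint_plus (fun y => k (a, y))) by assumption.
ring.
Qed.

Lemma oint_scal e k a b c d : a <= b -> c <= d ->
  (forall z, on_boundary a b c d z -> Ccont k z) ->
  oint (fun w => e * k w)%C a b c d = (e * oint k a b c d)%C.
Proof.
intros Hab Hcd Hk.
destruct (edges_Pcont _ _ _ _ _ Hab Hcd Hk) as (H1 & H2 & H3 & H4).
unfold oint.
rewrite (Cint_scal e (fun x => k (x, c))), (Cint_scal e (fun y => k (b, y))),
  (Cint_scal e (fun x => k (x, d))), (Cint_scal e (fun y => k (a, y))) by assumption.
ring.
Qed.

Lemma oint_bound k a b c d M : a <= b -> c <= d ->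
  (forall z, on_boundary a b c d z -> Ccont k z) ->
  (forall z, on_boundary a b c d z -> Cmod (k z) <= M) ->
  Cmod (oint k a b c d) <= 4 * (M * ((b - a) + (d - c))).
Proof.
intros Hab Hcd Hk HM.
destruct (edges_Pcont _ _ _ _ _ Hab Hcd Hk) as (H1 & H2 & H3 & H4).
assert (B1 := Cint_bound _ _ _ M Hab H1 ltac:(intros; apply HM; edge)).
assert (B2 := Cint_bound _ _ _ M Hcd H2 ltac:(intros; apply HM; edge)).
assert (B3 := Cint_bound _ _ _ M Hab H3 ltac:(intros; apply HM; edge)).
assert (B4 := Cint_bound _ _ _ M Hcd H4 ltac:(intros; apply HM; edge)).
unfold oint.
eapply Rle_trans; [apply Cmod_triangle_sub|].
eapply Rle_trans; [apply Rplus_le_compat_r, Cmod_triangle_sub|].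
eapply Rle_trans; [apply Rplus_le_compat_r, Rplus_le_compat_r, Cmod_triangle|].
rewrite !Cmod_mult, Cmod_Ci; lra.
Qed.

Lemma oint_close k l a b c d M : a <= b -> c <= d ->
  (forall z, on_boundary a b c d z -> Ccont k z) ->
  (forall z, on_boundary a b c d z -> Ccont l z) ->
  (forall z, on_boundary a b c d z -> Cmod (k z - l z) <= M) ->
  Cmod (oint k a b c d - oint l a b c d) <= 4 * (M * ((b - a) + (d - c))).
Proof.
intros Hab Hcd Hk Hl HM.
assert (Hl' : forall z, on_boundary a b c d z -> Ccont (fun w => -1 * l w)%C z)
  by (intros z Hz; apply Ccont_mult; [apply Ccont_const|auto]).
replace (oint k a b c d - oint l a b c d)%C with (oint (fun w => k w + -1 * l w)%C a b c d)
  by (rewrite oint_plus, oint_scal by assumption; ring).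
apply oint_bound; try assumption; intros z Hz; [apply Ccont_plus; auto|].
replace (k z + -1 * l z)%C with (k z - l z)%C by ring; auto.
Qed.

Lemma oint_split_v k a m b c d : a <= m -> m <= b -> c <= d ->
  (forall z, in_rect a b c d z -> Ccont k z) ->
  oint k a b c d = (oint k a m c d + oint k m b c d)%C.
Proof.
intros Ham Hmb Hcd Hk; unfold oint.
rewrite (Cint_Chasles (fun x => k (x, c)) a m b), (Cint_Chasles (fun x => k (x, d)) a m b)
  by (try assumption; apply path_cont_h; intros; apply Hk; unfold in_rect; simpl; lra).
ring.
Qed.

Lemma oint_split_h k a b c m d : a <= b -> c <= m -> m <= d ->
  (forall z, in_rect a b c d z -> Ccont k z) ->
  oint k a b c d = (oint k a b c m + oint k a b m d)%C.
Proof.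
intros Hab Hcm Hmd Hk; unfold oint.
rewrite (Cint_Chasles (fun y => k (b, y)) c m d), (Cint_Chasles (fun y => k (a, y)) c m d)
  by (try assumption; apply path_cont_v; intros; apply Hk; unfold in_rect; simpl; lra).
ring.
Qed.

Lemma RInt_affine p q a b :
  RInt (fun t => p + q * t) a b = p * (b - a) + q * (b * b - a * a) / 2.
Proof.
apply is_RInt_unique.
replace (p * (b - a) + q * (b * b - a * a) / 2)
  with (minus (p * b + q * (b * b) / 2) (p * a + q * (a * a) / 2))
  by (unfold minus, plus, opp; simpl; field).
apply (is_RInt_derive (fun t => p * t + q * (t * t) / 2)).
- intros t _; auto_derive; [trivial|field].
- intros t _; apply (ex_derive_continuous (fun t => p + q * t)); auto_derive; trivial.
Qed.

(** Affine functions have a primitive; the edges are integrated explicitly. *)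
Lemma oint_affine al be a b c d : a <= b -> c <= d ->
  oint (fun w => al + be * w)%C a b c d = 0.
Proof.
intros Hab Hcd; destruct al as [p q], be as [s t].
assert (Hh : forall y, Cint (fun x => (p, q) + (s, t) * (x, y))%C a b =
  ((p - t * y) * (b - a) + s * (b * b - a * a) / 2,
   (q + s * y) * (b - a) + t * (b * b - a * a) / 2)).
{ intros y; unfold Cint; f_equal; rewrite <- RInt_affine; apply RInt_ext;
    intros x _; simpl; ring. }
assert (Hv : forall x, Cint (fun y => (p, q) + (s, t) * (x, y))%C c d =
  ((p + s * x) * (d - c) + - t * (d * d - c * c) / 2,
   (q + t * x) * (d - c) + s * (d * d - c * c) / 2)).
{ intros x; unfold Cint; f_equal; rewrite <- RInt_affine; apply RInt_ext;
    intros y _; simpl; ring. }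
unfold oint; rewrite !Hh, !Hv.
unfold Cminus, Cplus, Copp, Cmult, Ci, RtoC; simpl; f_equal; field.
Qed.

(** * Goursat's theorem *)

(** If the integral along a rectangle exceeds [e], that along one of its four
    quarters exceeds [e / 4]. *)
Lemma oint_quarter k x y L H e : 0 <= L -> 0 <= H ->
  (forall z, in_rect x (x + L) y (y + H) z -> Ccont k z) ->
  e < Cmod (oint k x (x + L) y (y + H)) ->
  exists x' y', x <= x' <= x + L / 2 /\ y <= y' <= y + H / 2 /\
    e / 4 < Cmod (oint k x' (x' + L / 2) y' (y' + H / 2)).
Proof.
intros HL HH Hk He.
destruct (excluded_middle_informative (exists x' y', x <= x' <= x + L / 2 /\
  y <= y' <= y + H / 2 /\ e / 4 < Cmod (oint k x' (x' + L / 2) y' (y' + H / 2))))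
  as [|Hn]; [assumption|exfalso].
assert (Hs : forall x' y', x <= x' <= x + L / 2 -> y <= y' <= y + H / 2 ->
  Cmod (oint k x' (x' + L / 2) y' (y' + H / 2)) <= e / 4).
{ intros x' y' Hx Hy; apply Rnot_lt_le; intros Hlt; apply Hn; eauto. }
rewrite (oint_split_v k x (x + L / 2)) in He by (try assumption; lra).
rewrite (oint_split_h k x (x + L / 2) y (y + H / 2)) in He
  by (try lra; intros z Hz; apply Hk; unfold in_rect in *; lra).
rewrite (oint_split_h k (x + L / 2) (x + L) y (y + H / 2)) in He
  by (try lra; intros z Hz; apply Hk; unfold in_rect in *; lra).
assert (H1 := Hs x y ltac:(lra) ltac:(lra)).
assert (H2 := Hs x (y + H / 2) ltac:(lra) ltac:(lra)).
assert (H3 := Hs (x + L / 2) y ltac:(lra) ltac:(lra)).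
assert (H4 := Hs (x + L / 2) (y + H / 2) ltac:(lra) ltac:(lra)).
replace (x + L / 2 + L / 2) with (x + L) in * by field.
replace (y + H / 2 + H / 2) with (y + H) in * by field.
assert (T1 := Cmod_triangle (oint k x (x + L / 2) y (y + H / 2)
  + oint k x (x + L / 2) (y + H / 2) (y + H)) (oint k (x + L / 2) (x + L) y (y + H / 2)
  + oint k (x + L / 2) (x + L) (y + H / 2) (y + H))).
assert (T2 := Cmod_triangle (oint k x (x + L / 2) y (y + H / 2))
  (oint k x (x + L / 2) (y + H / 2) (y + H))).
assert (T3 := Cmod_triangle (oint k (x + L / 2) (x + L) y (y + H / 2))
  (oint k (x + L / 2) (x + L) (y + H / 2) (y + H))).
lra.
Qed.

(** Near a point of differentiability the affine part contributes nothing, so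
    the integral is small compared with the square of the size. *)
Lemma oint_small k p e : Cdiff k p -> 0 < e -> exists del, 0 < del /\
  forall a b c d, a <= b -> c <= d -> in_rect a b c d p ->
    (forall z, in_rect a b c d z -> Ccont k z) ->
    (b - a) + (d - c) < del ->
    Cmod (oint k a b c d) <= e * ((b - a) + (d - c)) ^ 2.
Proof.
intros [l Hl] He; destruct (Hl (e / 4) ltac:(lra)) as [del [Hd H]].
exists del; split; [assumption|]; intros a b c d Hab Hcd Hp Hk Hsize.
set (aff := fun w => ((k p - l * p) + l * w)%C).
replace (oint k a b c d) with (oint k a b c d - oint aff a b c d)%C
  by (unfold aff; rewrite oint_affine by assumption; ring).
eapply Rle_trans.
- apply (oint_close _ _ _ _ _ _ (e / 4 * ((b - a) + (d - c)))); try assumption.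
  + intros z Hz; apply Hk, Hz.
  + intros z _; apply Ccont_plus; [apply Ccont_const|].
    apply Ccont_mult; [apply Ccont_const|apply Ccont_id].
  + intros w Hw; unfold aff.
    replace (k w - (k p - l * p + l * w))%C with ((slope k p l w - l) * (w - p))%C
      by (rewrite (slope_eq k p l w); ring).
    assert (Hwp : Cmod (w - p) <= (b - a) + (d - c)).
    { eapply Rle_trans; [apply Cmod_le_sum|].
      destruct Hw as [[Hw1 Hw2] _], Hp as [Hp1 Hp2]; simpl.
      apply Rplus_le_compat; apply Rabs_le; simpl; lra. }
    rewrite Cmod_mult; apply Rmult_le_compat; try apply Cmod_ge_0; [|assumption].
    apply Rlt_le; assert (Hs := H w ltac:(lra)); now rewrite slope_at in Hs.
- right; field.
Qed.

Lemma nested_limit (u : nat -> R) (L : R) : 0 <= L ->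
  (forall n, u n <= u (S n) <= u n + L / 2 ^ S n) ->
  exists l, forall n, u n <= l <= u n + L / 2 ^ n.
Proof.
intros HL Hu.
assert (Hmono : forall n m, u n <= u (n + m)%nat <= u n + L / 2 ^ n - L / 2 ^ (n + m)).
{ intros n m; induction m as [|m IH]; [rewrite Nat.add_0_r; lra|].
  rewrite Nat.add_succ_r; specialize (Hu (n + m)%nat).
  assert (L / 2 ^ (n + m) = 2 * (L / 2 ^ S (n + m)))
    by (simpl; field; apply pow_nonzero; lra).
  lra. }
assert (Hpos : forall n, 0 <= L / 2 ^ n)
  by (intros n; apply Rdiv_le_0_compat; [assumption|apply pow_lt; lra]).
assert (Hle : forall n m, u m <= u n + L / 2 ^ n).
{ intros n m; destruct (le_ge_dec n m) as [Hnm|Hnm].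
  - replace m with (n + (m - n))%nat by lia.
    assert (H1 := Hmono n (m - n)%nat); assert (H2 := Hpos (n + (m - n))%nat); lra.
  - assert (H1 := Hmono m (n - m)%nat); replace (m + (n - m))%nat with n in H1 by lia.
    assert (H2 := Hpos n); lra. }
destruct (completeness (fun x => exists n, x = u n)) as [l [Hl1 Hl2]].
- exists (u O + L / 2 ^ 0); intros x [n ->]; apply Hle.
- exists (u O), O; reflexivity.
- exists l; intros n; split; [apply Hl1; now exists n|].
  apply Hl2; intros x [m ->]; apply Hle.
Qed.

(** A rectangle with nonzero integral has quarters, of all generations, whose
    integrals decrease at most by the factor 4; at the common point of the
    quarters this contradicts [oint_small]. *)
Theorem goursat k a b c d : a <= b -> c <= d ->
  (forall z, in_rect a b c d z -> Cdiff k z) -> oint k a b c d = 0.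
Proof.
intros Hab Hcd Hk.
apply Cmod_eq_0; apply Rle_antisym; [|apply Cmod_ge_0].
apply Rnot_lt_le; intros Hpos.
set (e := Cmod (oint k a b c d) / 2).
assert (He : 0 < e) by (unfold e; lra).
set (L := b - a); set (H := d - c).
assert (HL : 0 <= L) by (unfold L; lra).
assert (HH : 0 <= H) by (unfold H; lra).
assert (Hpn : forall (K : R) n, 0 <= K -> 0 <= K / 2 ^ n)
  by (intros; apply Rdiv_le_0_compat; [assumption|apply pow_lt; lra]).
assert (Hhalf : forall (K : R) n, K / 2 ^ S n = K / 2 ^ n / 2)
  by (intros; simpl; field; apply pow_nonzero; lra).
(* A rectangle of the n-th generation, given by its lower left corner. *)
set (ok := fun (n : nat) (p : R * R) =>
  (a <= fst p /\ fst p + L / 2 ^ n <= b /\ c <= snd p /\ snd p + H / 2 ^ n <= d) /\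
  e / 4 ^ n < Cmod (oint k (fst p) (fst p + L / 2 ^ n) (snd p) (snd p + H / 2 ^ n))).
assert (Hstep : forall n p, exists p', ok n p -> ok (S n) p' /\
  fst p <= fst p' <= fst p + L / 2 ^ S n /\ snd p <= snd p' <= snd p + H / 2 ^ S n).
{ intros n p.
  destruct (excluded_middle_informative (ok n p)) as [[Hin Hbig]|Hn];
    [|exists p; tauto].
  destruct (oint_quarter k (fst p) (snd p) (L / 2 ^ n) (H / 2 ^ n) (e / 4 ^ n))
    as (x' & y' & Hx & Hy & Hb); try auto.
  { intros z [Hz1 Hz2]; apply Cdiff_cont, Hk; split; lra. }
  exists (x', y'); intros _; unfold ok; simpl fst; simpl snd.
  rewrite !Hhalf; replace (e / 4 ^ S n) with (e / 4 ^ n / 4)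
    by (simpl; field; apply pow_nonzero; lra).
  repeat split; try lra; assumption. }
set (next := fun n p => proj1_sig (constructive_indefinite_description _ (Hstep n p))).
assert (Hnext : forall n p, ok n p -> ok (S n) (next n p) /\
  fst p <= fst (next n p) <= fst p + L / 2 ^ S n /\
  snd p <= snd (next n p) <= snd p + H / 2 ^ S n).
{ intros n p; unfold next.
  destruct (constructive_indefinite_description _ (Hstep n p)); assumption. }
set (s := nat_rect (fun _ => (R * R)%type) (a, c) next).
assert (Hs : forall n, ok n (s n)).
{ induction n as [|n IH]; [|apply Hnext, IH].
  unfold ok, s; simpl; rewrite !Rdiv_1_r.
  replace (a + L) with b by (unfold L; ring).
  replace (c + H) with d by (unfold H; ring).
  repeat split; try lra; unfold e; lra. }
destruct (nested_limit (fun n => fst (s n)) L HL) as [x Hx];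
  [intros n; apply (Hnext n (s n) (Hs n))|].
destruct (nested_limit (fun n => snd (s n)) H HH) as [y Hy];
  [intros n; apply (Hnext n (s n) (Hs n))|].
assert (Hxy : in_rect a b c d (x, y)).
{ specialize (Hx O); specialize (Hy O); simpl in Hx, Hy.
  unfold in_rect; simpl; unfold L, H in *; lra. }
(* The n-th rectangle has size [(L + H) / 2^n]; the 1 covers [L + H = 0]. *)
set (e' := e / ((L + H) ^ 2 + 1)).
assert (Hden : 0 < (L + H) ^ 2 + 1) by (generalize (pow2_ge_0 (L + H)); lra).
assert (He' : 0 < e') by now apply Rdiv_lt_0_compat.
destruct (oint_small k (x, y) e' (Hk _ Hxy) He') as [del [Hd Hsm]].
destruct (Pow_x_infinity 2 ltac:(rewrite Rabs_right; lra) ((L + H) / del + 1))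
  as [n Hn].
specialize (Hn n (Nat.le_refl n)).
assert (H2n : 0 < 2 ^ n) by (apply pow_lt; lra).
rewrite Rabs_right in Hn by lra.
destruct (Hs n) as [Hin Hbig].
assert (Hsmall : L / 2 ^ n + H / 2 ^ n < del).
{ rewrite <- Rdiv_plus_distr; apply Rlt_div_l; [assumption|].
  assert ((L + H) / del < 2 ^ n) by lra.
  apply Rlt_div_l in H0; lra. }
specialize (Hsm (fst (s n)) (fst (s n) + L / 2 ^ n) (snd (s n)) (snd (s n) + H / 2 ^ n)).
assert (HLn := Hpn L n HL); assert (HHn := Hpn H n HH).
assert (Hfin : Cmod (oint k (fst (s n)) (fst (s n) + L / 2 ^ n) (snd (s n))
  (snd (s n) + H / 2 ^ n)) <= e' * (L / 2 ^ n + H / 2 ^ n) ^ 2).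
{ eapply Rle_trans; [apply Hsm|].
  - lra.
  - lra.
  - specialize (Hx n); specialize (Hy n); unfold in_rect; simpl in *; lra.
  - intros z [Hz1 Hz2]; apply Cdiff_cont, Hk; split; lra.
  - lra.
  - right; f_equal; f_equal; ring. }
assert (H4n : 4 ^ n = 2 ^ n * 2 ^ n) by (rewrite <- Rpow_mult_distr; f_equal; ring).
assert (e' * (L / 2 ^ n + H / 2 ^ n) ^ 2 <= e / 4 ^ n).
{ replace (e' * (L / 2 ^ n + H / 2 ^ n) ^ 2)
    with ((e' * (L + H) ^ 2) / 4 ^ n) by (rewrite H4n; field; lra).
  apply Rmult_le_compat_r; [apply Rlt_le, Rinv_0_lt_compat, pow_lt; lra|].
  replace (e' * (L + H) ^ 2) with (e - e') by (unfold e'; field; lra).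
  lra. }
lra.
Qed.

Ltac rmin := unfold Rmin in *; repeat destruct (Rle_dec _ _); lra.
Ltac rmax := unfold Rmax in *; repeat destruct (Rle_dec _ _); lra.

Lemma Ccont_2d k x y : Ccont k (x, y) ->
  continuity_2d_pt (fun u v => fst (k (u, v))) x y /\
  continuity_2d_pt (fun u v => snd (k (u, v))) x y.
Proof.
intros Hk; split; intros eps; destruct (Hk eps (cond_pos eps)) as [del [Hd H]];
  assert (Hd2 : 0 < del / 2) by lra; exists (mkposreal _ Hd2);
  simpl; intros u v Hu Hv;
  assert (Hc : Cmod ((u, v) - (x, y)) < del)
    by (eapply Rle_lt_trans; [apply Cmod_le_sum|simpl; unfold Rminus in *; lra]).
- eapply Rle_lt_trans; [apply (Cmod_fst (k (u, v) - k (x, y))%C)|auto].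
- eapply Rle_lt_trans; [apply (Cmod_snd (k (u, v) - k (x, y))%C)|auto].
Qed.

Lemma Ccont_uniform k a b c d e :
  (forall z, in_rect a b c d z -> Ccont k z) -> 0 < e ->
  exists del, 0 < del /\ forall z w, in_rect a b c d z -> in_rect a b c d w ->
    Rabs (fst z - fst w) < del -> Rabs (snd z - snd w) < del ->
    Cmod (k z - k w) < e.
Proof.
intros Hk He; assert (He2 : 0 < e / 2) by lra.
destruct (uniform_continuity_2d (fun u v => fst (k (u, v))) a b c d) with
  (mkposreal _ He2) as [d1 H1].
{ intros x y Hx Hy; apply (Ccont_2d k), Hk; now split. }
destruct (uniform_continuity_2d (fun u v => snd (k (u, v))) a b c d) with
  (mkposreal _ He2) as [d2 H2].
{ intros x y Hx Hy; apply (Ccont_2d k), Hk; now split. }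
exists (Rmin d1 d2); split; [apply Rmin_glb_lt; apply cond_pos|].
intros [z1 z2] [w1 w2] [Hz1 Hz2] [Hw1 Hw2] Hf Hs; simpl in *.
specialize (H1 w1 w2 z1 z2 Hw1 Hw2 Hz1 Hz2 ltac:(rmin) ltac:(rmin)).
specialize (H2 w1 w2 z1 z2 Hw1 Hw2 Hz1 Hz2 ltac:(rmin) ltac:(rmin)).
eapply Rle_lt_trans; [apply Cmod_le_sum|]; simpl; unfold Rminus in *; lra.
Qed.

Lemma edge_bounded k (l : R -> C) a b : a <= b ->
  (forall s t, Cmod (l s - l t) = Rabs (s - t)) ->
  (forall t, a <= t <= b -> Ccont k (l t)) ->
  exists M, forall t, a <= t <= b -> Cmod (k (l t)) <= M.
Proof.
intros Hab Hl Hk.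
destruct (continuity_ab_maj (fun t => Cmod (k (l t))) a b Hab) as [t [Ht _]].
- intros t Ht; apply continuity_pt_filterlim, filterlim_locally; intros eps.
  destruct (Hk t Ht eps (cond_pos eps)) as [del [Hd H]].
  exists (mkposreal del Hd); intros s Hs; simpl in Hs.
  assert (Hc : Cmod (k (l s) - k (l t)) < eps) by (apply H; rewrite Hl; exact Hs).
  assert (H1 := Cmod_triangle_rev (k (l s)) (k (l t))).
  assert (H2 := Cmod_triangle_rev (k (l t)) (k (l s))).
  rewrite Cmod_minus_sym in H2.
  apply Rabs_lt_between; unfold minus, plus, opp; simpl; lra.
- exists (Cmod (k (l t))); auto.
Qed.

Lemma boundary_bounded k a b c d : a <= b -> c <= d ->
  (forall z, on_boundary a b c d z -> Ccont k z) ->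
  exists M, 0 < M /\ forall z, on_boundary a b c d z -> Cmod (k z) <= M.
Proof.
intros Hab Hcd Hk.
assert (Hh : forall y, y = c \/ y = d ->
  exists M, forall x, a <= x <= b -> Cmod (k (x, y)) <= M).
{ intros y Hy; apply (edge_bounded k (fun x => (x, y))); [assumption| |].
  - intros; apply Cmod_horizontal.
  - intros; apply Hk; destruct Hy; subst; edge. }
assert (Hv : forall x, x = a \/ x = b ->
  exists M, forall y, c <= y <= d -> Cmod (k (x, y)) <= M).
{ intros x Hx; apply (edge_bounded k (fun y => (x, y))); [assumption| |].
  - intros; apply Cmod_vertical.
  - intros; apply Hk; destruct Hx; subst; edge. }
destruct (Hh c) as [M1 H1], (Hh d) as [M2 H2], (Hv a) as [M3 H3], (Hv b) as [M4 H4];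
  try tauto.
exists (Rmax (Rmax (Rmax M1 M2) (Rmax M3 M4)) 1); split.
{ eapply Rlt_le_trans; [apply Rlt_0_1|apply Rmax_r]. }
intros [x y] [[Hx Hy] Hz]; simpl in *.
destruct Hz as [ -> | [ -> | [ -> | -> ]]];
  [specialize (H3 y Hy)|specialize (H4 y Hy)|specialize (H1 x Hx)|specialize (H2 x Hx)];
  rmax.
Qed.

(** The two long sides of a thin rectangle nearly cancel by uniform continuity,
    the two short ones are short. *)
Lemma oint_thin k a b c d e : a <= b -> c <= d ->
  (forall z, in_rect a b c d z -> Ccont k z) -> 0 < e ->
  exists del, 0 < del /\ forall al be, a <= al -> al <= be -> be <= b ->
    be - al < del -> Cmod (oint k al be c d) <= e.
Proof.
intros Hab Hcd Hk He.
destruct (boundary_bounded k a b c d Hab Hcd) as [M [HM Hbd]];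
  [intros z Hz; apply Hk, Hz|].
set (e1 := e / (4 * (d - c) + 1)).
assert (He1 : 0 < e1) by (apply Rdiv_lt_0_compat; lra).
destruct (Ccont_uniform k a b c d e1 Hk He1) as [d1 [Hd1 H1]].
assert (Hd2 : 0 < e / (8 * M)) by (apply Rdiv_lt_0_compat; lra).
exists (Rmin d1 (e / (8 * M))); split; [now apply Rmin_glb_lt|].
intros al be Hal Hle Hbe Hdel.
assert (M1 := Rmin_l d1 (e / (8 * M))); assert (M2 := Rmin_r d1 (e / (8 * M))).
assert (Hv : forall x, al <= x <= be -> path_cont (fun y => k (x, y)) c d).
{ intros x Hx; apply path_cont_v; intros y Hy; apply Hk; unfold in_rect; simpl; lra. }
assert (Hh : forall y, c <= y <= d -> path_cont (fun x => k (x, y)) al be).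
{ intros y Hy; apply path_cont_h; intros x Hx; apply Hk; unfold in_rect; simpl; lra. }
replace (oint k al be c d) with
  (Cint (fun x => k (x, c)) al be - Cint (fun x => k (x, d)) al be
   + Ci * Cint (fun y => k (be, y) + -1 * k (al, y)) c d)%C.
2:{ rewrite (Cint_plus (fun y => k (be, y)) (fun y => -1 * k (al, y))%C),
      (Cint_scal (-1) (fun y => k (al, y))); try assumption; try (apply Hv; lra).
    - unfold oint; ring.
    - intros t Ht; apply (Ccont_line (fun w => -1 * k w)%C (fun y => (al, y))).
      + intros; apply Cmod_vertical.
      + apply Ccont_mult; [apply Ccont_const|apply Hk; unfold in_rect; simpl; lra]. }
assert (B1 : Cmod (Cint (fun x => k (x, c)) al be) <= 2 * (M * (be - al))).
{ apply Cint_bound; [assumption|apply Hh; lra|]; intros t Ht; apply Hbd.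
  edge. }
assert (B2 : Cmod (Cint (fun x => k (x, d)) al be) <= 2 * (M * (be - al))).
{ apply Cint_bound; [assumption|apply Hh; lra|]; intros t Ht; apply Hbd.
  edge. }
assert (B3 : Cmod (Cint (fun y => k (be, y) + -1 * k (al, y))%C c d)
  <= 2 * (e1 * (d - c))).
{ apply Cint_bound; [assumption| |].
  - intros t Ht; unfold Cplus; simpl.
    destruct (Hv be ltac:(lra) t Ht) as [C1 C2], (Hv al ltac:(lra) t Ht) as [C3 C4].
    split; apply (continuous_plus (V := R_NormedModule)); try assumption.
    + apply (continuous_ext (fun s => opp (fst (k (al, s)))));
        [intros; unfold opp; simpl; ring|now apply (continuous_opp (V := R_NormedModule))].
    + apply (continuous_ext (fun s => opp (snd (k (al, s)))));
        [intros; unfold opp; simpl; ring|now apply (continuous_opp (V := R_NormedModule))].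
  - intros t Ht; replace (k (be, t) + -1 * k (al, t))%C
      with (k (be, t) - k (al, t))%C by ring.
    apply Rlt_le, H1; unfold in_rect; simpl; try lra.
    + rewrite Rabs_right; lra.
    + rewrite Rminus_diag, Rabs_R0; lra. }
eapply Rle_trans; [apply Cmod_triangle|]; rewrite Cmod_mult, Cmod_Ci.
eapply Rle_trans; [apply Rplus_le_compat_r, Cmod_triangle_sub|].
assert (M * (be - al) <= e / 8).
{ replace (e / 8) with (M * (e / (8 * M))) by (field; lra).
  apply Rmult_le_compat_l; lra. }
assert (2 * (e1 * (d - c)) <= e / 2).
{ replace (2 * (e1 * (d - c))) with (e / 2 - e1 / 2) by (unfold e1; field; lra); lra. }
lra.
Qed.

Lemma oint_degenerate k a c d : oint k a a c d = 0.
Proof.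
assert (H : forall f, Cint f a a = 0).
{ intros f; unfold Cint; rewrite !RInt_point; reflexivity. }
unfold oint; rewrite !H; ring.
Qed.

(** Continuity alone makes a whole vertical line removable for vanishing of
    boundary integrals. *)
Lemma oint_line k a b c d x0 : a <= b -> c <= d ->
  (forall z, in_rect a b c d z -> Ccont k z) ->
  (forall al be, a <= al -> al <= be -> be <= b -> be < x0 \/ x0 < al ->
    oint k al be c d = 0) ->
  oint k a b c d = 0.
Proof.
intros Hab Hcd Hk H0.
destruct (Rlt_dec x0 a) as [Hx|Hx]; [apply H0; lra|].
destruct (Rlt_dec b x0) as [Hx'|Hx']; [apply H0; lra|].
apply Cmod_eq_0, Rle_antisym; [|apply Cmod_ge_0].
apply le_epsilon; intros e He; rewrite Rplus_0_l.
destruct (oint_thin k a b c d e Hab Hcd Hk He) as [del [Hd Hthin]].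
set (al := Rmax a (x0 - del / 3)); set (be := Rmin b (x0 + del / 3)).
assert (Hal : a <= al /\ al <= x0 /\ x0 - del / 3 <= al /\ (al = a \/ al < x0))
  by (unfold al; rmax).
assert (Hbe : be <= b /\ x0 <= be /\ be <= x0 + del / 3 /\ (be = b \/ x0 < be))
  by (unfold be; rmin).
clearbody al be.
rewrite (oint_split_v k a al b), (oint_split_v k al be b)
  by (try lra; intros z Hz; apply Hk; unfold in_rect in *; lra).
replace (oint k a al c d) with (RtoC 0).
2:{ symmetry; destruct Hal as (? & ? & ? & [ -> |]); [apply oint_degenerate|]; apply H0; lra. }
replace (oint k be b c d) with (RtoC 0).
2:{ symmetry; destruct Hbe as (? & ? & ? & [ -> |]); [apply oint_degenerate|]; apply H0; lra. }
replace (0 + (oint k al be c d + 0))%C with (oint k al be c d) by ring.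
apply Hthin; lra.
Qed.

(** Two exceptional points: one for the singularity of the integrand of Cauchy's
    formula, one for a point where the function itself may not be known to be
    differentiable. *)
Lemma goursat_except k a b c d p q : a <= b -> c <= d ->
  (forall z, in_rect a b c d z -> Ccont k z) ->
  (forall z, in_rect a b c d z -> z <> p -> z <> q -> Cdiff k z) ->
  oint k a b c d = 0.
Proof.
intros Hab Hcd Hk Hd.
apply (oint_line k a b c d (fst p)); try assumption.
intros a1 b1 Ha1 Hab1 Hb1 Hp.
apply (oint_line k a1 b1 c d (fst q)); try assumption.
{ intros z Hz; apply Hk; unfold in_rect in *; lra. }
intros a2 b2 Ha2 Hab2 Hb2 Hq.
apply goursat; try assumption; intros z Hz; unfold in_rect in *; apply Hd; try lra.
- intros ->; lra.
- intros ->; lra.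
Qed.

(** * Cauchy's formula, removable singularities and the maximum principle *)

Definition inside (a b c d : R) (z : C) : Prop := a < fst z < b /\ c < snd z < d.

Definition margin (m a b c d : R) (z : C) : Prop :=
  0 < m /\ a + m <= fst z <= b - m /\ c + m <= snd z <= d - m.

Lemma inside_margin a b c d z : inside a b c d z -> exists m, margin m a b c d z.
Proof.
intros [Hx Hy].
exists (Rmin (Rmin (fst z - a) (b - fst z)) (Rmin (snd z - c) (d - snd z))).
unfold margin; rmin.
Qed.

Lemma margin_boundary m a b c d z w : margin m a b c d z -> on_boundary a b c d w ->
  m <= Cmod (w - z).
Proof.
intros (Hm & Hx & Hy) [_ Hw].
assert (H1 := Cmod_fst (w - z)%C); assert (H2 := Cmod_snd (w - z)%C); simpl in H1, H2.
apply Rabs_le_between in H1; apply Rabs_le_between in H2.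
destruct Hw as [Hw|[Hw|[Hw|Hw]]]; lra.
Qed.

Lemma margin_ball m a b c d z w : margin m a b c d z -> Cmod (w - z) < m ->
  inside a b c d w.
Proof.
intros (Hm & Hx & Hy) Hw.
assert (H1 := Cmod_fst (w - z)%C); assert (H2 := Cmod_snd (w - z)%C); simpl in H1, H2.
apply Rabs_le_between in H1; apply Rabs_le_between in H2; unfold inside; lra.
Qed.

Lemma inside_le a b c d z : inside a b c d z -> a <= b /\ c <= d.
Proof. unfold inside; lra. Qed.

Lemma inside_in a b c d z : inside a b c d z -> in_rect a b c d z.
Proof. unfold inside, in_rect; lra. Qed.

Lemma inside_neq a b c d z w : inside a b c d z -> on_boundary a b c d w -> w <> z.
Proof. intros Hz [_ Hw] ->; unfold inside in Hz; lra. Qed.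

Lemma Ccont_kernel z w : w <> z -> Ccont (fun v => / (v - z))%C w.
Proof.
intros H; apply (Ccont_inv (fun v => v - z)%C); [|now apply Cminus_neq].
apply Ccont_minus; [apply Ccont_id|apply Ccont_const].
Qed.

(** The winding integral; its imaginary part is positive edge by edge. *)
Lemma oint_kernel_neq_0 a b c d z : inside a b c d z ->
  oint (fun w => / (w - z))%C a b c d <> 0.
Proof.
intros Hz; destruct (inside_le _ _ _ _ _ Hz) as [Hab Hcd].
destruct z as [zx zy], Hz as [Hx Hy]; simpl in Hx, Hy.
assert (Hz : inside a b c d (zx, zy)) by now split.
destruct (edges_Pcont (fun w => / (w - (zx, zy)))%C a b c d Hab Hcd)
  as (C1 & C2 & C3 & C4).
{ intros w Hw; apply Ccont_kernel; eapply inside_neq; eauto. }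
assert (Hq : forall u v, u <> 0 \/ v <> 0 -> 0 < u ^ 2 + v ^ 2) by (intros; nra).
assert (Hpos : forall f l r, l < r ->
  (forall t, l <= t <= r -> continuous f t) -> (forall t, l < t < r -> 0 < f t) ->
  0 < RInt f l r) by (intros; now apply RInt_gt_0).
assert (Hneg : forall f l r, l < r ->
  (forall t, l <= t <= r -> continuous f t) -> (forall t, l < t < r -> f t < 0) ->
  RInt f l r < 0).
{ intros f l r Hlr Hf Hlt.
  assert (H := RInt_lt f (fun _ => 0) l r Hlr).
  rewrite RInt_const in H; unfold scal in H; simpl in H; unfold mult in H; simpl in H.
  rewrite Rmult_0_r in H; apply H; try assumption.
  intros; apply continuous_const. }
assert (I1 : 0 < snd (Cint (fun x => / ((x, c) - (zx, zy)))%C a b)).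
{ apply (Hpos (fun x => snd (/ ((x, c) - (zx, zy)))%C));
    [lra|intros t Ht; exact (proj2 (C1 t Ht))|].
  intros t Ht; simpl; apply Rdiv_lt_0_compat; [lra|apply Hq; right; lra]. }
assert (I3 : snd (Cint (fun x => / ((x, d) - (zx, zy)))%C a b) < 0).
{ apply (Hneg (fun x => snd (/ ((x, d) - (zx, zy)))%C));
    [lra|intros t Ht; exact (proj2 (C3 t Ht))|].
  intros t Ht; simpl; apply Ropp_lt_cancel; rewrite Ropp_0, <- Rdiv_opp_l.
  apply Rdiv_lt_0_compat; [lra|apply Hq; right; lra]. }
assert (I2 : 0 < fst (Cint (fun y => / ((b, y) - (zx, zy)))%C c d)).
{ apply (Hpos (fun y => fst (/ ((b, y) - (zx, zy)))%C));
    [lra|intros t Ht; exact (proj1 (C2 t Ht))|].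
  intros t Ht; simpl; apply Rdiv_lt_0_compat; [lra|apply Hq; left; lra]. }
assert (I4 : fst (Cint (fun y => / ((a, y) - (zx, zy)))%C c d) < 0).
{ apply (Hneg (fun y => fst (/ ((a, y) - (zx, zy)))%C));
    [lra|intros t Ht; exact (proj1 (C4 t Ht))|].
  intros t Ht; simpl; apply Ropp_lt_cancel; rewrite Ropp_0, <- Rdiv_opp_l.
  apply Rdiv_lt_0_compat; [lra|apply Hq; left; lra]. }
intros E; apply (f_equal snd) in E; revert E.
unfold oint; revert I1 I2 I3 I4.
generalize (Cint (fun x => / ((x, c) - (zx, zy)))%C a b)
  (Cint (fun x => / ((x, d) - (zx, zy)))%C a b)
  (Cint (fun y => / ((b, y) - (zx, zy)))%C c d)
  (Cint (fun y => / ((a, y) - (zx, zy)))%C c d).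
intros X1 X2 X3 X4; simpl; lra.
Qed.

(** The difference quotient [slope h z l] is continuous on the rectangle and
    differentiable off [z] and [p], so its integral vanishes. *)
Lemma cauchy_formula h a b c d p z : inside a b c d z ->
  (forall w, in_rect a b c d w -> Ccont h w) ->
  (forall w, in_rect a b c d w -> w <> p -> Cdiff h w) -> z <> p ->
  oint (fun w => h w / (w - z))%C a b c d =
  (h z * oint (fun w => / (w - z)) a b c d)%C.
Proof.
intros Hz Hc Hd Hzp; destruct (inside_le _ _ _ _ _ Hz) as [Hab Hcd].
destruct (Hd z (inside_in _ _ _ _ _ Hz) Hzp) as [l Hl].
assert (Hnear : forall w, w <> z -> near w (fun v => ((h v - h z) / (v - z))%C = slope h z l v)).
{ intros w Hw.
  assert (Hw0 := Ccont_neq_0 (fun v => v - z)%C w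
    (Ccont_minus _ _ _ (Ccont_id w) (Ccont_const z w)) (Cminus_neq _ _ Hw)).
  revert Hw0; apply near_imp; intros v Hv.
  rewrite slope_ne; [reflexivity|intros ->; apply Hv; ring]. }
assert (H0 : oint (slope h z l) a b c d = 0).
{ apply (goursat_except _ _ _ _ _ p z); try assumption.
  - intros w Hw; destruct (excluded_middle_informative (w = z)) as [->|Hwz]; [assumption|].
    apply (Ccont_ext_near _ _ _ (Hnear w Hwz)).
    apply Ccont_mult; [|now apply Ccont_kernel].
    apply Ccont_minus; [now apply Hc|apply Ccont_const].
  - intros w Hw Hwp Hwz; apply (Cdiff_ext_near _ _ _ (Hnear w Hwz)).
    apply Cdiff_div; [| |now apply Cminus_neq]; apply Cdiff_minus;
      try apply Cdiff_const; [now apply Hd|apply Cdiff_id]. }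
rewrite (oint_ext _ (fun w => h w / (w - z) + - h z * / (w - z))%C) in H0;
  try assumption.
2:{ intros w Hw; assert (Hwz := inside_neq _ _ _ _ _ _ Hz Hw).
    rewrite slope_ne by assumption; field; now apply Cminus_neq. }
rewrite oint_plus in H0; try assumption.
- rewrite oint_scal in H0; try assumption.
  + rewrite <- (Cplus_0_r (oint (fun w => (h w / (w - z))%C) a b c d)).
    replace (RtoC 0) with (oint (fun w => (/ (w - z))%C) a b c d * h z
      + - h z * oint (fun w => (/ (w - z))%C) a b c d)%C by ring.
    rewrite (Cplus_comm (_ * h z)), Cplus_assoc, H0; ring.
  + intros w Hw; apply Ccont_kernel; eapply inside_neq; eauto.
- intros w Hw; apply Ccont_mult; [apply Hc, Hw|].
  apply Ccont_kernel; eapply inside_neq; eauto.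
- intros w Hw; apply Ccont_mult; [apply Ccont_const|].
  apply Ccont_kernel; eapply inside_neq; eauto.
Qed.

Lemma near_dist p m : 0 < m -> near p (fun z => Cmod (z - p) < m).
Proof. intros Hm; exists m; auto. Qed.

(** The difference quotient at [p] of the integral is the integral of
    [phi w / ((w - z) (w - p))], which depends continuously on [z]. *)
Lemma cauchy_integral_diff phi a b c d p : inside a b c d p ->
  (forall w, on_boundary a b c d w -> Ccont phi w) ->
  Cdiff (fun z => oint (fun w => phi w / (w - z))%C a b c d) p.
Proof.
intros Hp Hphi; destruct (inside_le _ _ _ _ _ Hp) as [Hab Hcd].
destruct (inside_margin _ _ _ _ _ Hp) as [m Hmar]; assert (Hm := proj1 Hmar).
assert (Hdist := fun w => margin_boundary m a b c d p w Hmar).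
destruct (boundary_bounded phi a b c d Hab Hcd Hphi) as [M [HM Hbd]].
assert (Hneq : forall z, Cmod (z - p) < m / 2 -> forall w, on_boundary a b c d w ->
  m / 2 <= Cmod (w - z) /\ w <> z).
{ intros z Hz w Hw; specialize (Hdist w Hw).
  assert (m / 2 <= Cmod (w - z)).
  { assert (H := Cmod_triangle_rev (w - p) (z - p)).
    replace (w - p - (z - p))%C with (w - z)%C in H by ring; lra. }
  split; [assumption|]; intros ->.
  replace (z - z)%C with (RtoC 0) in * by ring; rewrite Cmod_0 in *; lra. }
assert (Hpp : Cmod (p - p) < m / 2)
  by (replace (p - p)%C with (RtoC 0) by ring; rewrite Cmod_0; lra).
set (psi := fun z => oint (fun w => phi w / (w - z) / (w - p))%C a b c d).
exists (psi p); apply is_Cderiv_intro.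
- set (K := M / (m / 2) / m / m); set (P := (b - a) + (d - c)).
  assert (HK : 0 < K) by (repeat apply Rdiv_lt_0_compat; lra).
  assert (HP : 0 <= P) by (unfold P; lra).
  intros e He; set (D := 4 * (K * P) + 1).
  assert (HKP : 0 <= K * P) by (apply Rmult_le_pos; lra).
  assert (HD : 0 < D) by (unfold D; lra).
  exists (Rmin (m / 2) (e / D)); split.
  { apply Rmin_glb_lt; [lra|now apply Rdiv_lt_0_compat]. }
  intros z Hz; assert (Hz1 : Cmod (z - p) < m / 2)
    by (eapply Rlt_le_trans; [exact Hz|apply Rmin_l]).
  assert (Hz2 : Cmod (z - p) < e / D)
    by (eapply Rlt_le_trans; [exact Hz|apply Rmin_r]).
  assert (Hcont : forall z, Cmod (z - p) < m / 2 -> forall w, on_boundary a b c d w ->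
    Ccont (fun w => phi w / (w - z) / (w - p))%C w).
  { intros v Hv w Hw; repeat apply Ccont_mult; [now apply Hphi|apply Ccont_kernel..].
    - now apply (Hneq v Hv).
    - now apply (Hneq p Hpp). }
  eapply Rle_lt_trans.
  + apply (oint_close _ _ _ _ _ _ (K * Cmod (z - p))); try assumption;
      try (now apply Hcont).
    intros w Hw; destruct (Hneq z Hz1 w Hw) as [G1 G2].
    destruct (Hneq p Hpp w Hw) as [_ G4]; assert (G3 := Hdist w Hw).
    replace (phi w / (w - z) / (w - p) - phi w / (w - p) / (w - p))%C
      with (phi w / (w - z) / (w - p) / (w - p) * (z - p))%C
      by (field; split; now apply Cminus_neq).
    rewrite Cmod_mult, !Cmod_div by (now apply Cminus_neq).
    apply Rmult_le_compat_r; [apply Cmod_ge_0|].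
    unfold K, Rdiv.
    repeat (apply Rmult_le_compat; [| |
       |apply Rinv_le_contravar; lra]); auto;
      repeat apply Rmult_le_pos; try apply Cmod_ge_0;
      apply Rlt_le, Rinv_0_lt_compat; lra.
  + replace (4 * (K * Cmod (z - p) * ((b - a) + (d - c))))
      with (4 * (K * P) * Cmod (z - p)) by (unfold P; ring).
    apply Rle_lt_trans with (4 * (K * P) * (e / D)).
    * apply Rmult_le_compat_l; lra.
    * replace (4 * (K * P)) with (D - 1) by (unfold D; ring).
      assert (0 < e / D) by now apply Rdiv_lt_0_compat.
      replace ((D - 1) * (e / D)) with (e - e / D) by (field; lra); lra.
- generalize (near_dist p (m / 2) ltac:(lra)); apply near_imp; intros z Hz.
  assert (Hcont : forall w, on_boundary a b c d w -> Ccont (fun w => phi w / (w - p))%C w).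
  { intros w Hw; apply Ccont_mult; [now apply Hphi|apply Ccont_kernel].
    now apply (Hneq p Hpp). }
  assert (Hcont2 : forall w, on_boundary a b c d w ->
    Ccont (fun w => phi w / (w - z) / (w - p))%C w).
  { intros w Hw; repeat apply Ccont_mult; [now apply Hphi|apply Ccont_kernel..].
    - now apply (Hneq z Hz).
    - now apply (Hneq p Hpp). }
  rewrite (oint_ext _ (fun w => phi w / (w - p) + (z - p) * (phi w / (w - z) / (w - p)))%C);
    try assumption.
  + rewrite oint_plus, oint_scal; try assumption; [unfold psi; ring|].
    intros w Hw; apply Ccont_mult; [apply Ccont_const|now apply Hcont2].
  + intros w Hw; field; split; apply Cminus_neq; eapply Hneq; eassumption.
Qed.

Lemma near_inside a b c d p : inside a b c d p -> near p (inside a b c d).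
Proof.
intros Hp; destruct (inside_margin _ _ _ _ _ Hp) as [m Hm]; exists m; split; [apply Hm|].
intros z; now apply margin_ball.
Qed.

(** Off [p], Cauchy's formula displays [h] as the quotient of two integrals that
    are differentiable at [p]; by continuity the formula persists at [p]. *)
Theorem removable_singularity h a b c d p : inside a b c d p ->
  (forall w, in_rect a b c d w -> Ccont h w) ->
  (forall w, in_rect a b c d w -> w <> p -> Cdiff h w) -> Cdiff h p.
Proof.
intros Hp Hc Hd.
assert (DJ := cauchy_integral_diff h a b c d p Hp (fun w Hw => Hc w (proj1 Hw))).
assert (DI := cauchy_integral_diff (fun _ => 1%C) a b c d p Hp
  (fun w _ => Ccont_const 1%C w)).
assert (HI : forall z, oint (fun w => 1 / (w - z))%C a b c d =
  oint (fun w => / (w - z))%C a b c d).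
{ intros z; f_equal; apply FunctionalExtensionality.functional_extensionality.
  intros w; unfold Cdiv; ring. }
set (J := fun z => oint (fun w => h w / (w - z))%C a b c d) in *.
set (I := fun z => oint (fun w => 1 / (w - z))%C a b c d) in *.
assert (HIp : I p <> 0) by (unfold I; rewrite HI; now apply oint_kernel_neq_0).
assert (DQ : Cdiff (fun z => J z / I z)%C p) by now apply Cdiff_div.
assert (Hoff : near p (fun z => z <> p -> (J z / I z)%C = h z)).
{ generalize (near_inside _ _ _ _ _ Hp); apply near_imp; intros z Hz Hzp.
  assert (HIz : I z <> 0) by (unfold I; rewrite HI; now apply oint_kernel_neq_0).
  assert (HJ : J z = (h z * I z)%C).
  { unfold J, I; rewrite HI; now apply (cauchy_formula h a b c d p z). }
  rewrite HJ; field; assumption. }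
assert (Hat : (J p / I p)%C = h p).
{ apply (Ccont_eq_at (fun z => J z / I z)%C h p); try assumption.
  - now apply Cdiff_cont.
  - apply Hc; now apply inside_in. }
apply (Cdiff_ext_near (fun z => J z / I z)%C); [|assumption].
revert Hoff; apply near_imp; intros z Hz.
destruct (excluded_middle_informative (z = p)) as [->|]; auto.
Qed.

(** Landau's trick: Cauchy's formula for the n-th power of [h] loses a constant
    factor that does not depend on [n]. *)
Theorem maximum_principle h a b c d m z : inside a b c d z ->
  (forall w, in_rect a b c d w -> Cdiff h w) ->
  (forall w, on_boundary a b c d w -> Cmod (h w) <= m) -> Cmod (h z) <= m.
Proof.
intros Hz Hd Hm; destruct (inside_le _ _ _ _ _ Hz) as [Hab Hcd].
destruct (inside_margin _ _ _ _ _ Hz) as [mu Hmar]; assert (Hmu := proj1 Hmar).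
assert (Hdist := fun w => margin_boundary mu a b c d z w Hmar).
assert (HI := oint_kernel_neq_0 _ _ _ _ _ Hz).
assert (HI' := proj1 (Cmod_gt_0 _) HI).
set (I := oint (fun w => / (w - z))%C a b c d) in *.
set (P := (b - a) + (d - c)).
assert (Hm0 : 0 <= m).
{ eapply Rle_trans; [apply Cmod_ge_0|apply (Hm (a, c))].
  edge. }
set (K := 4 * P / (mu * Cmod I)).
assert (Hpow : forall n, Cmod (h z) ^ n <= K * m ^ n).
{ intros n.
  assert (Hf := cauchy_formula (fun w => h w ^ n)%C a b c d (z + 1)%C z Hz).
  rewrite <- Cmod_pow.
  apply Rmult_le_reg_r with (Cmod I); [assumption|].
  rewrite <- Cmod_mult; unfold I at 1; rewrite <- Hf.
  - replace (K * m ^ n * Cmod I) with (4 * (m ^ n / mu * P)) by (unfold K; field; lra).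
    apply oint_bound; try assumption.
    + intros w Hw; apply Ccont_mult.
      * apply (Ccont_pow h), Cdiff_cont, Hd, Hw.
      * apply Ccont_kernel; eapply inside_neq; eauto.
    + intros w Hw.
      rewrite Cmod_div by (apply Cminus_neq; eapply inside_neq; eauto).
      apply Rmult_le_compat; [apply Cmod_ge_0| | |].
      * apply Rlt_le, Rinv_0_lt_compat; eapply Rlt_le_trans; [exact Hmu|auto].
      * rewrite Cmod_pow; apply pow_incr; split; [apply Cmod_ge_0|auto].
      * apply Rinv_le_contravar; auto.
  - intros w Hw; apply (Ccont_pow h), Cdiff_cont, Hd, Hw.
  - intros w Hw _; apply (Cdiff_pow h), Hd, Hw.
  - intros E; apply (f_equal fst) in E; simpl in E; lra. }
apply Rnot_lt_le; intros Hlt.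
destruct (Req_dec m 0) as [->|Hm1].
- specialize (Hpow 1%nat); simpl in Hpow; rewrite !Rmult_1_r, Rmult_0_r in Hpow; lra.
- assert (Hr : 1 < Cmod (h z) / m) by (apply Rlt_div_r; lra).
  destruct (Pow_x_infinity (Cmod (h z) / m) ltac:(rewrite Rabs_right; lra) (K + 1))
    as [n Hn].
  specialize (Hn n (Nat.le_refl n)); specialize (Hpow n).
  rewrite Rabs_right in Hn by (apply Rle_ge, pow_le; lra).
  unfold Rdiv in Hn; rewrite Rpow_mult_distr, pow_inv in Hn.
  assert (Hmn : 0 < m ^ n) by (apply pow_lt; lra).
  assert (Cmod (h z) ^ n * / m ^ n <= K).
  { apply Rmult_le_reg_r with (m ^ n); [assumption|].
    rewrite Rmult_assoc, Rinv_l, Rmult_1_r by lra; assumption. }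
  lra.
Qed.

Definition crect (T B : R) (z : C) : Prop := in_rect (- T) T (- B) B z.

Definition cbound (T B : R) (z : C) : Prop := on_boundary (- T) T (- B) B z.

(** * The Schwarz lemma and the Schur step on a rectangle *)

Lemma rect_inside T B z : rect T B z <-> inside (- T) T (- B) B z.
Proof.
unfold rect, inside, Re, Im; split; intros [H1 H2].
- apply Rabs_def2 in H1; apply Rabs_def2 in H2; lra.
- split; apply Rabs_def1; lra.
Qed.

Lemma rect_crect T B z : rect T B z -> crect T B z.
Proof. intros H; now apply inside_in, rect_inside. Qed.

(** The quotient of the two squared moduli is the square of the
    pseudo-hyperbolic distance of [x] and [y]. *)
Lemma pseudo_hyperbolic x y :
  Cmod (1 - Cconj y * x) ^ 2 = Cmod (x - y) ^ 2 + (1 - Cmod x ^ 2) * (1 - Cmod y ^ 2).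
Proof. rewrite !Cmod2_alt; destruct x, y; simpl; ring. Qed.

Lemma Cmod_sqr_le x y : Cmod x ^ 2 <= Cmod y ^ 2 -> Cmod x <= Cmod y.
Proof.
intros H; apply Rsqr_incr_0; unfold Rsqr; [simpl in H; lra|apply Cmod_ge_0..].
Qed.

Lemma Cmod_sqr_le_1 x : Cmod x <= 1 -> 0 <= 1 - Cmod x ^ 2.
Proof. intros H; assert (H0 := Cmod_ge_0 x); nra. Qed.

Lemma pseudo_hyperbolic_le x y : Cmod x <= 1 -> Cmod y <= 1 ->
  Cmod (x - y) <= Cmod (1 - Cconj y * x).
Proof.
intros Hx Hy; apply Cmod_sqr_le; rewrite pseudo_hyperbolic.
assert (H1 := Cmod_sqr_le_1 x Hx); assert (H2 := Cmod_sqr_le_1 y Hy).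
assert (0 <= (1 - Cmod x ^ 2) * (1 - Cmod y ^ 2)) by now apply Rmult_le_pos.
lra.
Qed.

Lemma one_minus_neq_0 x : Cmod x < 1 -> (1 - x)%C <> 0.
Proof.
intros H E; replace x with (1 - (1 - x))%C in H by ring.
rewrite E in H; replace (1 - 0)%C with (RtoC 1) in H by ring; rewrite Cmod_1 in H; lra.
Qed.

Lemma slope_diff h p d z : Cdiff h z -> z <> p -> Cdiff (slope h p d) z.
Proof.
intros Hh Hz.
apply (Cdiff_ext_near (fun w => (h w - h p) / (w - p))%C).
- assert (H := Ccont_neq_0 (fun v => v - p)%C z
    (Ccont_minus _ _ _ (Ccont_id z) (Ccont_const p z)) (Cminus_neq _ _ Hz)).
  revert H; apply near_imp; intros w Hw; rewrite slope_ne; [reflexivity|].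
  intros ->; apply Hw; ring.
- apply Cdiff_div; [| |now apply Cminus_neq]; apply Cdiff_minus;
    try apply Cdiff_const; [assumption|apply Cdiff_id].
Qed.

(** The Schwarz lemma with the distance to [p] in the role of the modulus: the
    difference quotient at [p] is at most [1 / m] on the boundary. *)
Lemma schwarz_margin k m a b c d p : margin m a b c d p ->
  (forall w, in_rect a b c d w -> Cdiff k w /\ Cmod (k w) <= 1) ->
  k p = 0 -> forall w, Cmod (w - p) < m -> Cmod (k w) * m <= Cmod (w - p).
Proof.
intros Hmar Hk Hp w Hw; assert (Hm := proj1 Hmar).
assert (Hin : inside a b c d p) by (unfold inside, margin in *; lra).
destruct (Hk p (inside_in _ _ _ _ _ Hin)) as [[l Hl] _].
assert (Dk : forall z, in_rect a b c d z -> z <> p -> Cdiff (slope k p l) z).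
{ intros z Hz Hzp; apply slope_diff; [now apply Hk|assumption]. }
assert (D0 : Cdiff (slope k p l) p).
{ apply (removable_singularity _ _ _ _ _ _ Hin); [|assumption].
  intros z Hz; destruct (excluded_middle_informative (z = p)) as [->|Hzp]; [assumption|].
  apply Cdiff_cont; now apply Dk. }
assert (Hb : Cmod (slope k p l w) <= / m).
{ apply (maximum_principle (slope k p l) a b c d).
  - now apply (margin_ball m a b c d p).
  - intros z Hz; destruct (excluded_middle_informative (z = p)) as [->|Hzp]; auto.
  - intros z Hz; assert (Hzp := inside_neq _ _ _ _ _ _ Hin Hz).
    assert (Hdist := margin_boundary _ _ _ _ _ _ _ Hmar Hz).
    rewrite slope_ne, Hp by assumption.
    replace (k z - 0)%C with (k z) by ring; rewrite Cmod_div by now apply Cminus_neq.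
    unfold Rdiv; rewrite <- (Rmult_1_l (/ m)).
    apply Rmult_le_compat; [apply Cmod_ge_0| |apply Hk, Hz|now apply Rinv_le_contravar].
    apply Rlt_le, Rinv_0_lt_compat; lra. }
rewrite (slope_eq k p l w), Hp, Cplus_0_l, Cmod_mult.
assert (H0 := Cmod_ge_0 (w - p)).
replace (Cmod (w - p)) with (/ m * Cmod (w - p) * m) at 2 by (field; lra).
apply Rmult_le_compat_r; [lra|]; apply Rmult_le_compat_r; assumption.
Qed.

(** Composing with an automorphism of the disk that moves [a h p] to the
    origin, [a < 1], and letting [a] tend to 1. *)
Lemma strong_maximum_local h m x0 x1 y0 y1 p : margin m x0 x1 y0 y1 p ->
  (forall w, in_rect x0 x1 y0 y1 w -> Cdiff h w /\ Cmod (h w) <= 1) ->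
  Cmod (h p) = 1 -> forall w, Cmod (w - p) < m -> h w = h p.
Proof.
intros Hmar Hh Hp w Hw; assert (Hm := proj1 Hmar); set (om := h p) in *.
assert (Hw1 : Cmod (h w) <= 1) by (apply Hh, inside_in, (margin_ball _ _ _ _ _ _ _ Hmar Hw)).
assert (Key : forall a, 0 < a < 1 ->
  a * Cmod (h w - om) * m <= Cmod (w - p) * Cmod (1 - RtoC (a * a) * (Cconj om * h w))).
{ intros a Ha.
  assert (Hsmall : forall x, Cmod x <= 1 -> Cmod (RtoC (a * a) * (Cconj om * x)) < 1).
  { intros x Hx; rewrite !Cmod_mult, Cmod_R, Cmod_conj, Hp, Rabs_right by nra.
    assert (H := Cmod_ge_0 x); nra. }
  set (k := fun z => ((RtoC a * h z - RtoC a * om) / (1 - RtoC (a * a) * (Cconj om * h z)))%C).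
  assert (Hk : Cmod (k w) * m <= Cmod (w - p)).
  { apply (schwarz_margin k m x0 x1 y0 y1 p Hmar);
      [|unfold k; fold om; unfold Cdiv; ring|assumption].
    intros z Hz; destruct (Hh z Hz) as [Dz Bz].
    assert (Hd := one_minus_neq_0 _ (Hsmall (h z) Bz)); split.
    - apply Cdiff_div; [| |assumption].
      + apply Cdiff_minus; [apply Cdiff_mult; [apply Cdiff_const|assumption]|apply Cdiff_const].
      + apply Cdiff_minus; [apply Cdiff_const|].
        repeat (apply Cdiff_mult; [apply Cdiff_const|]); assumption.
    - unfold k; rewrite Cmod_div by assumption.
      apply Rle_div_l; [now apply Cmod_gt_0|]; rewrite Rmult_1_l.
      replace (RtoC (a * a) * (Cconj om * h z))%C with (Cconj (RtoC a * om) * (RtoC a * h z))%C.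
      + apply pseudo_hyperbolic_le; rewrite Cmod_mult, Cmod_R, Rabs_right by lra.
        * assert (H := Cmod_ge_0 (h z)); nra.
        * rewrite Hp; lra.
      + rewrite Cmult_conj, RtoC_mult, Cconj_real; ring. }
  assert (Hd := one_minus_neq_0 _ (Hsmall (h w) Hw1)); assert (Hd' := proj1 (Cmod_gt_0 _) Hd).
  unfold k in Hk; rewrite Cmod_div in Hk by assumption.
  replace (RtoC a * h w - RtoC a * om)%C with (RtoC a * (h w - om))%C in Hk by ring.
  rewrite Cmod_mult, Cmod_R, Rabs_right in Hk by lra.
  set (D := Cmod (1 - RtoC (a * a) * (Cconj om * h w))) in *.
  replace (a * Cmod (h w - om) * m) with (a * Cmod (h w - om) / D * m * D) by (field; lra).
  apply Rmult_le_compat_r; lra. }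
assert (Hlim : Cmod (1 - Cconj om * h w) = Cmod (h w - om)).
{ replace (1 - Cconj om * h w)%C with (Cconj om * (om - h w))%C.
  - rewrite Cmod_mult, Cmod_conj, Hp, Cmod_minus_sym; ring.
  - assert (H := Cmod2_conj om); rewrite Hp, pow1 in H.
    transitivity (om * Cconj om - Cconj om * h w)%C; [ring|]; rewrite <- H; reflexivity. }
destruct (excluded_middle_informative (h w = om)) as [|Hne]; [assumption|exfalso].
assert (Hpos := proj1 (Cmod_gt_0 _) (Cminus_neq _ _ Hne)).
set (X := Cmod (h w - om)) in *.
assert (Hall : forall a, 0 < a < 1 -> a * X * m <= Cmod (w - p) * (X + 2 * (1 - a))).
{ intros a Ha; eapply Rle_trans; [apply Key, Ha|].
  apply Rmult_le_compat_l; [apply Cmod_ge_0|].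
  replace (1 - RtoC (a * a) * (Cconj om * h w))%C
    with ((1 - Cconj om * h w) + RtoC (1 - a * a) * (Cconj om * h w))%C
    by (rewrite RtoC_minus; ring).
  eapply Rle_trans; [apply Cmod_triangle|]; rewrite Hlim; apply Rplus_le_compat_l.
  rewrite !Cmod_mult, Cmod_R, Cmod_conj, Hp, Rabs_right by nra.
  assert (H := Cmod_ge_0 (h w)); rewrite Rmult_1_l.
  apply Rle_trans with ((1 - a * a) * 1); [apply Rmult_le_compat_l; [nra|assumption]|nra]. }
set (t := Cmod (w - p)) in *; assert (Ht := Cmod_ge_0 (w - p)); fold t in Ht.
set (e := X * (m - t) / (2 * (X * m + 2 * t))).
assert (Hden : 0 < X * m + 2 * t) by (assert (0 < X * m) by nra; lra).
assert (Hnum : 0 < X * (m - t)) by (apply Rmult_lt_0_compat; lra).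
assert (He : 0 < e) by (apply Rdiv_lt_0_compat; lra).
assert (He1 : e < 1) by (apply Rlt_div_l; [lra|nra]).
specialize (Hall (1 - e) ltac:(lra)).
assert (e * (X * m + 2 * t) = X * (m - t) / 2) by (unfold e; field; lra).
nra.
Qed.

(** The local version propagates along the segment from [p] to [w], in steps
    shorter than the distance of the segment to the boundary. *)
Theorem strong_maximum T B h p : rect T B p ->
  (forall w, rect T B w -> Cdiff h w /\ Cmod (h w) <= 1) ->
  Cmod (h p) = 1 -> forall w, rect T B w -> h w = h p.
Proof.
intros Hp Hh H1 w Hw.
assert (HT : exists m, 0 < m /\ Rabs (fst p) + 2 * m < T /\ Rabs (fst w) + 2 * m < T /\
  Rabs (snd p) + 2 * m < B /\ Rabs (snd w) + 2 * m < B).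
{ destruct Hp as [P1 P2], Hw as [W1 W2]; unfold Re, Im in *.
  exists (Rmin (Rmin (T - Rabs (fst p)) (T - Rabs (fst w)))
    (Rmin (B - Rabs (snd p)) (B - Rabs (snd w))) / 3); rmin. }
destruct HT as (m & Hm & M1 & M2 & M3 & M4).
assert (Hin : forall v, in_rect (- (T - m)) (T - m) (- (B - m)) (B - m) v -> rect T B v).
{ intros v [V1 V2]; apply rect_inside; unfold inside; lra. }
assert (Hc : forall x y L t, 0 <= t <= 1 -> Rabs x + 2 * m < L -> Rabs y + 2 * m < L ->
  - (L - m) + m <= x + t * (y - x) <= L - m - m).
{ intros x y L t Ht Hx Hy; assert (X := Rcomplements.Rabs_le_between x (L - 2 * m)).
  assert (Y := Rcomplements.Rabs_le_between y (L - 2 * m)).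
  assert (X1 := proj1 X ltac:(lra)); assert (Y1 := proj1 Y ltac:(lra)).
  assert (0 <= (1 - t) * (L - 2 * m - x) + t * (L - 2 * m - y))
    by (apply Rplus_le_le_0_compat; apply Rmult_le_pos; lra).
  assert (0 <= (1 - t) * (L - 2 * m + x) + t * (L - 2 * m + y))
    by (apply Rplus_le_le_0_compat; apply Rmult_le_pos; lra).
  lra. }
destruct (Pow_x_infinity 2 ltac:(rewrite Rabs_right; lra) (Cmod (w - p) / m + 1)) as [n Hn].
specialize (Hn n (Nat.le_refl n)); rewrite Rabs_right in Hn by (apply Rle_ge, pow_le; lra).
set (N := 2 ^ n) in *; assert (HN : 0 < N) by (apply pow_lt; lra).
assert (HNn : N = INR (2 ^ n)) by (rewrite pow_INR; reflexivity).
assert (Hstep : Cmod (w - p) / N < m).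
{ apply Rlt_div_l; [assumption|].
  assert (Cmod (w - p) / m < N) by lra.
  apply Rlt_div_l in H; lra. }
set (pt := fun k : nat => (p + RtoC (INR k / N) * (w - p))%C).
assert (Hpt : forall k, fst (pt k) = fst p + INR k / N * (fst w - fst p) /\
  snd (pt k) = snd p + INR k / N * (snd w - snd p)).
{ intros k; unfold pt; destruct p, w; simpl; split; ring. }
assert (Hind : forall k, INR k <= N -> h (pt k) = h p).
{ induction k as [|k IH]; intros Hk.
  - f_equal; unfold pt; simpl; unfold Rdiv; rewrite Rmult_0_l; ring.
  - rewrite S_INR in Hk; rewrite <- IH by lra.
    apply (strong_maximum_local h m (- (T - m)) (T - m) (- (B - m)) (B - m) (pt k)).
    + destruct (Hpt k) as [E1 E2]; unfold margin; rewrite E1, E2.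
      assert (Ht : 0 <= INR k / N <= 1).
      { split; [apply Rdiv_le_0_compat; [apply pos_INR|assumption]|apply Rle_div_l; lra]. }
      split; [assumption|split; now apply Hc].
    + intros v Hv; now apply Hh, Hin.
    + rewrite IH; lra.
    + replace (pt (S k) - pt k)%C with (RtoC (/ N) * (w - p))%C.
      * rewrite Cmod_mult, Cmod_R, Rabs_right
          by (apply Rle_ge, Rlt_le, Rinv_0_lt_compat, HN).
        unfold Rdiv in Hstep; lra.
      * unfold pt; rewrite S_INR; unfold Rdiv.
        replace ((INR k + 1) * / N) with (INR k * / N + / N) by ring.
        rewrite RtoC_plus; ring. }
replace w with (pt (2 ^ n)%nat) at 1.
- apply Hind; rewrite <- HNn; lra.
- unfold pt; rewrite <- HNn; unfold Rdiv; rewrite Rinv_r by lra; ring.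
Qed.

(** What the Schwarz lemma uses of a conformal map onto the unit disk. *)
Record disk_coord (T B : R) (u : C -> C) : Prop := {
  dc_diff : forall z, crect T B z -> Cdiff u z;
  dc_bound : forall z, cbound T B z -> Cmod (u z) = 1;
  dc_at_0 : u 0 = 0;
  dc_zero : forall z, crect T B z -> u z = 0 -> z = 0;
  dc_deriv : forall d, is_Cderiv u 0 d -> d <> 0;
  dc_real : forall x, - T <= x <= T -> Im (u (RtoC x)) = 0 }.

Lemma rect_0 T B : 0 < T -> 0 < B -> rect T B 0.
Proof. intros; apply rect_inside; unfold inside; simpl; lra. Qed.

Lemma disk_coord_lt_1 T B u z : 0 < T -> 0 < B -> disk_coord T B u ->
  rect T B z -> Cmod (u z) < 1.
Proof.
intros HT HB Hu Hz.
assert (Hle : forall w, rect T B w -> Cmod (u w) <= 1).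
{ intros w Hw; apply rect_inside in Hw.
  apply (maximum_principle u _ _ _ _ 1 w Hw); [apply (dc_diff _ _ _ Hu)|].
  intros v Hv; rewrite (dc_bound _ _ _ Hu v Hv); lra. }
destruct (Rle_lt_or_eq_dec _ _ (Hle z Hz)) as [|E]; [assumption|exfalso].
assert (H0 : u 0 = u z).
{ apply (strong_maximum T B u z Hz); [|assumption|now apply rect_0].
  intros w Hw; split; [now apply (dc_diff _ _ _ Hu), rect_crect|now apply Hle]. }
rewrite <- H0, (dc_at_0 _ _ _ Hu), Cmod_0 in E; lra.
Qed.

(** Uniform continuity on the closed rectangle. *)
Lemma disk_coord_near_boundary T B u e : 0 < T -> 0 < B -> disk_coord T B u ->
  0 < e -> exists del, 0 < del /\ forall s w, 0 < s < del -> s < T -> s < B ->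
    on_boundary (- (T - s)) (T - s) (- (B - s)) (B - s) w -> 1 - e <= Cmod (u w).
Proof.
intros HT HB Hu He.
destruct (Ccont_uniform u (- T) T (- B) B e) as [del [Hd H]]; [|assumption|].
{ intros z Hz; apply Cdiff_cont, (dc_diff _ _ _ Hu), Hz. }
exists del; split; [assumption|]; intros s w Hs HsT HsB [[Hw1 Hw2] Hw].
assert (Hv : exists v, cbound T B v /\ Rabs (fst v - fst w) < del /\ Rabs (snd v - snd w) < del).
{ destruct Hw as [E|[E|[E|E]]];
    [exists (- T, snd w)|exists (T, snd w)|exists (fst w, - B)|exists (fst w, B)];
    unfold cbound, on_boundary, in_rect; simpl; rewrite E in *;
    (split; [intuition lra|split; apply Rabs_def1; lra]). }
destruct Hv as (v & Hv & V1 & V2).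
assert (Hlt : Cmod (u v - u w) < e).
{ apply H; try assumption; [apply Hv|unfold in_rect; lra]. }
assert (Hr := Cmod_triangle_rev (u v) (u w)); rewrite (dc_bound _ _ _ Hu v Hv) in Hr; lra.
Qed.

(** The quotient [h / u] extends across [0], where both factors vanish and [u]
    only to first order. On rectangles exhausting the given one it is bounded by
    [1 / |u|], which tends to 1. *)
Theorem schwarz_quotient T B u h : 0 < T -> 0 < B -> disk_coord T B u ->
  (forall z, rect T B z -> Cdiff h z /\ Cmod (h z) <= 1) -> h 0 = 0 ->
  exists g, forall z, rect T B z ->
    Cdiff g z /\ Cmod (g z) <= 1 /\ h z = (u z * g z)%C.
Proof.
intros HT HB Hu Hh H0; assert (R0 := rect_0 T B HT HB).
destruct (proj1 (Hh _ R0)) as [d Hd].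
destruct (dc_diff _ _ _ Hu 0 (rect_crect _ _ _ R0)) as [e He].
assert (He0 := dc_deriv _ _ _ Hu e He).
set (sh := slope h 0 d); set (su := slope u 0 e).
assert (Eh : forall z, h z = (sh z * z)%C).
{ intros z; unfold sh; rewrite (slope_eq h 0 d z), H0 at 1; ring. }
assert (Eu : forall z, u z = (su z * z)%C).
{ intros z; unfold su; rewrite (slope_eq u 0 e z), (dc_at_0 _ _ _ Hu) at 1; ring. }
assert (Hsu : forall z, rect T B z -> su z <> 0).
{ intros z Hz E; destruct (excluded_middle_informative (z = 0)) as [->|Hz0].
  - unfold su in E; rewrite slope_at in E; contradiction.
  - apply Hz0, (dc_zero _ _ _ Hu); [now apply rect_crect|].
    rewrite Eu, E; ring. }
set (g := fun z => (sh z / su z)%C); exists g.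
assert (Goff : forall z, rect T B z -> z <> 0 -> Cdiff g z).
{ intros z Hz Hz0; apply Cdiff_div; [| |now apply Hsu]; apply slope_diff; try assumption.
  - now apply Hh.
  - now apply (dc_diff _ _ _ Hu), rect_crect. }
assert (Gat : Ccont g 0).
{ apply Ccont_div; [exact Hd|exact He|now apply Hsu]. }
assert (Hsub : forall z, in_rect (- (T / 2)) (T / 2) (- (B / 2)) (B / 2) z -> rect T B z).
{ intros z [Hz1 Hz2]; apply rect_inside; unfold inside; lra. }
assert (Gd : forall z, rect T B z -> Cdiff g z).
{ intros z Hz; destruct (excluded_middle_informative (z = 0)) as [->|Hz0]; [|now apply Goff].
  apply (removable_singularity g (- (T / 2)) (T / 2) (- (B / 2)) (B / 2)).
  - unfold inside; simpl; lra.
  - intros w Hw; destruct (excluded_middle_informative (w = 0)) as [->|Hw0]; [assumption|].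
    apply Cdiff_cont, Goff; auto.
  - intros w Hw Hw0; apply Goff; auto. }
assert (Gm : forall z, h z = (u z * g z)%C \/ ~ rect T B z).
{ intros z; destruct (excluded_middle_informative (rect T B z)) as [Hz|]; [left|tauto].
  unfold g; rewrite Eh, Eu at 1; field; now apply Hsu. }
intros z Hz; split; [now apply Gd|split; [|destruct (Gm z); tauto]].
apply le_epsilon; intros eps Heps.
set (eta := eps / (1 + eps)).
assert (Heta : 0 < eta) by (apply Rdiv_lt_0_compat; lra).
assert (Heta' : 1 - eta = / (1 + eps)) by (unfold eta; field; lra).
destruct (disk_coord_near_boundary T B u eta HT HB Hu Heta) as [del [Hdel Hnb]].
apply rect_inside in Hz; destruct Hz as [Hz1 Hz2].
assert (Hex : exists s, 0 < s < del /\ - (T - s) < fst z < T - s /\ - (B - s) < snd z < B - s).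
{ exists (Rmin (Rmin (del / 2) (Rmin ((fst z + T) / 2) ((T - fst z) / 2)))
    (Rmin ((snd z + B) / 2) ((B - snd z) / 2))); rmin. }
destruct Hex as (s & Hs & Hzs1 & Hzs2).
assert (Hin : forall w, in_rect (- (T - s)) (T - s) (- (B - s)) (B - s) w -> rect T B w).
{ intros w [W1 W2]; apply rect_inside; unfold inside; lra. }
apply (maximum_principle g (- (T - s)) (T - s) (- (B - s)) (B - s)).
- unfold inside; lra.
- intros w Hw; now apply Gd, Hin.
- intros w Hw; assert (Hwr := Hin w (proj1 Hw)).
  assert (Hlow := Hnb s w ltac:(lra) ltac:(lra) ltac:(lra) Hw).
  destruct (Gm w) as [Ew|]; [|tauto].
  assert (Hhw := proj2 (Hh w Hwr)); rewrite Ew, Cmod_mult in Hhw.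
  rewrite Heta' in Hlow; assert (Hg := Cmod_ge_0 (g w)).
  assert (/ (1 + eps) * Cmod (g w) <= 1).
  { eapply Rle_trans; [apply Rmult_le_compat_r; [assumption|exact Hlow]|assumption]. }
  apply Rmult_le_reg_l with (/ (1 + eps)); [apply Rinv_0_lt_compat; lra|].
  rewrite Rinv_l by lra; assumption.
Qed.

(** The class on which the Schur algorithm operates. *)
Definition schur (T B : R) (h : C -> C) : Prop :=
  (forall z, rect T B z -> Cdiff h z /\ Cmod (h z) <= 1) /\
  (forall x, - T < x < T -> Im (h (RtoC x)) = 0).

Lemma real_eq (z : C) : Im z = 0 -> z = RtoC (Re z).
Proof. intros H; destruct z as [x y]; simpl in H; subst; reflexivity. Qed.

(** If [h 0] is interior to the disk, [k] is the Schwarz quotient of the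
    composition of [h] with the involution that exchanges [h 0] and [0]. If
    [h 0] is [1] or [- 1], then [h] is constant and any [k] will do. *)
Theorem schur_step T B u h : 0 < T -> 0 < B -> disk_coord T B u -> schur T B h ->
  exists k, schur T B k /\ forall z, rect T B z ->
    h z = ((RtoC (Re (h 0)) - u z * k z) / (1 - RtoC (Re (h 0)) * (u z * k z)))%C.
Proof.
intros HT HB Hu [Hh Hreal]; assert (R0 := rect_0 T B HT HB).
set (ga := Re (h 0)).
assert (Hga : h 0 = RtoC ga) by (apply real_eq, Hreal; lra).
assert (Hga1 : Cmod (h 0) <= 1) by apply (proj2 (Hh _ R0)).
assert (Hgab : Rabs ga <= 1) by (rewrite <- Cmod_R, <- Hga; assumption).
destruct (Rle_lt_or_eq_dec _ _ Hgab) as [Hlt|Heq].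
2:{ exists (fun _ => RtoC 0); split.
    - split; [intros z _; split; [apply Cdiff_const|rewrite Cmod_0; lra]|reflexivity].
    - intros z Hz; rewrite (strong_maximum T B h 0 R0 Hh); [rewrite Hga; field| |assumption].
      rewrite Hga, Cmod_R; assumption. }
assert (Hsmall : forall x, Cmod x <= 1 -> (1 - RtoC ga * x)%C <> 0).
{ intros x Hx; apply one_minus_neq_0; rewrite Cmod_mult, Cmod_R.
  assert (H := Cmod_ge_0 x); assert (H' := Rabs_pos ga); nra. }
assert (Hone : (1 - RtoC ga * RtoC ga)%C <> 0).
{ apply Hsmall; rewrite Cmod_R; assumption. }
set (m := fun z => ((RtoC ga - h z) / (1 - RtoC ga * h z))%C).
destruct (schwarz_quotient T B u m HT HB Hu) as [g Hg].
- intros z Hz; destruct (Hh z Hz) as [Dz Bz]; assert (Hd := Hsmall _ Bz); split.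
  + apply Cdiff_div; [| |assumption]; apply Cdiff_minus; try apply Cdiff_const; try assumption.
    apply Cdiff_mult; [apply Cdiff_const|assumption].
  + unfold m; rewrite Cmod_div by assumption.
    apply Rle_div_l; [now apply Cmod_gt_0|]; rewrite Rmult_1_l, Cmod_minus_sym.
    rewrite <- (Cconj_real ga) at 2.
    apply pseudo_hyperbolic_le; [assumption|rewrite Cmod_R; assumption].
- unfold m; rewrite Hga; unfold Cdiv; ring.
- exists g; split; [split|].
  + intros z Hz; destruct (Hg z Hz) as (G1 & G2 & _); now split.
  + assert (Hoff : forall x, - T < x < T -> x <> 0 -> Im (g (RtoC x)) = 0).
    { intros x Hx Hx0.
      assert (Hxr : rect T B (RtoC x)) by (apply rect_inside; unfold inside; simpl; lra).
      destruct (Hg _ Hxr) as (_ & _ & Ex).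
      assert (Hur := real_eq _ (dc_real _ _ _ Hu x ltac:(lra))).
      assert (Hu0 : Re (u (RtoC x)) <> 0).
      { intros E; rewrite E in Hur; apply Hx0.
        apply (dc_zero _ _ _ Hu) in Hur; [|now apply rect_crect].
        now apply (f_equal fst) in Hur. }
      assert (Hhr := real_eq _ (Hreal x Hx)).
      assert (Hmr : Im (m (RtoC x)) = 0).
      { unfold m; rewrite Hhr; rewrite <- RtoC_mult, <- !RtoC_minus, <- RtoC_div; [reflexivity|].
        intros E; apply (Hsmall _ (proj2 (Hh _ Hxr))).
        rewrite Hhr, <- RtoC_mult, <- RtoC_minus; now f_equal. }
      rewrite Ex, Hur in Hmr; destruct (g (RtoC x)) as [gx gy]; simpl in *.
      assert (Hp : Re (u (RtoC x)) * gy = 0) by lra.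
      apply Rmult_integral in Hp; destruct Hp; [contradiction|assumption]. }
    intros x Hx; destruct (Req_dec x 0) as [->|Hx0]; [|now apply Hoff].
    destruct (Req_dec (Im (g (RtoC 0))) 0) as [|Hne]; [assumption|exfalso].
    assert (Hc := Cdiff_cont _ _ (proj1 (Hg _ R0))).
    destruct (Hc (Rabs (Im (g (RtoC 0)))) (Rabs_pos_lt _ Hne)) as [del [Hdel H]].
    set (y := Rmin (del / 2) (T / 2)).
    assert (Hy : 0 < y) by (apply Rmin_glb_lt; lra).
    assert (Hy1 : y <= del / 2) by apply Rmin_l.
    assert (Hy2 : y <= T / 2) by apply Rmin_r.
    specialize (H (RtoC y)).
    replace (RtoC y - RtoC 0)%C with (RtoC y) in H by ring.
    rewrite Cmod_R, Rabs_right in H by lra; specialize (H ltac:(lra)).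
    assert (Hs := Cmod_snd (g (RtoC y) - g (RtoC 0))%C).
    assert (Hoy := Hoff y ltac:(lra) ltac:(lra)); unfold Im in *; simpl in Hs.
    rewrite Hoy, Rplus_0_l, Rabs_Ropp in Hs; lra.
  + intros z Hz; destruct (Hg z Hz) as (_ & _ & Ez); rewrite <- Ez.
    assert (Hd := Hsmall _ (proj2 (Hh z Hz))).
    assert (E1 : (RtoC ga - m z)%C = (h z * ((1 - RtoC ga * RtoC ga) / (1 - RtoC ga * h z)))%C)
      by (unfold m; field; assumption).
    assert (E2 : (1 - RtoC ga * m z)%C = ((1 - RtoC ga * RtoC ga) / (1 - RtoC ga * h z))%C)
      by (unfold m; field; assumption).
    rewrite E1, E2; field; split; assumption.
Qed.

(** * Convergence of the g-fraction *)

(** Backward recursion from the value [- 1] of the function of index [i + n + 1];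
    the first step is written out. *)
Fixpoint schur_approx (ga : nat -> R) (u : C) (i n : nat) : C :=
  match n with
  | O => ((RtoC (ga i) + u) / (1 + RtoC (ga i) * u))%C
  | S n' => let s := schur_approx ga u (S i) n' in
      ((RtoC (ga i) - u * s) / (1 - RtoC (ga i) * (u * s)))%C
  end.

Definition gpar (ga : nat -> R) (i : nat) : R := (1 + ga i) / 2.

Lemma Cmod_mult_lt_1 u s : Cmod u < 1 -> Cmod s <= 1 -> Cmod (u * s) < 1.
Proof.
intros Hu Hs; rewrite Cmod_mult.
assert (H := Cmod_ge_0 u); assert (H' := Cmod_ge_0 s); nra.
Qed.

Lemma den_neq_0 ga u s : Rabs ga <= 1 -> Cmod u < 1 -> Cmod s <= 1 ->
  (1 - RtoC ga * (u * s))%C <> 0.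
Proof.
intros Hg Hu Hs; apply one_minus_neq_0; rewrite Cmod_mult, Cmod_R.
assert (H := Cmod_mult_lt_1 u s Hu Hs); assert (H' := Cmod_ge_0 (u * s)).
assert (H2 := Rabs_pos ga); nra.
Qed.

Lemma moebius_le_1 ga u s : Rabs ga <= 1 -> Cmod u < 1 -> Cmod s <= 1 ->
  Cmod ((RtoC ga - u * s) / (1 - RtoC ga * (u * s))) <= 1.
Proof.
intros Hg Hu Hs; assert (Hd := den_neq_0 ga u s Hg Hu Hs).
rewrite Cmod_div by assumption; apply Rle_div_l; [now apply Cmod_gt_0|].
rewrite Rmult_1_l, Cmod_minus_sym, <- (Cconj_real ga) at 1.
replace (RtoC ga * (u * s))%C with (Cconj (RtoC ga) * (u * s))%C by now rewrite Cconj_real.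
rewrite Cconj_real at 1; apply pseudo_hyperbolic_le; [|rewrite Cmod_R; assumption].
apply Rlt_le; now apply Cmod_mult_lt_1.
Qed.

Lemma schur_approx_0 ga u i : schur_approx ga u i 0 =
  ((RtoC (ga i) - u * RtoC (-1)) / (1 - RtoC (ga i) * (u * RtoC (-1))))%C.
Proof. simpl; f_equal; ring. Qed.

Lemma schur_approx_le_1 ga u i n : (forall i, Rabs (ga i) <= 1) -> Cmod u < 1 ->
  Cmod (schur_approx ga u i n) <= 1.
Proof.
intros Hg Hu; revert i; induction n as [|n IH]; intros i.
- rewrite schur_approx_0; apply moebius_le_1; auto.
  rewrite Cmod_R, Rabs_left; lra.
- simpl; apply moebius_le_1; auto.
Qed.

(** Multiplication by [u] strictly contracts the pseudo-hyperbolic distance on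
    the closed disk. *)
Lemma contraction_scale u a : Cmod u < 1 -> Cmod a <= 1 ->
  (1 + Cmod u ^ 2) ^ 2 * Cmod (1 - a) ^ 2 <= 4 * Cmod (1 - RtoC (Cmod u ^ 2) * a) ^ 2.
Proof.
intros Hu Ha; set (t := Cmod u ^ 2).
assert (Ht : 0 <= t < 1) by (unfold t; assert (H := Cmod_ge_0 u); nra).
assert (HA := Cmod_sqr_le_1 a Ha); rewrite Cmod2_alt in HA.
rewrite !Cmod2_alt; destruct a as [p q]; simpl in *.
set (A := p * (p * 1) + q * (q * 1)) in *.
assert (Hp : 0 <= p + (1 + A) / 2).
{ replace (p + (1 + A) / 2) with (((p + 1) ^ 2 + q ^ 2) / 2) by (unfold A; field).
  generalize (pow2_ge_0 (p + 1)) (pow2_ge_0 q); lra. }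
assert (Hfac : 0 <= (1 - t) * ((3 + t) + 2 * (1 - t) * p - (3 * t + 1) * A)).
{ apply Rmult_le_pos; [lra|].
  assert (0 <= (1 - t) * (p + (1 + A) / 2)) by (apply Rmult_le_pos; lra).
  assert (0 <= (2 + 2 * t) * (1 - A)) by (apply Rmult_le_pos; lra).
  lra. }
unfold A in Hfac; nra.
Qed.

(** The square of the factor [2 |u| / (1 + |u|^2)] of [contraction_scale]. *)
Definition rate (u : C) : R := 4 * Cmod u ^ 2 / (1 + Cmod u ^ 2) ^ 2.

Lemma rate_bounds u : Cmod u < 1 -> 0 <= rate u < 1.
Proof.
intros Hu; unfold rate; set (t := Cmod u ^ 2).
assert (Ht : 0 <= t < 1) by (unfold t; assert (H := Cmod_ge_0 u); nra).
assert (Hd : 0 < (1 + t) ^ 2) by (apply pow_lt; lra); split.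
- apply Rdiv_le_0_compat; lra.
- apply Rlt_div_l; [assumption|]; nra.
Qed.

(** The recursion is multiplication by [u] followed by an isometry of the
    pseudo-hyperbolic distance. For [ga = 1] or [ga = - 1] the recursion is
    constant and the left-hand side vanishes. *)
Lemma moebius_contraction ga u x y kappa : Rabs ga <= 1 -> Cmod u < 1 ->
  Cmod x <= 1 -> Cmod y <= 1 -> 0 <= kappa ->
  Cmod (x - y) ^ 2 <= kappa * Cmod (1 - Cconj y * x) ^ 2 ->
  let m := fun s => ((RtoC ga - u * s) / (1 - RtoC ga * (u * s)))%C in
  Cmod (m x - m y) ^ 2 <= rate u * kappa * Cmod (1 - Cconj (m y) * m x) ^ 2.
Proof.
intros Hg Hu Hx Hy Hk Hxy m.
assert (Dx := den_neq_0 ga u x Hg Hu Hx); assert (Dy := den_neq_0 ga u y Hg Hu Hy).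
set (dx := (1 - RtoC ga * (u * x))%C) in *; set (dy := (1 - RtoC ga * (u * y))%C) in *.
assert (Dy' : Cconj dy <> 0).
{ apply Cmod_gt_0; rewrite Cmod_conj; now apply Cmod_gt_0. }
assert (E1 : (m x - m y)%C = (RtoC (1 - ga * ga) * (u * (y - x)) / (dx * dy))%C).
{ unfold m; fold dx dy; rewrite RtoC_minus, RtoC_mult.
  transitivity (((RtoC ga - u * x) * dy - (RtoC ga - u * y) * dx) / (dx * dy))%C.
  - field; split; assumption.
  - f_equal; unfold dx, dy; ring. }
assert (E2 : (1 - Cconj (m y) * m x)%C =
  (RtoC (1 - ga * ga) * (1 - RtoC (Cmod u ^ 2) * (Cconj y * x)) / (dx * Cconj dy))%C).
{ unfold m; fold dx dy; rewrite Cdiv_conj, Cmod2_conj, RtoC_minus, RtoC_mult by assumption.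
  assert (Ey : Cconj dy = (1 - RtoC ga * (Cconj u * Cconj y))%C).
  { unfold dy; rewrite Cminus_conj, !Cmult_conj, !Cconj_real; reflexivity. }
  rewrite Cminus_conj, Cmult_conj, Cconj_real.
  transitivity ((dx * Cconj dy - (RtoC ga - Cconj u * Cconj y) * (RtoC ga - u * x))
    / (dx * Cconj dy))%C.
  - field; split; assumption.
  - f_equal; rewrite Ey; unfold dx; ring. }
rewrite E1, E2, !Cmod_div, !Cmod_mult, Cmod_conj by (now apply Cmult_neq_0).
rewrite (Cmod_minus_sym y x).
assert (Px := proj1 (Cmod_gt_0 _) Dx); assert (Py := proj1 (Cmod_gt_0 _) Dy).
set (P := Cmod dx * Cmod dy); assert (HP : 0 < P) by now apply Rmult_lt_0_compat.
set (L := Cmod (RtoC (1 - ga * ga))).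
unfold Rdiv; rewrite !Rpow_mult_distr.
assert (Ha : Cmod (Cconj y * x) <= 1).
{ rewrite Cmod_mult, Cmod_conj; assert (H := Cmod_ge_0 x); assert (H' := Cmod_ge_0 y); nra. }
assert (Hsc := contraction_scale u (Cconj y * x) Hu Ha).
set (E := Cmod (1 - Cconj y * x) ^ 2) in *.
set (F := Cmod (1 - RtoC (Cmod u ^ 2) * (Cconj y * x)) ^ 2) in *.
set (N := Cmod (x - y) ^ 2) in *; set (t := Cmod u ^ 2) in *.
assert (Ht : 0 <= t) by apply pow2_ge_0.
assert (Hcore : t * N <= rate u * kappa * F).
{ unfold rate; fold t; assert (Hd : 0 < (1 + t) ^ 2) by (apply pow_lt; lra).
  replace (4 * t / (1 + t) ^ 2 * kappa * F) with (t * kappa * (4 * F) / (1 + t) ^ 2)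
    by (field; lra).
  apply (proj1 (Rle_div_r _ _ _ Hd)).
  apply Rle_trans with (t * (kappa * E) * (1 + t) ^ 2).
  - apply Rmult_le_compat_r; [lra|]; now apply Rmult_le_compat_l.
  - replace (t * (kappa * E) * (1 + t) ^ 2) with (t * kappa * ((1 + t) ^ 2 * E)) by ring.
    apply Rmult_le_compat_l; [now apply Rmult_le_pos|assumption]. }
replace (rate u * kappa * (L ^ 2 * F * (/ P) ^ 2))
  with (L ^ 2 * (/ P) ^ 2 * (rate u * kappa * F)) by ring.
replace (L ^ 2 * (t * N) * (/ P) ^ 2) with (L ^ 2 * (/ P) ^ 2 * (t * N)) by ring.
apply Rmult_le_compat_l; [|assumption].
apply Rmult_le_pos; apply pow2_ge_0.
Qed.

Definition schur_chain (ga : nat -> R) (u : C) (s : nat -> C) : Prop :=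
  forall i, Cmod (s i) <= 1 /\
    s i = ((RtoC (ga i) - u * s (S i)) / (1 - RtoC (ga i) * (u * s (S i))))%C.

Lemma schur_approx_dist ga u s i n : (forall i, Rabs (ga i) <= 1) -> Cmod u < 1 ->
  schur_chain ga u s -> Cmod (s i - schur_approx ga u i n) ^ 2 <= 4 * rate u ^ n.
Proof.
intros Hg Hu Hs.
assert (H : Cmod (s i - schur_approx ga u i n) ^ 2 <=
  rate u ^ n * Cmod (1 - Cconj (schur_approx ga u i n) * s i) ^ 2).
{ revert i; induction n as [|n IH]; intros i.
  - simpl pow at 2; rewrite Rmult_1_l; apply pow_incr; split; [apply Cmod_ge_0|].
    apply pseudo_hyperbolic_le; [apply Hs|now apply schur_approx_le_1].
  - rewrite (proj2 (Hs i)).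
    apply (moebius_contraction (ga i) u (s (S i)) (schur_approx ga u (S i) n) (rate u ^ n));
      auto.
    + apply Hs.
    + now apply schur_approx_le_1.
    + apply pow_le, rate_bounds, Hu. }
eapply Rle_trans; [exact H|].
rewrite Rmult_comm; apply Rmult_le_compat_r; [apply pow_le, rate_bounds, Hu|].
assert (Hb : Cmod (1 - Cconj (schur_approx ga u i n) * s i) <= 2).
{ eapply Rle_trans; [apply Cmod_triangle_sub|].
  rewrite Cmod_1, Cmod_mult, Cmod_conj.
  assert (H1 := proj1 (Hs i)); assert (H2 := schur_approx_le_1 ga u i n Hg Hu).
  assert (H3 := Cmod_ge_0 (s i)); assert (H4 := Cmod_ge_0 (schur_approx ga u i n)); nra. }
assert (H0 := Cmod_ge_0 (1 - Cconj (schur_approx ga u i n) * s i)); nra.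
Qed.

Lemma one_plus_neq_0 x : Cmod x < 1 -> (1 + x)%C <> 0.
Proof.
intros H; replace (1 + x)%C with (1 - - x)%C by ring.
apply one_minus_neq_0; now rewrite Cmod_opp.
Qed.

(** The variable [w] of the g-fraction with [1 + w = ((1 + u) / (1 - u))^2]. *)
Definition Phi_of (u : C) : C := (4 * u / ((1 - u) * (1 - u)))%C.

(** The tails of the g-fraction in the disk coordinate. Multiplying by [g i]
    avoids the division by [1 + s], which vanishes together with [g i]. *)
Lemma gfrac_tail_schur ga u i n : (forall i, Rabs (ga i) <= 1) -> Cmod u < 1 ->
  (1 <= i)%nat ->
  gfrac_tail (gpar ga) (Phi_of u) i n <> 0 /\
  (RtoC (gpar ga i) / gfrac_tail (gpar ga) (Phi_of u) i n)%C =
  ((1 + schur_approx ga u i n) * (1 - u) / (2 * (1 - u * schur_approx ga u i n)))%C.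
Proof.
intros Hg Hu; assert (Hu1 := one_minus_neq_0 u Hu).
assert (H2 := C2_neq_0).
assert (Ep : forall i, RtoC (gpar ga i) = ((1 + RtoC (ga i)) / 2)%C).
{ intros j; unfold gpar; rewrite RtoC_div, RtoC_plus by lra; reflexivity. }
revert i; induction n as [|n IH]; intros i Hi.
- simpl gfrac_tail; split; [apply RtoC_neq_0; lra|].
  rewrite Ep, schur_approx_0.
  assert (Hd := den_neq_0 (ga i) u (RtoC (-1)) (Hg i) Hu
    ltac:(rewrite Cmod_R, Rabs_left; lra)).
  assert (Hup := one_plus_neq_0 u Hu).
  set (c := RtoC (ga i)) in *; set (d := (1 - c * (u * RtoC (-1)))%C) in *.
  assert (E1 : (1 + (c - u * RtoC (-1)) / d)%C = ((1 + c) * (1 + u) / d)%C)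
    by (transitivity ((d + (c - u * RtoC (-1))) / d)%C;
      [field; assumption|f_equal; unfold d; ring]).
  assert (E2 : (1 - u * ((c - u * RtoC (-1)) / d))%C = ((1 - u) * (1 + u) / d)%C)
    by (transitivity ((d - u * (c - u * RtoC (-1))) / d)%C;
      [field; assumption|f_equal; unfold d; ring]).
  rewrite E1, E2; field; repeat split; assumption.
- destruct (IH (S i) ltac:(lia)) as [Ht Hr]; clear IH.
  assert (Hs := schur_approx_le_1 ga u (S i) n Hg Hu).
  simpl gfrac_tail; simpl schur_approx; cbv zeta.
  set (s := schur_approx ga u (S i) n) in *.
  set (t := gfrac_tail (gpar ga) (Phi_of u) (S i) n) in *.
  assert (Hus := one_minus_neq_0 _ (Cmod_mult_lt_1 u s Hu Hs)).
  assert (Hd := den_neq_0 (ga i) u s (Hg i) Hu Hs).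
  assert (Hm := moebius_le_1 (ga i) u s (Hg i) Hu Hs).
  assert (Hum := one_minus_neq_0 _ (Cmod_mult_lt_1 u _ Hu Hm)).
  set (c := RtoC (ga i)) in *; set (d := (1 - c * (u * s))%C) in *.
  set (k := (d - u * (c - u * s))%C).
  assert (Ek : (1 - u * ((c - u * s) / d))%C = (k / d)%C)
    by (unfold k; field; assumption).
  assert (Hk : k <> 0).
  { intros E; apply Hum; rewrite Ek, E; unfold Cdiv; ring. }
  assert (Et : (1 + RtoC (gcoef (gpar ga) i) * Phi_of u / t)%C =
    (k / ((1 - u) * (1 - u * s)))%C).
  { destruct i as [|i]; [lia|].
    transitivity (1 + (1 - RtoC (gpar ga (S i))) * Phi_of u * (RtoC (gpar ga (S (S i))) / t))%C.
    - simpl gcoef; rewrite RtoC_mult, RtoC_minus; field; assumption.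
    - rewrite Hr, Ep; fold c; unfold Phi_of.
      transitivity (((1 - u) * (1 - u * s) + (1 - c) * u * (1 + s)) / ((1 - u) * (1 - u * s)))%C.
      + field; repeat split; assumption.
      + f_equal; unfold k, d; ring. }
  rewrite Et; split.
  + unfold Cdiv; apply Cmult_neq_0; [assumption|]; intros E.
    assert (H := Cinv_r _ (Cmult_neq_0 _ _ Hu1 Hus)); rewrite E, Cmult_0_r in H.
    apply (f_equal fst) in H; simpl in H; lra.
  + rewrite Ek, Ep; fold c.
    assert (E1 : (1 + (c - u * s) / d)%C = ((1 + c) * (1 - u * s) / d)%C)
      by (transitivity ((d + (c - u * s)) / d)%C; [field; assumption|f_equal; unfold d; ring]).
    rewrite E1; field; repeat split; assumption.
Qed.

Lemma gfrac_approx_schur ga u n : (forall i, Rabs (ga i) <= 1) -> Cmod u < 1 ->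
  gfrac_approx (gpar ga) (Phi_of u) (S n) =
  ((1 - u) * (1 - u * schur_approx ga u 1 n) /
   ((1 + u) * (1 + u * schur_approx ga u 1 n)))%C.
Proof.
intros Hg Hu; assert (Hu1 := one_minus_neq_0 u Hu); assert (Hu2 := one_plus_neq_0 u Hu).
assert (H2 := C2_neq_0).
destruct (gfrac_tail_schur ga u 1 n Hg Hu (Nat.le_refl 1)) as [Ht Hr].
assert (Hs := schur_approx_le_1 ga u 1 n Hg Hu).
unfold gfrac_approx; simpl gfrac_tail.
set (s := schur_approx ga u 1 n) in *.
set (t := gfrac_tail (gpar ga) (Phi_of u) 1 n) in *.
assert (Hus := one_minus_neq_0 _ (Cmod_mult_lt_1 u s Hu Hs)).
assert (Hus' := one_plus_neq_0 _ (Cmod_mult_lt_1 u s Hu Hs)).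
assert (Et : (1 + RtoC (gpar ga 1) * Phi_of u / t)%C =
  ((1 + u) * (1 + u * s) / ((1 - u) * (1 - u * s)))%C).
{ transitivity (1 + Phi_of u * (RtoC (gpar ga 1) / t))%C; [field; assumption|].
  rewrite Hr; unfold Phi_of.
  transitivity (((1 - u) * (1 - u * s) + 2 * u * (1 + s)) / ((1 - u) * (1 - u * s)))%C.
  - field; repeat split; assumption.
  - f_equal; ring. }
rewrite Et; field; repeat split; assumption.
Qed.

Theorem gfrac_converges ga u s : (forall i, Rabs (ga i) <= 1) -> Cmod u < 1 ->
  schur_chain ga u s ->
  is_gfrac (gpar ga) (Phi_of u) ((1 - u) * (1 - u * s 1%nat) / ((1 + u) * (1 + u * s 1%nat)))%C.
Proof.
intros Hg Hu Hs; assert (Hu1 := one_minus_neq_0 u Hu); assert (Hu2 := one_plus_neq_0 u Hu).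
assert (Hs1 := proj1 (Hs 1%nat)).
set (c := ((1 - u) / (1 + u))%C).
set (v := fun x => (c * ((1 - u * x) / (1 + u * x)))%C).
assert (Hv : forall x, Cmod x <= 1 ->
  v x = ((1 - u) * (1 - u * x) / ((1 + u) * (1 + u * x)))%C).
{ intros x Hx; assert (H := one_plus_neq_0 _ (Cmod_mult_lt_1 u x Hu Hx)).
  unfold v, c; field; split; assumption. }
(* The limit is a continuous function of the first Schur value. *)
assert (Hcont : Ccont v (s 1%nat)).
{ apply Ccont_mult; [apply Ccont_const|].
  apply (Ccont_div (fun x => 1 - u * x)%C (fun x => 1 + u * x)%C).
  - apply Ccont_minus; [apply Ccont_const|apply Ccont_mult; [apply Ccont_const|apply Ccont_id]].
  - apply Ccont_plus; [apply Ccont_const|apply Ccont_mult; [apply Ccont_const|apply Ccont_id]].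
  - now apply one_plus_neq_0, Cmod_mult_lt_1. }
unfold is_gfrac; apply filterlim_locally; intros eps.
destruct (Hcont eps (cond_pos eps)) as [del [Hdel H]].
assert (Hrate := rate_bounds u Hu).
destruct (pow_lt_1_zero (rate u) ltac:(rewrite Rabs_right; lra) (del ^ 2 / 4)
  ltac:(assert (0 < del ^ 2) by (apply pow_lt; lra); lra)) as [N HN].
exists (S N); intros [|n] Hn; [lia|].
specialize (HN n ltac:(lia)); rewrite Rabs_right in HN by (apply Rle_ge, pow_le; lra).
apply C_NormedModule_mixin_compat1.
change (Cmod (gfrac_approx (gpar ga) (Phi_of u) (S n) -
  (1 - u) * (1 - u * s 1%nat) / ((1 + u) * (1 + u * s 1%nat))) < eps).
rewrite gfrac_approx_schur, <- !Hv by (try assumption; now apply schur_approx_le_1).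
apply H; rewrite Cmod_minus_sym.
assert (Hd := schur_approx_dist ga u s 1 n Hg Hu Hs).
set (D := Cmod (s 1%nat - schur_approx ga u 1 n)) in *.
assert (HD : 0 <= D) by apply Cmod_ge_0.
apply Rsqr_incrst_0; unfold Rsqr; simpl in *; lra.
Qed.

(** * Unordered absolutely convergent sums *)

Definition sumL {I : Type} (f : I -> C) (l : list I) : C :=
  fold_right (fun i acc => (f i + acc)%C) (RtoC 0) l.

Definition absL {I : Type} (f : I -> C) (l : list I) : R :=
  fold_right (fun i acc => Cmod (f i) + acc) 0 l.

Definition abs_tail {I : Type} (f : I -> C) : Prop :=
  forall e, 0 < e -> exists l0, forall l, NoDup l ->
    (forall i, In i l -> ~ In i l0) -> absL f l < e.

(** Smallness of the tails is kept together with convergence: it is what makes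
    regrouping and products available. *)
Definition asum {I : Type} (f : I -> C) (s : C) : Prop :=
  forall e, 0 < e -> exists l0, forall l, NoDup l ->
    ((forall i, In i l -> ~ In i l0) -> absL f l < e) /\
    (incl l0 l -> Cmod (sumL f l - s) < e).

Definition dec_eq {I : Type} (x y : I) : {x = y} + {x <> y} :=
  excluded_middle_informative (x = y).

Definition uniq {I : Type} (l : list I) : list I := nodup dec_eq l.

Lemma uniq_NoDup {I} (l : list I) : NoDup (uniq l).
Proof. apply NoDup_nodup. Qed.

Lemma uniq_incl {I} (l : list I) : incl l (uniq l).
Proof. intros i Hi; now apply nodup_In. Qed.

Definition without {I : Type} (l l0 : list I) : list I :=
  filter (fun i => if in_dec dec_eq i l0 then false else true) l.

Lemma without_In {I} (l l0 : list I) i : In i (without l l0) <-> In i l /\ ~ In i l0.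
Proof.
unfold without; rewrite filter_In.
destruct (in_dec dec_eq i l0); intuition discriminate.
Qed.

Lemma without_perm {I} (l l0 : list I) : NoDup l -> NoDup l0 -> incl l0 l ->
  Permutation l (l0 ++ without l l0).
Proof.
intros Hl Hl0 Hi; apply NoDup_Permutation; [assumption| |].
- apply NoDup_app; [assumption|now apply NoDup_filter|].
  intros i Hi0 Hw; apply without_In in Hw; tauto.
- intros i; rewrite in_app_iff, without_In.
  destruct (in_dec dec_eq i l0); split; intuition.
Qed.

Lemma sumL_app {I} (f : I -> C) l l' : sumL f (l ++ l') = (sumL f l + sumL f l')%C.
Proof. induction l as [|i l IH]; simpl; [ring|rewrite IH; ring]. Qed.

Lemma absL_app {I} (f : I -> C) l l' : absL f (l ++ l') = absL f l + absL f l'.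
Proof. induction l as [|i l IH]; simpl; [ring|rewrite IH; ring]. Qed.

Lemma sumL_perm {I} (f : I -> C) l l' : Permutation l l' -> sumL f l = sumL f l'.
Proof. induction 1; simpl; congruence || ring. Qed.

Lemma sumL_map {I J} (f : J -> C) (phi : I -> J) l :
  sumL f (map phi l) = sumL (fun i => f (phi i)) l.
Proof. induction l as [|i l IH]; simpl; congruence. Qed.

Lemma absL_map {I J} (f : J -> C) (phi : I -> J) l :
  absL f (map phi l) = absL (fun i => f (phi i)) l.
Proof. induction l as [|i l IH]; simpl; congruence. Qed.

Lemma absL_pos {I} (f : I -> C) l : 0 <= absL f l.
Proof. induction l as [|i l IH]; simpl; [lra|generalize (Cmod_ge_0 (f i)); lra]. Qed.

Lemma sumL_absL {I} (f : I -> C) l : Cmod (sumL f l) <= absL f l.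
Proof.
induction l as [|i l IH]; simpl; [rewrite Cmod_0; lra|].
eapply Rle_trans; [apply Cmod_triangle|lra].
Qed.

Lemma absL_incl {I} (f : I -> C) l l' : NoDup l -> incl l l' -> absL f l <= absL f l'.
Proof.
intros Hl; revert l'; induction Hl as [|i l Hi Hl IH]; intros l' Hincl; [apply absL_pos|].
destruct (in_split i l' (Hincl i (or_introl eq_refl))) as (l1 & l2 & ->).
rewrite absL_app; simpl.
assert (H : absL f l <= absL f (l1 ++ l2)); [|rewrite absL_app in H; lra].
apply IH; intros j Hj; assert (H := Hincl j (or_intror Hj)).
rewrite in_app_iff in *; simpl in H; intuition congruence.
Qed.

Lemma asum_tail {I} (f : I -> C) s : asum f s -> abs_tail f.
Proof.
intros H e He; destruct (H e He) as [l0 H0]; exists l0; intros l Hl; now apply H0.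
Qed.

Lemma asum_unique {I} (f : I -> C) s t : asum f s -> asum f t -> s = t.
Proof.
intros Hs Ht.
destruct (excluded_middle_informative (s = t)) as [|Hn]; [assumption|exfalso].
assert (Hp := proj1 (Cmod_gt_0 _) (Cminus_neq _ _ Hn)).
destruct (Hs (Cmod (s - t) / 2) ltac:(lra)) as [l0 H0].
destruct (Ht (Cmod (s - t) / 2) ltac:(lra)) as [l1 H1].
set (l := uniq (l0 ++ l1)).
assert (A0 : Cmod (sumL f l - s) < Cmod (s - t) / 2).
{ apply H0; [apply uniq_NoDup|intros i Hi; apply uniq_incl, in_or_app; tauto]. }
assert (A1 : Cmod (sumL f l - t) < Cmod (s - t) / 2).
{ apply H1; [apply uniq_NoDup|intros i Hi; apply uniq_incl, in_or_app; tauto]. }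
assert (H := Cmod_triangle (s - sumL f l) (sumL f l - t)).
replace (s - sumL f l + (sumL f l - t))%C with (s - t)%C in H by ring.
rewrite (Cmod_minus_sym s (sumL f l)) in H; lra.
Qed.

(** Once the tails are small, cofinally many good finite sums suffice. *)
Lemma asum_cofinal {I} (f : I -> C) s : abs_tail f ->
  (forall e, 0 < e -> forall l0, NoDup l0 -> exists l, NoDup l /\ incl l0 l /\
    Cmod (sumL f l - s) < e) ->
  asum f s.
Proof.
intros Ht Hc e He.
destruct (Ht (e / 2) ltac:(lra)) as [l0 H0]; exists l0; intros l Hl; split.
{ intros Hd; specialize (H0 l Hl Hd); lra. }
intros Hi; destruct (Hc (e / 2) ltac:(lra) l Hl) as (l' & Hl' & Hll' & Hs).
rewrite (sumL_perm f _ _ (without_perm l' l Hl' Hl Hll')), sumL_app in Hs.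
assert (Hw : absL f (without l' l) < e / 2).
{ apply H0; [now apply NoDup_filter|].
  intros i Hin; apply without_In in Hin; intuition. }
assert (Hb := sumL_absL f (without l' l)).
set (W := sumL f (without l' l)) in *.
replace (sumL f l - s)%C with ((sumL f l + W - s) - W)%C by ring.
eapply Rle_lt_trans; [apply Cmod_triangle_sub|lra].
Qed.

Lemma asum_ext {I} (f g : I -> C) s : (forall i, f i = g i) -> asum f s -> asum g s.
Proof.
intros H; replace g with f; [tauto|].
apply FunctionalExtensionality.functional_extensionality, H.
Qed.

Lemma asum_scal {I} (c : C) (f : I -> C) s : asum f s -> asum (fun i => c * f i)%C (c * s)%C.
Proof.
intros Hs e He.
assert (HK : 0 < Cmod c + 1) by (generalize (Cmod_ge_0 c); lra).
assert (Ea : forall l, absL (fun i => c * f i)%C l = Cmod c * absL f l).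
{ induction l as [|i l IH]; simpl; [ring|rewrite IH, Cmod_mult; ring]. }
assert (Es : forall l, sumL (fun i => c * f i)%C l = (c * sumL f l)%C).
{ induction l as [|i l IH]; simpl; [ring|rewrite IH; ring]. }
assert (Hm : forall x, 0 <= x -> x < e / (Cmod c + 1) -> Cmod c * x < e).
{ intros x Hx0 Hx; apply Rlt_div_r in Hx; [|assumption].
  eapply Rle_lt_trans; [|exact Hx].
  rewrite Rmult_comm; apply Rmult_le_compat_l; lra. }
destruct (Hs (e / (Cmod c + 1)) ltac:(now apply Rdiv_lt_0_compat)) as [l0 H].
exists l0; intros l Hl; destruct (H l Hl) as [H1 H2]; split; intros Hd.
- rewrite Ea; apply Hm; [apply absL_pos|auto].
- rewrite Es; replace (c * sumL f l - c * s)%C with (c * (sumL f l - s))%C by ring.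
  rewrite Cmod_mult; apply Hm; [apply Cmod_ge_0|auto].
Qed.

Lemma asum_plus {I} (f g : I -> C) s t : asum f s -> asum g t ->
  asum (fun i => f i + g i)%C (s + t)%C.
Proof.
intros Hs Ht e He.
assert (Ea : forall l, absL (fun i => f i + g i)%C l <= absL f l + absL g l).
{ induction l as [|i l IH]; simpl; [lra|].
  generalize (Cmod_triangle (f i) (g i)); lra. }
assert (Es : forall l, sumL (fun i => f i + g i)%C l = (sumL f l + sumL g l)%C).
{ induction l as [|i l IH]; simpl; [ring|rewrite IH; ring]. }
destruct (Hs (e / 2) ltac:(lra)) as [l0 H0], (Ht (e / 2) ltac:(lra)) as [l1 H1].
exists (l0 ++ l1); intros l Hl; destruct (H0 l Hl) as [T0 S0], (H1 l Hl) as [T1 S1].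
split; intros Hd.
- eapply Rle_lt_trans; [apply Ea|].
  assert (A0 := T0 (fun i Hi Hi0 => Hd i Hi (in_or_app _ _ _ (or_introl Hi0)))).
  assert (A1 := T1 (fun i Hi Hi1 => Hd i Hi (in_or_app _ _ _ (or_intror Hi1)))); lra.
- rewrite Es.
  assert (A0 := S0 (fun i Hi => Hd i (in_or_app _ _ _ (or_introl Hi)))).
  assert (A1 := S1 (fun i Hi => Hd i (in_or_app _ _ _ (or_intror Hi)))).
  replace (sumL f l + sumL g l - (s + t))%C
    with ((sumL f l - s) + (sumL g l - t))%C by ring.
  eapply Rle_lt_trans; [apply Cmod_triangle|lra].
Qed.

Lemma NoDup_map_inj {I J} (phi : I -> J) l : (forall i j, phi i = phi j -> i = j) ->
  NoDup l -> NoDup (map phi l).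
Proof. intros; apply FinFun.Injective_map_NoDup; assumption. Qed.

Lemma asum_reindex {I J} (phi : I -> J) (psi : J -> I) (f : J -> C) s :
  (forall i, psi (phi i) = i) -> (forall j, phi (psi j) = j) ->
  asum f s -> asum (fun i => f (phi i)) s.
Proof.
intros Hpsi Hphi Hs e He.
assert (Hinj : forall i j, phi i = phi j -> i = j).
{ intros i j H; rewrite <- (Hpsi i), <- (Hpsi j); congruence. }
destruct (Hs e He) as [l0 H]; exists (map psi l0); intros l Hl.
rewrite <- absL_map, <- sumL_map.
destruct (H (map phi l) (NoDup_map_inj phi l Hinj Hl)) as [H1 H2]; split; intros Hd.
- apply H1; intros j Hj Hj0; apply in_map_iff in Hj; destruct Hj as (i & <- & Hi).
  apply (Hd i Hi); rewrite <- (Hpsi i); now apply in_map.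
- apply H2; intros j Hj; rewrite <- (Hphi j); apply in_map, Hd, in_map, Hj.
Qed.

Definition lefts {I J K : Type} (chi : K -> I + J) (l : list K) : list I :=
  flat_map (fun k => match chi k with inl i => i :: nil | inr _ => nil end) l.
Definition rights {I J K : Type} (chi : K -> I + J) (l : list K) : list J :=
  flat_map (fun k => match chi k with inl _ => nil | inr j => j :: nil end) l.

(** A finite set of indices is pulled back to the two parts by means of [chi]. *)
Lemma asum_split {I J K} (phi : I -> K) (psi : J -> K) (chi : K -> I + J)
  (f : K -> C) s t :
  (forall i, chi (phi i) = inl i) -> (forall j, chi (psi j) = inr j) ->
  (forall k, match chi k with inl i => phi i = k | inr j => psi j = k end) ->
  asum (fun i => f (phi i)) s -> asum (fun j => f (psi j)) t -> asum f (s + t)%C.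
Proof.
intros Hphi Hpsi Hchi Hs Ht e He.
assert (Ea : forall l, absL f l = absL (fun i => f (phi i)) (lefts chi l)
  + absL (fun j => f (psi j)) (rights chi l)).
{ induction l as [|k l IH]; simpl; [ring|]; specialize (Hchi k).
  rewrite IH; destruct (chi k); simpl; rewrite Hchi; ring. }
assert (Es : forall l, sumL f l = (sumL (fun i => f (phi i)) (lefts chi l)
  + sumL (fun j => f (psi j)) (rights chi l))%C).
{ induction l as [|k l IH]; simpl; [ring|]; specialize (Hchi k).
  rewrite IH; destruct (chi k); simpl; rewrite Hchi; ring. }
assert (Il : forall l i, In i (lefts chi l) <-> In (phi i) l).
{ intros l i; unfold lefts; rewrite in_flat_map; split.
  - intros (k & Hk & Hi); specialize (Hchi k); destruct (chi k); simpl in Hi; [|tauto].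
    destruct Hi as [<-|[]]; now rewrite Hchi.
  - intros Hi; exists (phi i); split; [assumption|]; rewrite Hphi; simpl; auto. }
assert (Ir : forall l j, In j (rights chi l) <-> In (psi j) l).
{ intros l i; unfold rights; rewrite in_flat_map; split.
  - intros (k & Hk & Hi); specialize (Hchi k); destruct (chi k); simpl in Hi; [tauto|].
    destruct Hi as [<-|[]]; now rewrite Hchi.
  - intros Hi; exists (psi i); split; [assumption|]; rewrite Hpsi; simpl; auto. }
assert (Nl : forall l, NoDup l -> NoDup (lefts chi l)).
{ induction l as [|k l IH]; intros Hl; [constructor|]; inversion_clear Hl.
  simpl; specialize (Hchi k); destruct (chi k); simpl; [|auto].
  constructor; [rewrite (Il l), Hchi|]; auto. }
assert (Nr : forall l, NoDup l -> NoDup (rights chi l)).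
{ induction l as [|k l IH]; intros Hl; [constructor|]; inversion_clear Hl.
  simpl; specialize (Hchi k); destruct (chi k); simpl; [auto|].
  constructor; [rewrite (Ir l), Hchi|]; auto. }
destruct (Hs (e / 2) ltac:(lra)) as [l0 H0], (Ht (e / 2) ltac:(lra)) as [l1 H1].
exists (map phi l0 ++ map psi l1); intros l Hl.
destruct (H0 _ (Nl l Hl)) as [T0 S0], (H1 _ (Nr l Hl)) as [T1 S1].
split; intros Hd; [rewrite Ea|rewrite Es].
- assert (A0 : absL (fun i => f (phi i)) (lefts chi l) < e / 2).
  { apply T0; intros i Hi Hi0; apply (Hd (phi i)); [now apply Il|].
    apply in_or_app; left; now apply in_map. }
  assert (A1 : absL (fun i => f (psi i)) (rights chi l) < e / 2).
  { apply T1; intros i Hi Hi0; apply (Hd (psi i)); [now apply Ir|].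
    apply in_or_app; right; now apply in_map. }
  lra.
- assert (B0 : incl l0 (lefts chi l)).
  { intros i Hi; apply Il, Hd, in_or_app; left; now apply in_map. }
  assert (B1 : incl l1 (rights chi l)).
  { intros i Hi; apply Ir, Hd, in_or_app; right; now apply in_map. }
  specialize (S0 B0); specialize (S1 B1).
  set (X := sumL _ (lefts chi l)) in *; set (Y := sumL _ (rights chi l)) in *.
  replace (X + Y - (s + t))%C with ((X - s) + (Y - t))%C by ring.
  eapply Rle_lt_trans; [apply Cmod_triangle|lra].
Qed.

Lemma abs_tail_bounded {I} (f : I -> C) : abs_tail f ->
  exists M, 0 < M /\ forall l, NoDup l -> absL f l <= M.
Proof.
intros Ht; destruct (Ht 1 Rlt_0_1) as [l0 H0].
exists (absL f (uniq l0) + 1); split; [generalize (absL_pos f (uniq l0)); lra|].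
intros l Hl.
assert (Hw : absL f (without l (uniq l0)) < 1).
{ apply H0; [now apply NoDup_filter|]; intros i Hi Hi0; apply without_In in Hi.
  apply (proj2 Hi); now apply uniq_incl. }
assert (absL f l <= absL f (uniq l0 ++ without l (uniq l0))).
{ apply absL_incl; [assumption|]; intros i Hi; apply in_or_app.
  destruct (in_dec dec_eq i (uniq l0)); [tauto|right; now apply without_In]. }
rewrite absL_app in H; lra.
Qed.

Definition tensor {I J : Type} (f : I -> C) (g : J -> C) (p : I * J) : C :=
  (f (fst p) * g (snd p))%C.

Lemma sumL_prod {I J} (f : I -> C) (g : J -> C) l l' :
  sumL (tensor f g) (list_prod l l') = (sumL f l * sumL g l')%C.
Proof.
induction l as [|i l IH]; simpl; [ring|]; rewrite sumL_app, IH, sumL_map.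
assert (E : forall m, sumL (fun j => tensor f g (i, j)) m = (f i * sumL g m)%C).
{ induction m as [|j m IHm]; simpl; [ring|rewrite IHm; unfold tensor; simpl; ring]. }
rewrite E; ring.
Qed.

Lemma absL_prod {I J} (f : I -> C) (g : J -> C) l l' :
  absL (tensor f g) (list_prod l l') = absL f l * absL g l'.
Proof.
induction l as [|i l IH]; simpl; [ring|]; rewrite absL_app, IH, absL_map.
assert (E : forall m, absL (fun j => tensor f g (i, j)) m = Cmod (f i) * absL g m).
{ induction m as [|j m IHm]; simpl; [ring|].
  rewrite IHm; unfold tensor; simpl; rewrite Cmod_mult; ring. }
rewrite E; ring.
Qed.

Lemma NoDup_list_prod {I J} (l : list I) (l' : list J) :
  NoDup l -> NoDup l' -> NoDup (list_prod l l').
Proof.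
intros Hl Hl'; induction Hl as [|i l Hi Hl IH]; simpl; [constructor|].
apply NoDup_app; [|assumption|].
- apply NoDup_map_inj; [congruence|assumption].
- intros p Hp Hp'; apply in_map_iff in Hp; destruct Hp as (j & <- & _).
  apply in_prod_iff in Hp'; tauto.
Qed.

(** A finite set of pairs that avoids [l0 * l1] has its first components off [l0]
    or its second components off [l1]; this bounds the tails. *)
Theorem asum_tensor {I J} (f : I -> C) (g : J -> C) s t :
  asum f s -> asum g t -> asum (tensor f g) (s * t)%C.
Proof.
intros Hs Ht; assert (Tf := asum_tail _ _ Hs); assert (Tg := asum_tail _ _ Ht).
destruct (abs_tail_bounded f Tf) as (F & HF & BF).
destruct (abs_tail_bounded g Tg) as (G & HG & BG).
assert (T : abs_tail (tensor f g)).
{ intros e He.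
  destruct (Tf (e / (2 * G)) ltac:(apply Rdiv_lt_0_compat; lra)) as [l0 H0].
  destruct (Tg (e / (2 * F)) ltac:(apply Rdiv_lt_0_compat; lra)) as [l1 H1].
  exists (list_prod l0 l1); intros L HL Hd.
  set (A := uniq (map fst L)); set (B := uniq (map snd L)).
  assert (NA : NoDup A) by apply uniq_NoDup; assert (NB : NoDup B) by apply uniq_NoDup.
  assert (IA : forall p, In p L -> In (fst p) A) by (intros; apply uniq_incl; now apply in_map).
  assert (IB : forall p, In p L -> In (snd p) B) by (intros; apply uniq_incl; now apply in_map).
  set (P := list_prod (without A l0) B); set (Q := list_prod A (without B l1)).
  assert (Hle : absL (tensor f g) L <= absL (tensor f g) (P ++ Q)).
  { apply absL_incl; [assumption|]; intros [i j] Hp; apply in_or_app.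
    assert (Hi := IA _ Hp); assert (Hj := IB _ Hp); simpl in Hi, Hj.
    destruct (in_dec dec_eq i l0) as [Hi0|Hi0].
    - right; apply in_prod_iff; split; [assumption|].
      apply without_In; split; [assumption|]; intros Hj1.
      apply (Hd _ Hp); now apply in_prod_iff.
    - left; apply in_prod_iff; split; [now apply without_In|assumption]. }
  rewrite absL_app in Hle; unfold P, Q in Hle; rewrite !absL_prod in Hle.
  assert (A1 : absL f (without A l0) < e / (2 * G)).
  { apply H0; [now apply NoDup_filter|]; intros i Hi; apply without_In in Hi; tauto. }
  assert (A2 : absL g (without B l1) < e / (2 * F)).
  { apply H1; [now apply NoDup_filter|]; intros i Hi; apply without_In in Hi; tauto. }
  assert (B1 := BG B NB).
  assert (B2 := BF A NA).
  assert (C1 : absL f (without A l0) * absL g B <= absL f (without A l0) * G)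
    by (apply Rmult_le_compat_l; [apply absL_pos|assumption]).
  assert (C2 : absL f A * absL g (without B l1) <= F * absL g (without B l1))
    by (apply Rmult_le_compat_r; [apply absL_pos|assumption]).
  assert (D1 : absL f (without A l0) * G < e / 2).
  { replace (e / 2) with (e / (2 * G) * G) by (field; lra); now apply Rmult_lt_compat_r. }
  assert (D2 : F * absL g (without B l1) < e / 2).
  { replace (e / 2) with (F * (e / (2 * F))) by (field; lra); now apply Rmult_lt_compat_l. }
  lra. }
apply asum_cofinal; [assumption|]; intros e He L HL.
assert (HK : 0 < 2 * (F + Cmod t + 1)) by (generalize (Cmod_ge_0 t); lra).
set (e1 := e / (2 * (F + Cmod t + 1))).
assert (He1 : 0 < e1) by now apply Rdiv_lt_0_compat.
destruct (Hs e1 He1) as [l0 H0], (Ht e1 He1) as [l1 H1].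
set (A := uniq (l0 ++ map fst L)); set (B := uniq (l1 ++ map snd L)).
exists (list_prod A B); split; [apply NoDup_list_prod; apply uniq_NoDup|split].
- intros [i j] Hp; apply in_prod_iff; split; apply uniq_incl, in_or_app; right.
  + now apply (in_map fst) in Hp.
  + now apply (in_map snd) in Hp.
- rewrite sumL_prod.
  assert (A0 : Cmod (sumL f A - s) < e1).
  { apply H0; [apply uniq_NoDup|]; intros i Hi; apply uniq_incl, in_or_app; tauto. }
  assert (A1 : Cmod (sumL g B - t) < e1).
  { apply H1; [apply uniq_NoDup|]; intros i Hi; apply uniq_incl, in_or_app; tauto. }
  assert (AF : Cmod (sumL f A) <= F).
  { eapply Rle_trans; [apply sumL_absL|apply BF, uniq_NoDup]. }
  replace (sumL f A * sumL g B - s * t)%C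
    with (sumL f A * (sumL g B - t) + (sumL f A - s) * t)%C by ring.
  eapply Rle_lt_trans; [apply Cmod_triangle|]; rewrite !Cmod_mult.
  assert (Cmod (sumL f A) * Cmod (sumL g B - t) <= F * e1).
  { apply Rmult_le_compat; try apply Cmod_ge_0; lra. }
  assert (Cmod (sumL f A - s) * Cmod t <= e1 * Cmod t).
  { apply Rmult_le_compat_r; [apply Cmod_ge_0|lra]. }
  replace e with (2 * (F + Cmod t + 1) * e1) by (unfold e1; field; lra).
  assert (0 <= Cmod t) by apply Cmod_ge_0; nra.
Qed.

(** ** Sums over the natural numbers *)

Lemma sumL_seq f N : sumL f (seq 0 N) = (sum_f_R0 (fun n => Re (f n)) N - Re (f N),
  sum_f_R0 (fun n => Im (f n)) N - Im (f N)).
Proof.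
induction N as [|N IH].
- simpl; unfold RtoC; f_equal; ring.
- rewrite seq_S, sumL_app, IH; simpl; unfold Cplus, Re, Im; simpl; f_equal; ring.
Qed.

Lemma absL_seq f N k :
  absL f (seq N k) = sum_n_m (fun n => Cmod (f n)) N (N + k) - Cmod (f (N + k)%nat).
Proof.
revert N; induction k as [|k IH]; intros N.
- rewrite Nat.add_0_r, sum_n_n; simpl; ring.
- simpl; rewrite IH.
  rewrite (sum_Sn_m _ N (N + S k)) by lia.
  replace (S N + k)%nat with (N + S k)%nat by lia; unfold plus; simpl; ring.
Qed.

Lemma ex_series_Re_Im (f : nat -> C) : ex_series (fun n => Cmod (f n)) ->
  ex_series (fun n => Re (f n)) /\ ex_series (fun n => Im (f n)).
Proof.
intros H; split; apply (ex_series_le (V := R_CompleteNormedModule) _ (fun n => Cmod (f n)));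
  try assumption; intros n.
- apply re_le_Cmod.
- eapply Rle_trans; [apply Rmax_r|apply Rmax_Cmod].
Qed.

Lemma CSeries_partial (f : nat -> C) e : ex_series (fun n => Re (f n)) ->
  ex_series (fun n => Im (f n)) -> 0 < e ->
  exists N0, forall N, (N0 <= N)%nat -> Cmod (sumL f (seq 0 N) - CSeries f) < e.
Proof.
intros H1 H2 He.
apply Series_correct in H1; apply Series_correct in H2.
assert (He2 : 0 < e / 2) by lra.
assert (L1 := proj1 (filterlim_locally _ _) H1 (mkposreal _ He2)).
assert (L2 := proj1 (filterlim_locally _ _) H2 (mkposreal _ He2)).
clear H1 H2; destruct L1 as [N1 H1], L2 as [N2 H2].
exists (S (max N1 N2)); intros N HN.
destruct N as [|N]; [lia|].
specialize (H1 N ltac:(lia)); specialize (H2 N ltac:(lia)).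
rewrite sum_n_Reals in H1, H2.
replace e with (e / 2 + e / 2) by field.
eapply Rle_lt_trans; [|exact (Rplus_lt_compat _ _ _ _ H1 H2)].
eapply Rle_trans; [apply Cmod_le_sum|].
rewrite sumL_seq; unfold CSeries; right; f_equal; simpl;
  unfold minus, plus, opp, abs; simpl; f_equal; ring.
Qed.

Lemma nat_asum (f : nat -> C) : ex_series (fun n => Cmod (f n)) -> asum f (CSeries f).
Proof.
intros Hf; assert (T : abs_tail f).
{ intros e He.
  destruct (Cauchy_ex_series _ Hf (mkposreal e He)) as [N HN]; simpl in HN.
  exists (seq 0 N); intros l Hl Hd.
  set (k := S (list_max l)).
  assert (Hle : absL f l <= absL f (seq N k)).
  { apply absL_incl; [assumption|]; intros i Hi; apply in_seq.
    assert (Hi0 := Hd i Hi); rewrite in_seq in Hi0.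
    assert (Hmax := proj1 (list_max_le l (list_max l)) (Nat.le_refl _)).
    rewrite Forall_forall in Hmax; specialize (Hmax i Hi); unfold k; lia. }
  rewrite absL_seq in Hle.
  specialize (HN N (N + k)%nat ltac:(lia) ltac:(lia)).
  assert (Hge := Cmod_ge_0 (f (N + k)%nat)).
  assert (Hr := Rle_abs (sum_n_m (fun n => Cmod (f n)) N (N + k))).
  change (Rabs (sum_n_m (fun n => Cmod (f n)) N (N + k)) < e) in HN; lra. }
apply asum_cofinal; [assumption|]; intros e He l0 Hl0.
destruct (ex_series_Re_Im f Hf) as [H1 H2].
destruct (CSeries_partial f e H1 H2 He) as [N HN].
exists (seq 0 (N + S (list_max l0))); split; [apply seq_NoDup|split].
- intros i Hi; apply in_seq.
  assert (Hmax := proj1 (list_max_le l0 (list_max l0)) (Nat.le_refl _)).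
  rewrite Forall_forall in Hmax; specialize (Hmax i Hi); lia.
- apply HN; lia.
Qed.

Lemma nat_asum_CSeries (f : nat -> C) s : asum f s -> ex_series (fun n => Cmod (f n)) ->
  CSeries f = s.
Proof. intros H Hf; exact (asum_unique _ _ _ (nat_asum f Hf) H). Qed.

Lemma asum_bound (f : nat -> C) s (c : nat -> R) : asum f s -> ex_series c ->
  (forall n, Cmod (f n) <= c n) -> Cmod s <= Series c.
Proof.
intros Hs Hc Hfc; apply le_epsilon; intros e He.
destruct (Hs e He) as [l0 H0].
set (N := S (list_max l0)).
assert (H : Cmod (sumL f (seq 0 N) - s) < e).
{ apply H0; [apply seq_NoDup|]; intros i Hi; apply in_seq.
  assert (Hmax := proj1 (list_max_le l0 (list_max l0)) (Nat.le_refl _)).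
  rewrite Forall_forall in Hmax; specialize (Hmax i Hi); unfold N; lia. }
assert (Hb : Cmod (sumL f (seq 0 N)) <= Series c).
{ eapply Rle_trans; [apply sumL_absL|]; rewrite absL_seq, Nat.add_0_l.
  assert (Hle : sum_n_m (fun n => Cmod (f n)) 0 N <= sum_n c N).
  { apply sum_n_m_le; assumption. }
  assert (Hser : sum_n c N <= Series c).
  { apply (is_lim_seq_incr_compare (sum_n c)).
    - apply Series_correct, Hc.
    - intros n; rewrite sum_Sn; unfold plus; simpl.
      assert (H1 := Hfc (S n)); assert (H2 := Cmod_ge_0 (f (S n))); lra. }
  generalize (Cmod_ge_0 (f N)); lra. }
assert (Hr := Cmod_triangle_rev s (sumL f (seq 0 N))).
rewrite Cmod_minus_sym in Hr; lra.
Qed.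

(** * The theta function of Jacobi's triple product *)

Fixpoint tri (m : nat) : nat := match m with O => O | S k => (tri k + S k)%nat end.

Lemma tri_2 m : (2 * tri m = m * m + m)%nat.
Proof. induction m as [|m IH]; simpl in *; lia. Qed.

Definition abs_conv (f : nat -> C) : Prop := ex_series (fun n => Cmod (f n)).

Lemma abs_conv_le f c : (forall n, Cmod (f n) <= c n) -> ex_series c -> abs_conv f.
Proof.
intros H Hc; apply (ex_series_le (V := R_CompleteNormedModule) _ c); [|assumption].
intros n; unfold norm; simpl; unfold abs; simpl.
rewrite Rabs_right; [apply H|apply Rle_ge, Cmod_ge_0].
Qed.

Lemma CSeries_ext f g : (forall n, f n = g n) -> CSeries f = CSeries g.
Proof.
intros H; unfold CSeries; f_equal; apply Series_ext; intros n; now rewrite H.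
Qed.

Lemma abs_conv_plus f g : abs_conv f -> abs_conv g -> abs_conv (fun n => f n + g n)%C.
Proof.
intros Hf Hg; apply abs_conv_le with (fun n => Cmod (f n) + Cmod (g n)).
- intros; apply Cmod_triangle.
- apply (ex_series_plus (V := R_NormedModule)); assumption.
Qed.

Lemma CSeries_plus f g : abs_conv f -> abs_conv g ->
  CSeries (fun n => f n + g n)%C = (CSeries f + CSeries g)%C.
Proof.
intros Hf Hg; apply nat_asum_CSeries; [|now apply abs_conv_plus].
apply asum_plus; now apply nat_asum.
Qed.

Lemma abs_conv_scal c f : abs_conv f -> abs_conv (fun n => c * f n)%C.
Proof.
intros Hf; apply abs_conv_le with (fun n => Cmod c * Cmod (f n)).
- intros; rewrite Cmod_mult; lra.
- apply (ex_series_scal (V := R_NormedModule)); assumption.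
Qed.

Lemma CSeries_scal c f : abs_conv f ->
  CSeries (fun n => c * f n)%C = (c * CSeries f)%C.
Proof.
intros Hf; apply nat_asum_CSeries; [|now apply abs_conv_scal].
now apply asum_scal, nat_asum.
Qed.

Lemma CSeries_minus f g : abs_conv f -> abs_conv g ->
  CSeries (fun n => f n - g n)%C = (CSeries f - CSeries g)%C.
Proof.
intros Hf Hg.
rewrite (CSeries_ext _ (fun n => f n + -1 * g n)%C) by (intros; ring).
rewrite CSeries_plus, CSeries_scal by (try apply abs_conv_scal; assumption); ring.
Qed.

Lemma CSeries_incr_1 f : abs_conv f ->
  CSeries f = (f O + CSeries (fun n => f (S n)))%C.
Proof.
intros Hf; destruct (ex_series_Re_Im f Hf) as [H1 H2].
unfold CSeries; rewrite (Series_incr_1 _ H1), (Series_incr_1 _ H2).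
destruct (f O); reflexivity.
Qed.

Lemma CSeries_RtoC (a : nat -> R) : CSeries (fun n => RtoC (a n)) = RtoC (Series a).
Proof.
unfold CSeries, RtoC; f_equal; simpl.
transitivity (0 * Series (fun _ => 0)); [|ring].
rewrite <- Series_scal_l; apply Series_ext; intros; simpl; ring.
Qed.

Lemma CSeries_conj f : CSeries (fun n => Cconj (f n)) = Cconj (CSeries f).
Proof.
unfold CSeries, Cconj; simpl; f_equal; rewrite <- Series_opp; reflexivity.
Qed.

Lemma CSeries_le f c : (forall n, Cmod (f n) <= c n) -> ex_series c ->
  Cmod (CSeries f) <= Series c.
Proof.
intros H Hc; apply (asum_bound f); try assumption.
apply nat_asum; now apply abs_conv_le with c.
Qed.

Lemma ex_series_tri rho X : 0 < rho < 1 -> 0 <= X ->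
  ex_series (fun m => rho ^ tri m * X ^ m).
Proof.
intros Hr HX.
apply (ex_series_le (V := R_CompleteNormedModule) _
  (fun m => Rabs (rho ^ tri m * (X + 1) ^ m))).
- intros n; unfold norm; simpl; unfold abs; simpl.
  rewrite !Rabs_mult; apply Rmult_le_compat_l; [apply Rabs_pos|].
  rewrite <- !RPow_abs; apply pow_incr; split; [apply Rabs_pos|].
  rewrite !Rabs_right; lra.
- assert (Hp : forall m, 0 < rho ^ tri m * (X + 1) ^ m).
  { intros m; apply Rmult_lt_0_compat; apply pow_lt; lra. }
  apply ex_series_DAlembert with 0; [lra|intros n; generalize (Hp n); lra|].
  apply is_lim_seq_ext with (fun n => (rho * (X + 1)) * rho ^ n).
  + intros n; rewrite Rabs_right.
    * simpl tri; rewrite pow_add; simpl; field; split; apply pow_nonzero; lra.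
    * apply Rle_ge, Rlt_le, Rdiv_lt_0_compat; apply Hp.
  + replace (Finite 0) with (Rbar_mult (rho * (X + 1)) 0) by (simpl; f_equal; ring).
    apply is_lim_seq_scal_l, is_lim_seq_geom; rewrite Rabs_right; lra.
Qed.

Definition proper_nome (r : R) : Prop := r <> 0 /\ Rabs r < 1.

Lemma proper_nome_abs r : proper_nome r -> 0 < Rabs r < 1.
Proof. intros [H1 H2]; split; [now apply Rabs_pos_lt|assumption]. Qed.

Lemma proper_nome_sqr r : proper_nome r -> proper_nome (r * r).
Proof.
intros H; assert (Ha := proper_nome_abs r H); destruct H as [H1 H2]; split; [nra|].
rewrite Rabs_mult; nra.
Qed.

Definition gterm (r : R) (x : C) (m : nat) : C := (RtoC (r ^ tri m) * x ^ m)%C.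

Lemma Cmod_gterm r x m : Cmod (gterm r x m) = Rabs r ^ tri m * Cmod x ^ m.
Proof. unfold gterm; now rewrite Cmod_mult, Cmod_R, Cmod_pow, RPow_abs. Qed.

Lemma gterm_conv r x : proper_nome r -> abs_conv (gterm r x).
Proof.
intros Hr; apply abs_conv_le with (fun m => Rabs r ^ tri m * Cmod x ^ m).
- intros n; rewrite Cmod_gterm; lra.
- apply ex_series_tri; [now apply proper_nome_abs|apply Cmod_ge_0].
Qed.

(** The terms of [Theta] with [n <= 0] form this power series in [1 / x], those
    with [n >= 1] form [x] times the same series in [x]. *)
Definition half_Theta (r : R) (x : C) : C := CSeries (gterm r x).

(** The sum of [r^(n(n-1)/2) x^n] over all integers [n]. *)
Definition Theta (r : R) (x : C) : C := (half_Theta r (/ x) + x * half_Theta r x)%C.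

(** ** Differentiability *)

(** The quotient [(w^m - z^m) / (w - z)] as a polynomial. *)
Fixpoint pow_slope (w z : C) (m : nat) : C :=
  match m with O => RtoC 0 | S k => (w * pow_slope w z k + z ^ k)%C end.

Lemma pow_slope_eq w z m : (w ^ m = z ^ m + pow_slope w z m * (w - z))%C.
Proof. induction m as [|m IH]; simpl; [ring|rewrite IH at 1; ring]. Qed.

Lemma pow_le_4 (m : nat) : INR m * INR m <= 4 ^ m.
Proof.
assert (H : INR m <= 2 ^ m).
{ induction m as [|m IH]; [simpl; lra|]; rewrite S_INR; simpl.
  assert (1 <= 2 ^ m) by (apply pow_R1_Rle; lra); lra. }
replace (4 ^ m) with (2 ^ m * 2 ^ m) by (rewrite <- Rpow_mult_distr; f_equal; ring).
apply Rmult_le_compat; try assumption; apply pos_INR.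
Qed.

Lemma pow_slope_bound w z K m : 1 <= K -> Cmod w <= K -> Cmod z <= K ->
  Cmod (pow_slope w z m) <= INR m * K ^ m /\
  Cmod (pow_slope w z m - pow_slope z z m) <= INR m * INR m * K ^ m * Cmod (w - z).
Proof.
intros HK Hw Hz.
assert (Hzk : forall k, Cmod (z ^ k) <= K ^ k).
{ intros k; rewrite Cmod_pow; apply pow_incr; split; [apply Cmod_ge_0|assumption]. }
assert (HKk : forall k, 0 < K ^ k) by (intros; apply pow_lt; lra).
assert (HB : forall v, Cmod v <= K -> forall k, Cmod (pow_slope v z k) <= INR k * K ^ k).
{ intros v Hv; induction k as [|k IH]; [simpl; rewrite Cmod_0; lra|].
  rewrite S_INR; simpl; eapply Rle_trans; [apply Cmod_triangle|]; rewrite Cmod_mult.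
  assert (Cmod v * Cmod (pow_slope v z k) <= K * (INR k * K ^ k))
    by (apply Rmult_le_compat; auto using Cmod_ge_0).
  specialize (Hzk k); specialize (HKk k); nra. }
split; [now apply HB|].
induction m as [|m IH].
{ simpl; replace (0 - 0)%C with (RtoC 0) by ring; rewrite Cmod_0; lra. }
simpl pow_slope.
replace (w * pow_slope w z m + z ^ m - (z * pow_slope z z m + z ^ m))%C
  with (w * (pow_slope w z m - pow_slope z z m) + pow_slope z z m * (w - z))%C by ring.
eapply Rle_trans; [apply Cmod_triangle|]; rewrite !Cmod_mult, S_INR; simpl.
set (D := Cmod (w - z)) in *; assert (HD : 0 <= D) by apply Cmod_ge_0.
assert (H1 : Cmod w * Cmod (pow_slope w z m - pow_slope z z m)
  <= K * (INR m * INR m * K ^ m * D)) by (apply Rmult_le_compat; auto using Cmod_ge_0).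
assert (H2 : Cmod (pow_slope z z m) * D <= INR m * K ^ m * D)
  by (apply Rmult_le_compat_r; [assumption|now apply HB]).
assert (Hm := pos_INR m); specialize (HKk m).
assert (0 <= K ^ m * D) by nra.
assert (INR m * K ^ m * D <= K * (INR m * (K ^ m * D))).
{ assert (0 <= INR m * (K ^ m * D)) by nra; nra. }
assert (0 <= K * (INR m * (K ^ m * D))) by (repeat apply Rmult_le_pos; lra).
assert (0 <= K * (K ^ m * D)) by (apply Rmult_le_pos; lra).
nra.
Qed.

(** Termwise: the difference quotients of the powers form a series that converges
    uniformly near [z]. *)
Lemma half_Theta_diff r z : proper_nome r -> Cdiff (half_Theta r) z.
Proof.
intros Hr; assert (Ha := proper_nome_abs r Hr).
set (K := Cmod z + 1); assert (HK : 1 <= K) by (unfold K; generalize (Cmod_ge_0 z); lra).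
set (psi := fun w => CSeries (fun m => RtoC (r ^ tri m) * pow_slope w z m)%C).
assert (Hsl : forall m, INR m * K ^ m <= (4 * K) ^ m).
{ intros m; rewrite Rpow_mult_distr; apply Rmult_le_compat_r; [apply pow_le; lra|].
  assert (H := pow_le_4 m); destruct m; [simpl; lra|].
  assert (1 <= INR (S m)) by (apply (le_INR 1); lia); nra. }
assert (Hz : Cmod z <= K) by (unfold K; lra).
assert (Hconv : forall w, Cmod w <= K ->
  abs_conv (fun m => RtoC (r ^ tri m) * pow_slope w z m)%C).
{ intros w Hw; apply abs_conv_le with (fun m => Rabs r ^ tri m * (4 * K) ^ m).
  - intros m; rewrite Cmod_mult, Cmod_R, <- RPow_abs.
    apply Rmult_le_compat_l; [apply pow_le; lra|].
    destruct (pow_slope_bound w z K m HK Hw Hz) as [H _].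
    eapply Rle_trans; [exact H|apply Hsl].
  - apply ex_series_tri; lra. }
assert (Hnear : near z (fun w => Cmod w <= K)).
{ exists 1; split; [lra|]; intros w Hw.
  assert (H := Cmod_triangle_rev w z); unfold K; lra. }
exists (psi z); apply is_Cderiv_intro.
- set (Q := Series (fun m => Rabs r ^ tri m * (4 * K) ^ m)).
  assert (HQ : 0 <= Q).
  { eapply Rle_trans; [apply (Cmod_ge_0 (CSeries (fun _ => RtoC 0)))|].
    apply CSeries_le; [|apply ex_series_tri; lra]; intros m; rewrite Cmod_0.
    apply Rmult_le_pos; apply pow_le; lra. }
  intros e He; destruct Hnear as [d [Hd Hw]].
  exists (Rmin d (e / (Q + 1))); split.
  { apply Rmin_glb_lt; [assumption|apply Rdiv_lt_0_compat; lra]. }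
  intros w Hwz; assert (HwK := Hw w (Rlt_le_trans _ _ _ Hwz (Rmin_l _ _))).
  assert (Hwe := Rlt_le_trans _ _ _ Hwz (Rmin_r _ _)).
  unfold psi; rewrite <- CSeries_minus by now apply Hconv.
  eapply Rle_lt_trans.
  + apply CSeries_le with (c := fun m => Cmod (w - z) * (Rabs r ^ tri m * (4 * K) ^ m)).
    * intros m.
      replace (RtoC (r ^ tri m) * pow_slope w z m - RtoC (r ^ tri m) * pow_slope z z m)%C
        with (RtoC (r ^ tri m) * (pow_slope w z m - pow_slope z z m))%C by ring.
      rewrite Cmod_mult, Cmod_R, <- RPow_abs.
      destruct (pow_slope_bound w z K m HK HwK Hz) as [_ H].
      replace (Cmod (w - z) * (Rabs r ^ tri m * (4 * K) ^ m))
        with (Rabs r ^ tri m * ((4 * K) ^ m * Cmod (w - z))) by ring.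
      apply Rmult_le_compat_l; [apply pow_le; lra|].
      eapply Rle_trans; [exact H|]; apply Rmult_le_compat_r; [apply Cmod_ge_0|].
      rewrite Rpow_mult_distr; apply Rmult_le_compat_r; [apply pow_le; lra|apply pow_le_4].
    * apply (ex_series_scal (V := R_NormedModule)), ex_series_tri; lra.
  + rewrite Series_scal_l; fold Q.
    apply Rle_lt_trans with (Cmod (w - z) * (Q + 1)).
    * apply Rmult_le_compat_l; [apply Cmod_ge_0|lra].
    * apply Rlt_div_r; lra.
- revert Hnear; apply near_imp; intros w Hw; unfold psi, half_Theta.
  rewrite Cmult_comm, <- CSeries_scal by now apply Hconv.
  rewrite <- CSeries_plus.
  + apply CSeries_ext; intros m; unfold gterm; rewrite (pow_slope_eq w z m); ring.
  + now apply gterm_conv.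
  + now apply abs_conv_scal, Hconv.
Qed.

Lemma Theta_diff r (x : C) : proper_nome r -> x <> 0 -> Cdiff (Theta r) x.
Proof.
intros Hr Hx; unfold Theta; apply Cdiff_plus.
- apply (Cdiff_comp (half_Theta r) Cinv); [|now apply half_Theta_diff].
  eexists; apply is_Cderiv_inv; assumption.
- apply Cdiff_mult; [apply Cdiff_id|now apply half_Theta_diff].
Qed.

Lemma Theta_conj r (x : C) : x <> 0 -> Theta r (Cconj x) = Cconj (Theta r x).
Proof.
intros Hx.
assert (HG : forall y, half_Theta r (Cconj y) = Cconj (half_Theta r y)).
{ intros y; unfold half_Theta; rewrite <- CSeries_conj; apply CSeries_ext; intros m.
  unfold gterm; rewrite Cmult_conj, Cpow_conj; f_equal.
  unfold Cconj, RtoC; simpl; f_equal; ring. }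
unfold Theta; rewrite Cplus_conj, Cmult_conj, <- !HG, Cinv_conj by assumption; reflexivity.
Qed.

(** ** The sum over the integers and its functional equations *)

Definition Czpow (x : C) (n : Z) : C :=
  match n with
  | Z0 => RtoC 1
  | Zpos p => (x ^ Pos.to_nat p)%C
  | Zneg p => (/ x ^ Pos.to_nat p)%C
  end.

Lemma Czpow_of_nat x m : Czpow x (Z.of_nat m) = (x ^ m)%C.
Proof.
destruct m; [reflexivity|]; simpl Z.of_nat; simpl Czpow.
now rewrite SuccNat2Pos.id_succ.
Qed.

Lemma Czpow_opp_nat (x : C) m : x <> 0 -> Czpow x (- Z.of_nat m) = ((/ x) ^ m)%C.
Proof.
intros Hx; destruct m; [reflexivity|]; simpl Z.of_nat; simpl Czpow.
rewrite SuccNat2Pos.id_succ, Cpow_inv by assumption; reflexivity.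
Qed.

Lemma Czpow_succ (x : C) n : x <> 0 -> Czpow x (n + 1) = (Czpow x n * x)%C.
Proof.
intros Hx; destruct (Z_le_gt_dec 0 n) as [Hn|Hn].
- replace n with (Z.of_nat (Z.to_nat n)) by lia.
  replace (Z.of_nat (Z.to_nat n) + 1)%Z with (Z.of_nat (S (Z.to_nat n))) by lia.
  rewrite !Czpow_of_nat; simpl; ring.
- set (m := Z.to_nat (- n - 1)).
  replace (n + 1)%Z with (- Z.of_nat m)%Z by (unfold m; lia).
  replace n with (- Z.of_nat (S m))%Z by (unfold m; lia).
  rewrite !Czpow_opp_nat by assumption; simpl; field; assumption.
Qed.

Lemma Czpow_add (x : C) n m : x <> 0 -> Czpow x (n + m) = (Czpow x n * Czpow x m)%C.
Proof.
intros Hx; revert m; apply Z.peano_ind.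
- rewrite Z.add_0_r; simpl; ring.
- intros m IH; unfold Z.succ; rewrite Z.add_assoc, !Czpow_succ, IH by assumption; ring.
- intros m IH; replace m with (Z.pred m + 1)%Z in IH by lia.
  rewrite Z.add_assoc, !Czpow_succ in IH by assumption.
  apply (f_equal (fun y => y / x)%C) in IH.
  transitivity (Czpow x (n + Z.pred m) * x / x)%C; [field; assumption|].
  rewrite IH; field; assumption.
Qed.

Lemma Czpow_neq_0 (x : C) n : x <> 0 -> Czpow x n <> 0.
Proof.
intros Hx E; assert (H : (Czpow x n * Czpow x (- n) = 1)%C).
{ rewrite <- Czpow_add, Z.add_opp_diag_r by assumption; reflexivity. }
rewrite E, Cmult_0_l in H; apply (f_equal fst) in H; simpl in H; lra.
Qed.

Lemma Czpow_opp (x : C) n : x <> 0 -> Czpow x (- n) = (/ Czpow x n)%C.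
Proof.
intros Hx; assert (Hn := Czpow_neq_0 x n Hx).
assert (H : (Czpow x n * Czpow x (- n) = 1)%C).
{ rewrite <- Czpow_add, Z.add_opp_diag_r by assumption; reflexivity. }
transitivity (Czpow x n * Czpow x (- n) / Czpow x n)%C; [field; assumption|].
rewrite H; unfold Cdiv; ring.
Qed.

Lemma Czpow_mult (x : C) (y : C) n : x <> 0 -> y <> 0 ->
  Czpow (x * y) n = (Czpow x n * Czpow y n)%C.
Proof.
intros Hx Hy; assert (Hxy := Cmult_neq_0 _ _ Hx Hy).
revert n; apply Z.peano_ind.
- simpl; ring.
- intros n IH; unfold Z.succ; rewrite !Czpow_succ, IH by assumption; ring.
- intros n IH; replace n with (Z.pred n + 1)%Z in IH by lia.
  rewrite !Czpow_succ in IH by assumption.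
  apply (f_equal (fun v => v / (x * y))%C) in IH.
  transitivity (Czpow (x * y) (Z.pred n) * (x * y) / (x * y))%C; [field; split; assumption|].
  rewrite IH; field; split; assumption.
Qed.

Lemma Czpow_inv (x : C) n : x <> 0 -> Czpow (/ x) n = (/ Czpow x n)%C.
Proof.
intros Hx; assert (Hx' := Cinv_neq_0 x Hx); assert (Hn := Czpow_neq_0 x n Hx).
assert (H := Czpow_mult x (/ x) n Hx Hx'); rewrite Cinv_r in H by assumption.
assert (H1 : Czpow 1 n = 1).
{ destruct n; simpl; try reflexivity; rewrite Cpow_1_l; field. }
rewrite H1 in H.
transitivity (Czpow x n * Czpow (/ x) n / Czpow x n)%C; [field; assumption|].
rewrite <- H; unfold Cdiv; ring.
Qed.

Definition triZ (n : Z) : Z := (n * (n - 1) / 2)%Z.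

Lemma triZ_2 n : (2 * triZ n = n * (n - 1))%Z.
Proof.
unfold triZ; assert (H : (n * (n - 1) mod 2 = 0)%Z).
{ destruct (Z.Even_or_Odd n) as [[k ->]|[k ->]].
  - replace (2 * k * (2 * k - 1))%Z with ((k * (2 * k - 1)) * 2)%Z by ring.
    apply Z_mod_mult.
  - replace ((2 * k + 1) * (2 * k + 1 - 1))%Z with (((2 * k + 1) * k) * 2)%Z by ring.
    apply Z_mod_mult. }
assert (H2 := Z_div_mod_eq_full (n * (n - 1)) 2); lia.
Qed.

Definition theta_term (r : R) (x : C) (n : Z) : C := (Czpow (RtoC r) (triZ n) * Czpow x n)%C.

Lemma asum_Theta r (x : C) : proper_nome r -> x <> 0 -> asum (theta_term r x) (Theta r x).
Proof.
intros Hr Hx; assert (HR := RtoC_neq_0 r (proj1 Hr)).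
apply (asum_split (fun m : nat => (- Z.of_nat m)%Z) (fun m : nat => (Z.of_nat m + 1)%Z)
  (fun n => if Z_le_gt_dec n 0 then inl (Z.to_nat (- n)) else inr (Z.to_nat (n - 1)))).
- intros m; destruct (Z_le_gt_dec (- Z.of_nat m) 0); [f_equal|]; lia.
- intros m; destruct (Z_le_gt_dec (Z.of_nat m + 1) 0); [|f_equal]; lia.
- intros n; destruct (Z_le_gt_dec n 0); lia.
- apply (asum_ext (gterm r (/ x))); [|now apply nat_asum, gterm_conv].
  intros m; unfold gterm, theta_term; rewrite Czpow_opp_nat by assumption.
  rewrite RtoC_pow, <- Czpow_of_nat; f_equal; f_equal.
  assert (H1 := tri_2 m); assert (H2 := triZ_2 (- Z.of_nat m)); nia.
- apply (asum_ext (fun m => x * gterm r x m)%C);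
    [|now apply asum_scal, nat_asum, gterm_conv].
  intros m; unfold gterm, theta_term; rewrite Czpow_succ, Czpow_of_nat by assumption.
  rewrite RtoC_pow, <- Czpow_of_nat.
  replace (triZ (Z.of_nat m + 1)) with (Z.of_nat (tri m)); [ring|].
  assert (H1 := tri_2 m); assert (H2 := triZ_2 (Z.of_nat m + 1)); nia.
Qed.

(** The shift [n -> n + 1] of the summation index. *)
Lemma Theta_shift r (x : C) : proper_nome r -> x <> 0 -> Theta r (r * x) = (Theta r x / x)%C.
Proof.
intros Hr Hx; assert (HR := RtoC_neq_0 r (proj1 Hr)).
apply (asum_unique (theta_term r (r * x))); [apply asum_Theta; auto using Cmult_neq_0|].
apply (asum_ext (fun n => / x * theta_term r x (n + 1))%C).
- intros n; unfold theta_term; rewrite Czpow_succ, Czpow_mult by assumption.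
  replace (triZ (n + 1)) with (triZ n + n)%Z
    by (assert (H1 := triZ_2 n); assert (H2 := triZ_2 (n + 1)); lia).
  rewrite Czpow_add by assumption; field; assumption.
- unfold Cdiv; rewrite Cmult_comm; apply asum_scal.
  apply (asum_reindex (fun n => n + 1)%Z (fun n => n - 1)%Z); try (intros; lia).
  now apply asum_Theta.
Qed.

(** The reflection [n -> 1 - n] of the summation index. *)
Lemma Theta_inv r (x : C) : proper_nome r -> x <> 0 -> Theta r (/ x) = (Theta r x / x)%C.
Proof.
intros Hr Hx.
apply (asum_unique (theta_term r (/ x))); [apply asum_Theta; auto using Cinv_neq_0|].
apply (asum_ext (fun n => / x * theta_term r x (1 - n))%C).
- intros n; unfold theta_term; rewrite Czpow_inv by assumption.
  replace (triZ (1 - n)) with (triZ n)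
    by (assert (H1 := triZ_2 n); assert (H2 := triZ_2 (1 - n)); lia).
  replace (1 - n)%Z with (- n + 1)%Z by ring.
  rewrite Czpow_succ, Czpow_opp by assumption; field.
  split; try assumption; now apply Czpow_neq_0.
- unfold Cdiv; rewrite Cmult_comm; apply asum_scal.
  apply (asum_reindex (fun n => 1 - n)%Z (fun n => 1 - n)%Z); try (intros; lia).
  now apply asum_Theta.
Qed.

Lemma Theta_m1 r : proper_nome r -> Theta r (-1) = 0.
Proof.
intros Hr; assert (H := Theta_inv r (-1) Hr Cm1_neq_0).
replace (/ -1)%C with (RtoC (-1)) in H.
2:{ rewrite <- RtoC_inv by lra; f_equal; field. }
set (v := Theta r (-1)) in *.
replace (v / -1)%C with (- v)%C in H by (field; apply Cm1_neq_0).
assert (H2 : (2 * v = 0)%C) by (replace (2 * v)%C with (v - - v)%C by ring; rewrite <- H; ring).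
replace v with (/ 2 * (2 * v))%C.
- rewrite H2; ring.
- field; intros E; apply (f_equal fst) in E; simpl in E; lra.
Qed.

(** Pairs of indices are grouped by the parity of their sum: they are
    [(a + b, a - b)] or [(a + b + 1, a - b)], and in either case the product of
    the two terms splits into a factor depending on [a] and one depending on
    [b]. *)
Theorem Theta_mult r (x : C) (y : C) : proper_nome r -> x <> 0 -> y <> 0 ->
  (Theta r x * Theta r y)%C =
  (Theta (r * r) (x * y) * Theta (r * r) (r * x / y) +
   x * (Theta (r * r) (r * x * y) * Theta (r * r) (r * r * x / y)))%C.
Proof.
intros Hr Hx Hy; assert (HR := RtoC_neq_0 r (proj1 Hr)); assert (Hr2 := proper_nome_sqr r Hr).
assert (Hiy := Cinv_neq_0 y Hy).
apply (asum_unique (tensor (theta_term r x) (theta_term r y))).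
{ apply asum_tensor; now apply asum_Theta. }
apply (asum_split
  (fun p : Z * Z => (fst p + snd p, fst p - snd p)%Z)
  (fun p : Z * Z => (fst p + snd p + 1, fst p - snd p)%Z)
  (fun p : Z * Z => let s := (fst p + snd p)%Z in let d := (fst p - snd p)%Z in
     if Z.even s then inl (s / 2, d / 2)%Z else inr ((s - 1) / 2, (d - 1) / 2)%Z)).
- intros [a b]; simpl.
  replace (a + b + (a - b))%Z with (a * 2)%Z by ring.
  replace (a + b - (a - b))%Z with (b * 2)%Z by ring.
  rewrite Z.even_mul, Bool.orb_true_r, !Z_div_mult by lia; reflexivity.
- intros [a b]; simpl.
  replace (a + b + 1 + (a - b))%Z with (a * 2 + 1)%Z by ring.
  replace (a + b + 1 - (a - b))%Z with (b * 2 + 1)%Z by ring.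
  rewrite Z.even_add, Z.even_mul, Bool.orb_true_r; simpl.
  rewrite !Z.add_simpl_r, !Z_div_mult by lia; reflexivity.
- intros [n m]; simpl; destruct (Z.even (n + m)) eqn:E; simpl.
  + apply Z.even_spec in E; destruct E as [k E].
    replace (n - m)%Z with ((k - m) * 2)%Z by lia.
    rewrite E, (Z.mul_comm 2 k), !Z_div_mult by lia; f_equal; lia.
  + assert (Ho : Z.odd (n + m) = true) by (rewrite <- Z.negb_even, E; reflexivity).
    apply Z.odd_spec in Ho; destruct Ho as [k Ho].
    replace (n - m - 1)%Z with ((k - m) * 2)%Z by lia.
    replace (n + m - 1)%Z with (k * 2)%Z by lia.
    rewrite !Z_div_mult by lia; f_equal; lia.
- apply (asum_ext (tensor (theta_term (r * r) (x * y)) (theta_term (r * r) (r * x / y)))).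
  + intros [a b]; unfold tensor, theta_term, Cdiv; simpl fst; simpl snd.
    rewrite RtoC_mult, !Czpow_mult, !Czpow_inv by auto using Cmult_neq_0.
    replace (a - b)%Z with (a + - b)%Z by ring.
    rewrite (Czpow_add x a b), (Czpow_add y a (- b)), (Czpow_opp y b) by assumption.
    assert (E : (Czpow r (triZ (a + b)) * Czpow r (triZ (a + - b)) =
      Czpow r (triZ a) * Czpow r (triZ a) * (Czpow r (triZ b) * Czpow r (triZ b)) * Czpow r b)%C).
    { rewrite <- !Czpow_add by assumption; f_equal.
      assert (H1 := triZ_2 (a + b)); assert (H2 := triZ_2 (a + - b));
      assert (H3 := triZ_2 a); assert (H4 := triZ_2 b); nia. }
    transitivity (Czpow r (triZ (a + b)) * Czpow r (triZ (a + - b)) *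
      (Czpow x a * Czpow x b * Czpow y a * / Czpow y b))%C; [rewrite E; ring|ring].
  + apply asum_tensor; apply asum_Theta; unfold Cdiv; auto using Cmult_neq_0.
- apply (asum_ext (fun p => x * tensor (theta_term (r * r) (r * x * y))
    (theta_term (r * r) (r * r * x / y)) p)%C).
  + intros [a b]; unfold tensor, theta_term, Cdiv; simpl fst; simpl snd.
    rewrite RtoC_mult, !Czpow_mult, !Czpow_inv by auto using Cmult_neq_0.
    replace (a - b)%Z with (a + - b)%Z by ring.
    rewrite (Czpow_succ x (a + b)), (Czpow_add x a b), (Czpow_add y a (- b)), (Czpow_opp y b)
      by assumption.
    assert (E : (Czpow r (triZ (a + b + 1)) * Czpow r (triZ (a + - b)) =
      Czpow r (triZ a) * Czpow r (triZ a) * (Czpow r (triZ b) * Czpow r (triZ b)) *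
      Czpow r a * Czpow r b * Czpow r b)%C).
    { rewrite <- !Czpow_add by assumption; f_equal.
      assert (H1 := triZ_2 (a + b + 1)); assert (H2 := triZ_2 (a + - b));
      assert (H3 := triZ_2 a); assert (H4 := triZ_2 b); nia. }
    transitivity (Czpow r (triZ (a + b + 1)) * Czpow r (triZ (a + - b)) *
      (Czpow x a * Czpow x b * x * Czpow y a * / Czpow y b))%C; [rewrite E; ring|ring].
  + apply asum_scal, asum_tensor; apply asum_Theta; unfold Cdiv; auto using Cmult_neq_0.
Qed.

(** For [y = - x] the second product of [Theta_mult] contains
    [Theta (r * r) (r * r * -1)], which is zero. *)
Lemma Theta_opp_mult r (x : C) : proper_nome r -> x <> 0 ->
  (Theta r x * Theta r (- x))%C = (Theta (r * r) (- (x * x)) * Theta (r * r) (- r))%C.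
Proof.
intros Hr Hx; assert (HR := RtoC_neq_0 r (proj1 Hr)).
assert (Hx' : (- x)%C <> 0).
{ intros H; apply Hx; replace x with (- - x)%C by ring; rewrite H; ring. }
rewrite Theta_mult by assumption.
replace (r * r * x / - x)%C with (RtoC (r * r) * -1)%C
  by (rewrite RtoC_mult; field; assumption).
rewrite Theta_shift, Theta_m1 by (try apply Cm1_neq_0; now apply proper_nome_sqr).
replace (x * - x)%C with (- (x * x))%C by ring.
replace (r * x / - x)%C with (- r)%C by (field; assumption).
unfold Cdiv; ring.
Qed.

(** * Zeros of the theta function *)

(** [|r|^(1/2) <= |x| <= |r|^(-1/2)], a fundamental annulus for [x -> r x]. *)
Definition annulus (r : R) (x : C) : Prop :=
  Rabs r <= Cmod x ^ 2 /\ Rabs r * Cmod x ^ 2 <= 1.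

Definition simple_zeros (r : R) : Prop :=
  (forall x, annulus r x -> x <> RtoC (-1) -> Theta r x <> 0) /\
  (forall d, is_Cderiv (Theta r) (-1) d -> d <> 0).

Lemma annulus_neq_0 r x : proper_nome r -> annulus r x -> x <> 0.
Proof.
intros Hr [H _] ->; rewrite Cmod_0 in H; generalize (proper_nome_abs r Hr); simpl in H; lra.
Qed.

Lemma annulus_sqr r x : proper_nome r -> annulus r x -> annulus (r * r) (- (x * x)).
Proof.
intros Hr [H1 H2]; assert (Ha := proper_nome_abs r Hr); unfold annulus.
rewrite Rabs_mult, Cmod_opp, Cmod_mult.
assert (0 <= Cmod x ^ 2) by apply pow2_ge_0.
replace ((Cmod x * Cmod x) ^ 2) with (Cmod x ^ 2 * Cmod x ^ 2) by ring.
split; [apply Rmult_le_compat; lra|].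
replace (Rabs r * Rabs r * (Cmod x ^ 2 * Cmod x ^ 2))
  with ((Rabs r * Cmod x ^ 2) * (Rabs r * Cmod x ^ 2)) by ring.
assert (0 <= Rabs r * Cmod x ^ 2) by (apply Rmult_le_pos; lra); nra.
Qed.

Lemma annulus_opp_nome r : proper_nome r -> annulus (r * r) (- r).
Proof.
intros Hr; assert (Ha := proper_nome_abs r Hr); unfold annulus.
rewrite Rabs_mult, Cmod_opp, Cmod_R; split; [simpl; lra|].
replace (Rabs r * Rabs r * Rabs r ^ 2) with ((Rabs r * Rabs r) * (Rabs r * Rabs r)) by ring.
assert (0 <= Rabs r * Rabs r <= 1) by nra; nra.
Qed.

(** The alternating sum of the powers [x^j], [-m <= j <= m], with coefficient 1
    at [j = m]. *)
Fixpoint alt_sum (x : C) (m : nat) : C :=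
  match m with O => RtoC 1 | S k => (x ^ S k + (/ x) ^ S k - alt_sum x k)%C end.

Lemma alt_sum_eq (x : C) m : x <> 0 -> ((1 + x) * alt_sum x m = (/ x) ^ m + x * x ^ m)%C.
Proof.
intros Hx; induction m as [|m IH]; [simpl; ring|].
simpl alt_sum.
transitivity ((1 + x) * (x * x ^ m + / x * (/ x) ^ m) - (1 + x) * alt_sum x m)%C; [ring|].
rewrite IH; simpl; field; assumption.
Qed.

Lemma alt_sum_bound (x : C) Y m : 1 <= Y -> Cmod x <= Y -> Cmod (/ x) <= Y ->
  Cmod (alt_sum x m) <= (3 * Y) ^ m.
Proof.
intros HY Hx Hx'; induction m as [|m IH]; [simpl; rewrite Cmod_1; lra|].
simpl alt_sum; eapply Rle_trans; [apply Cmod_triangle_sub|].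
eapply Rle_trans; [apply Rplus_le_compat_r, Cmod_triangle|].
change (x * x ^ m)%C with (x ^ S m)%C; change (/ x * (/ x) ^ m)%C with ((/ x) ^ S m)%C.
rewrite !Cmod_pow.
assert (H1 : Cmod x ^ S m <= Y ^ S m)
  by (apply pow_incr; split; [apply Cmod_ge_0|assumption]).
assert (H2 : Cmod (/ x) ^ S m <= Y ^ S m)
  by (apply pow_incr; split; [apply Cmod_ge_0|assumption]).
rewrite Rpow_mult_distr in *.
assert (H3 : 1 <= 3 ^ m) by (apply pow_R1_Rle; lra).
assert (H4 : 0 < Y ^ m) by (apply pow_lt; lra).
simpl in *.
assert (3 ^ m * Y ^ m <= 3 ^ m * (Y * Y ^ m)) by (apply Rmult_le_compat_l; nra).
assert (Y * Y ^ m <= 3 ^ m * (Y * Y ^ m)) by (assert (0 < Y * Y ^ m) by nra; nra).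
lra.
Qed.

(** For a small nome the leading term [1 + x] of [Theta r x] dominates. *)
Lemma Theta_small r x : proper_nome r -> Rabs r < 1 / 49 -> annulus r x ->
  Cmod (1 + x) / 4 <= Cmod (Theta r x).
Proof.
intros Hr Hr1 Hann; assert (Hx := annulus_neq_0 r x Hr Hann).
assert (Ha := proper_nome_abs r Hr); destruct Hann as [An1 An2].
assert (Hxp := proj1 (Cmod_gt_0 x) Hx).
(* With [|x|] and [1 / |x|] at most [1 / rho], the m-th term is at most
   [rho^(m (m + 1)) (3 / rho)^m <= (3 rho)^m]; the bound on [r] makes [rho < 1/7]. *)
set (rho := sqrt (Rabs r)).
assert (Hrho : 0 < rho) by (apply sqrt_lt_R0; lra).
assert (Hrr : rho * rho = Rabs r) by (apply sqrt_sqrt; lra).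
assert (Hrho7 : rho < 1 / 7) by nra.
set (Y := / rho).
assert (HY : rho * Y = 1) by (unfold Y; field; lra).
assert (HY1 : 1 <= Y) by nra.
assert (Hx1 : Cmod x <= Y).
{ apply Rsqr_incr_0; unfold Rsqr; [|lra|lra].
  assert (Rabs r * (Cmod x * Cmod x) <= Rabs r * (Y * Y)); [|nra].
  rewrite <- Hrr at 2; replace (rho * rho * (Y * Y)) with ((rho * Y) * (rho * Y)) by ring.
  rewrite HY; simpl in An2; rewrite Rmult_1_r in An2; lra. }
assert (Hx2 : Cmod (/ x) <= Y).
{ rewrite Cmod_inv by assumption; apply Rinv_le_contravar; [assumption|].
  apply Rsqr_incr_0; unfold Rsqr; simpl in An1; nra. }
set (f := fun m => (RtoC (r ^ tri m) * alt_sum x m)%C).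
assert (Hf : forall m, Cmod (f m) <= (3 * rho) ^ m).
{ intros m; unfold f; rewrite Cmod_mult, Cmod_R, <- RPow_abs, <- Hrr.
  eapply Rle_trans.
  - apply Rmult_le_compat_l; [apply pow_le; nra|].
    apply (alt_sum_bound x Y m HY1 Hx1 Hx2).
  - rewrite !Rpow_mult_distr.
    replace (rho ^ tri m * rho ^ tri m) with (rho ^ (m * m + m))
      by (rewrite <- pow_add, <- tri_2; f_equal; lia).
    rewrite pow_add.
    replace (rho ^ (m * m) * rho ^ m * (3 ^ m * Y ^ m))
      with (3 ^ m * rho ^ (m * m) * (rho ^ m * Y ^ m)) by ring.
    rewrite <- (Rpow_mult_distr rho Y), HY, pow1, Rmult_1_r.
    apply Rmult_le_compat_l; [apply pow_le; lra|].
    destruct m as [|m]; [simpl; lra|].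
    replace (S m * S m)%nat with (S m + S m * m)%nat by lia.
    rewrite pow_add; assert (0 < rho ^ S m) by (apply pow_lt; lra).
    assert (rho ^ (S m * m) <= 1).
    { rewrite <- (pow1 (S m * m)); apply pow_incr; lra. }
    nra. }
assert (Hgeo : ex_series (fun m => (3 * rho) ^ m))
  by (apply ex_series_geom; rewrite Rabs_right; lra).
assert (Hconv : abs_conv f) by (apply abs_conv_le with (1 := Hf); assumption).
assert (HJ : Theta r x = ((1 + x) * CSeries f)%C).
{ rewrite <- CSeries_scal by assumption; unfold Theta, half_Theta.
  rewrite <- CSeries_scal, <- CSeries_plus; try apply abs_conv_scal; try now apply gterm_conv.
  apply CSeries_ext; intros m; unfold gterm, f.
  replace ((1 + x) * (RtoC (r ^ tri m) * alt_sum x m))%C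
    with (RtoC (r ^ tri m) * ((1 + x) * alt_sum x m))%C by ring.
  rewrite alt_sum_eq by assumption; ring. }
assert (HS : 1 / 4 <= Cmod (CSeries f)).
{ rewrite CSeries_incr_1 by assumption.
  assert (Hsum : Cmod (CSeries (fun n => f (S n))) <= 3 / 4).
  { eapply Rle_trans.
    - apply CSeries_le with (c := fun n => 3 * rho * (3 * rho) ^ n).
      + intros n; apply (Hf (S n)).
      + apply (ex_series_scal (V := R_NormedModule)); assumption.
    - rewrite Series_scal_l, Series_geom by (rewrite Rabs_right; lra).
      apply Rmult_le_reg_r with (1 - 3 * rho); [lra|].
      replace (3 * rho * / (1 - 3 * rho) * (1 - 3 * rho)) with (3 * rho) by (field; lra).
      lra. }
  assert (H1 : Cmod (f O) = 1).
  { unfold f; simpl; rewrite Cmult_1_r; apply Cmod_1. }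
  assert (Ht := Cmod_triangle_rev (f O) (- CSeries (fun n => f (S n)))).
  rewrite Cmod_opp in Ht.
  replace (f O - - CSeries (fun n => f (S n)))%C
    with (f O + CSeries (fun n => f (S n)))%C in Ht by ring.
  lra. }
rewrite HJ, Cmod_mult; assert (H0 := Cmod_ge_0 (1 + x)); nra.
Qed.

Lemma annulus_near r : proper_nome r -> near (RtoC (-1)) (annulus r).
Proof.
intros Hr; assert (Ha := proper_nome_abs r Hr).
assert (Hs : 0 < 1 - Rabs r < 1) by lra.
exists ((1 - Rabs r) / 4); split; [lra|]; intros w Hw.
assert (H1 := Cmod_triangle_rev w (RtoC (-1))).
assert (H2 := Cmod_triangle_rev (RtoC (-1)) w).
rewrite Cmod_minus_sym in H2; rewrite Cmod_R in *.
rewrite (Rabs_left (-1)) in * by lra.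
set (a := Rabs r) in *; set (t := Cmod w) in *; unfold annulus; fold a t.
assert (L : 1 - (1 - a) / 4 <= t) by lra.
assert (U : t <= 1 + (1 - a) / 4) by lra.
replace (t ^ 2) with (t * t) by ring; split.
- apply Rle_trans with ((1 - (1 - a) / 4) * (1 - (1 - a) / 4)).
  + assert (0 <= (1 - a) * (9 - a)) by (apply Rmult_le_pos; lra); nra.
  + apply Rmult_le_compat; lra.
- apply Rle_trans with (a * ((1 + (1 - a) / 4) * (1 + (1 - a) / 4))).
  + apply Rmult_le_compat_l; [lra|]; apply Rmult_le_compat; lra.
  + assert (0 <= (1 - a) * (16 - 9 * a + a * a)) by (apply Rmult_le_pos; nra); nra.
Qed.

Lemma simple_zeros_small r : proper_nome r -> Rabs r < 1 / 49 -> simple_zeros r.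
Proof.
intros Hr Hr1; split.
- intros x Hann Hx E; assert (H := Theta_small r x Hr Hr1 Hann).
  rewrite E, Cmod_0 in H.
  assert (Hp : 0 < Cmod (1 + x)); [|lra].
  apply Cmod_gt_0; intros E1; apply Hx.
  replace x with ((1 + x) - 1)%C by ring; rewrite E1.
  unfold Cminus, Cplus, Copp, RtoC; simpl; f_equal; ring.
- intros d Hd E; subst d.
  destruct (Hd (1 / 4) ltac:(lra)) as [e [He H]].
  destruct (near_and _ _ _ (annulus_near r Hr) (ex_intro _ e (conj He H)))
    as [e' [He' H']]; clear H.
  set (w := (RtoC (-1) + RtoC (e' / 2))%C).
  assert (Hw : (w - RtoC (-1))%C = RtoC (e' / 2)) by (unfold w; ring).
  assert (Hw0 : Cmod (w - RtoC (-1)) = e' / 2)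
    by (rewrite Hw, Cmod_R, Rabs_right; lra).
  destruct (H' w ltac:(lra)) as [Hann Hs].
  assert (Hne : w <> RtoC (-1)).
  { intros E; rewrite E in Hw0; replace (RtoC (-1) - RtoC (-1))%C with (RtoC 0) in Hw0 by ring.
    rewrite Cmod_0 in Hw0; lra. }
  rewrite slope_at, slope_ne, Theta_m1 in Hs by assumption.
  replace ((Theta r w - 0) / (w - RtoC (-1)) - 0)%C with (Theta r w / (w - RtoC (-1)))%C in Hs
    by (unfold Cdiv; ring).
  rewrite Cmod_div in Hs by now apply Cminus_neq.
  assert (HJ := Theta_small r w Hr Hr1 Hann).
  replace (1 + w)%C with (w - RtoC (-1))%C in HJ.
  2:{ unfold Cminus, Cplus, Copp, RtoC; simpl; f_equal; ring. }
  rewrite Hw0 in *.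
  assert (Cmod (Theta r w) < 1 / 4 * (e' / 2)) by (apply Rlt_div_l; [lra|exact Hs]); lra.
Qed.

(** By [Theta_opp_mult] a zero [x] of [Theta r] in the annulus has [- x^2 = -1],
    so [x] is [1] or [- 1]. Comparing the derivatives of both sides at [- 1], where
    the right-hand side has a simple zero, excludes [1] and shows that the zero
    [- 1] is simple. The constant factor [Theta (r * r) (- r)] is not zero because
    [- r] itself lies in the annulus of [r^2]. *)
Lemma simple_zeros_descent r : proper_nome r -> simple_zeros (r * r) -> simple_zeros r.
Proof.
intros Hr [Hz Hd]; assert (Hr2 := proper_nome_sqr r Hr).
set (c := Theta (r * r) (- r)).
assert (Hc : c <> 0).
{ apply Hz; [now apply annulus_opp_nome|]; intros E; apply (f_equal fst) in E.
  simpl in E; destruct Hr as [_ Hr]; apply Rabs_def2 in Hr; lra. }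
assert (H1 : RtoC 1 <> 0) by (apply RtoC_neq_0; lra).
destruct (Theta_diff r (-1) Hr Cm1_neq_0) as [d Hd1].
destruct (Theta_diff r 1 Hr H1) as [d1 Hd2].
destruct (Theta_diff (r * r) (-1) Hr2 Cm1_neq_0) as [d2 Hd3].
assert (Hopp := is_Cderiv_scal (-1) _ _ _ (is_Cderiv_id (-1))).
assert (Hsq := is_Cderiv_scal (-1) _ _ _
  (is_Cderiv_mult _ _ (-1) _ _ (is_Cderiv_id (-1)) (is_Cderiv_id (-1)))).
assert (Em : (-1 * -1)%C = RtoC 1) by (unfold Cmult, RtoC; simpl; f_equal; ring).
assert (Em2 : (-1 * (-1 * -1))%C = RtoC (-1)) by (rewrite Em; ring).
rewrite <- Em in Hd2.
assert (HL := is_Cderiv_mult _ _ _ _ _ Hd1 (is_Cderiv_comp (Theta r) _ _ _ _ Hopp Hd2)).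
rewrite <- Em2 in Hd3 at 1.
assert (HR := is_Cderiv_mult _ _ (-1) _ _ (is_Cderiv_comp (Theta (r * r)) _ _ _ _ Hsq Hd3)
  (is_Cderiv_const c (-1))).
assert (E : (d * Theta r 1)%C = (d2 * 2 * c)%C).
{ simpl in HL, HR; rewrite Em, Theta_m1 in HL by assumption.
  transitivity (d * Theta r 1 + 0 * (d1 * (-1 * 1)))%C; [ring|].
  transitivity (d2 * (-1 * (1 * -1 + -1 * 1)) * c + Theta (r * r) (-1 * (-1 * -1)) * 0)%C;
    [|ring].
  eapply is_Cderiv_unique; [|exact HR].
  revert HL; apply is_Cderiv_ext_near.
  generalize (annulus_near r Hr); apply near_imp; intros w Hw.
  assert (Hw0 := annulus_neq_0 r w Hr Hw).
  replace (-1 * w)%C with (- w)%C by ring; rewrite Theta_opp_mult by assumption.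
  replace (-1 * (w * w))%C with (- (w * w))%C by ring; reflexivity. }
assert (Hne : (d * Theta r 1)%C <> 0).
{ rewrite E; repeat apply Cmult_neq_0; try assumption.
  - rewrite Em2 in Hd3; now apply Hd.
  - apply RtoC_neq_0; lra. }
split.
- intros x Hann Hx E0.
  assert (Hx0 := annulus_neq_0 r x Hr Hann).
  assert (HP := Theta_opp_mult r x Hr Hx0); fold c in HP; rewrite E0, Cmult_0_l in HP.
  destruct (excluded_middle_informative (x = RtoC 1)) as [->|Hx1].
  { apply Hne; rewrite E0; ring. }
  apply (Cmult_neq_0 (Theta (r * r) (- (x * x))) c); [|assumption|now symmetry].
  apply Hz; [now apply annulus_sqr|]; intros Exx.
  assert (Hprod : ((x - RtoC 1) * (x - RtoC (-1)))%C <> 0)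
    by (apply Cmult_neq_0; now apply Cminus_neq).
  apply Hprod; replace ((x - RtoC 1) * (x - RtoC (-1)))%C
    with (RtoC (-1) - - (x * x))%C.
  + rewrite Exx; ring.
  + destruct x as [p q]; unfold Cminus, Cplus, Copp, Cmult, RtoC; simpl; f_equal; ring.
- intros d' Hd'; rewrite (is_Cderiv_unique _ _ _ _ Hd' Hd1).
  intros E0; apply Hne; rewrite E0; ring.
Qed.

(** Repeated squaring makes the nome as small as [simple_zeros_small] needs. *)
Theorem Theta_simple_zeros r : proper_nome r -> simple_zeros r.
Proof.
intros Hr.
assert (H : forall n r, proper_nome r -> Rabs r ^ (2 ^ n) < 1 / 49 -> simple_zeros r).
{ induction n as [|n IH]; intros s Hs Hn.
  - simpl in Hn; rewrite Rmult_1_r in Hn; now apply simple_zeros_small.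
  - apply simple_zeros_descent; [assumption|]; apply IH; [now apply proper_nome_sqr|].
    rewrite Rabs_mult, Rpow_mult_distr, <- pow_add.
    replace (2 ^ n + 2 ^ n)%nat with (2 ^ S n)%nat by (simpl; lia); assumption. }
assert (Ha := proper_nome_abs r Hr).
destruct (pow_lt_1_zero (Rabs r) ltac:(rewrite Rabs_Rabsolu; lra) (1 / 49) ltac:(lra))
  as [n Hn].
apply (H n); [assumption|].
assert (Hn2 : (n <= 2 ^ n)%nat) by (apply Nat.lt_le_incl, Nat.pow_gt_lin_r; lia).
specialize (Hn (2 ^ n)%nat Hn2).
rewrite Rabs_right in Hn; [assumption|apply Rle_ge, pow_le; lra].
Qed.

(** * Theta constants and the nome *)

Lemma proper_nome_pos q : 0 < q < 1 -> proper_nome q.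
Proof. intros Hq; split; [lra|rewrite Rabs_right; lra]. Qed.

Lemma proper_nome_sq q : 0 < q < 1 -> proper_nome (q * q).
Proof. intros Hq; now apply proper_nome_sqr, proper_nome_pos. Qed.

Lemma sq_lt_1 q : 0 < q < 1 -> 0 < q * q < 1.
Proof. intros; nra. Qed.

Lemma RtoC_inj a b : RtoC a = RtoC b -> a = b.
Proof. intros H; now apply (f_equal fst) in H. Qed.

Lemma sq_pow_tri q m : (q * q) ^ tri m = q ^ (m * m) * q ^ m.
Proof.
rewrite Rpow_mult_distr, <- !pow_add; f_equal; generalize (tri_2 m); lia.
Qed.

Lemma theta3_Theta q : 0 < q < 1 -> Theta (q * q) q = RtoC (theta3_0 q).
Proof.
intros Hq; assert (HR := RtoC_neq_0 q ltac:(lra)); assert (Hs := proper_nome_sq q Hq).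
unfold Theta, half_Theta; rewrite CSeries_incr_1 by now apply gterm_conv.
rewrite <- CSeries_scal by now apply gterm_conv.
assert (E1 : forall n, gterm (q * q) (/ q) (S n) = RtoC (q ^ (S n * S n))).
{ intros n; unfold gterm; rewrite sq_pow_tri, RtoC_mult, !RtoC_pow, Cpow_inv by assumption.
  field; now apply Cpow_nz. }
assert (E2 : forall n, (q * gterm (q * q) q n)%C = RtoC (q ^ (S n * S n))).
{ intros n; unfold gterm; rewrite sq_pow_tri, <- RtoC_pow, <- !RtoC_mult; f_equal.
  replace (S n * S n)%nat with (S (n * n + n + n)) by lia.
  simpl; rewrite !pow_add; ring. }
rewrite (CSeries_ext _ _ E1), (CSeries_ext _ _ E2), CSeries_RtoC.
unfold gterm, theta3_0; simpl tri; simpl pow; simpl Cpow.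
rewrite RtoC_plus, RtoC_mult; ring.
Qed.

Lemma Rpower_half_square q n : 0 < q ->
  Rpower q ((INR n + 1 / 2) ^ 2) = Rpower q (1 / 4) * (q * q) ^ tri n.
Proof.
intros Hq; rewrite Rpow_mult_distr, <- pow_add, <- (Rpower_pow (tri n + tri n)),
  <- Rpower_plus by assumption.
f_equal; replace (tri n + tri n)%nat with (n * n + n)%nat by (generalize (tri_2 n); lia).
rewrite plus_INR, mult_INR; field.
Qed.

Lemma theta2_Theta q : 0 < q < 1 ->
  (RtoC (Rpower q (1 / 4)) * Theta (q * q) 1)%C = RtoC (theta2_0 q).
Proof.
intros Hq.
assert (E : forall n, gterm (q * q) 1 n = RtoC ((q * q) ^ tri n)).
{ intros n; unfold gterm; rewrite Cpow_1_l; ring. }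
unfold Theta, half_Theta; replace (/ 1)%C with (RtoC 1) by field.
rewrite (CSeries_ext _ _ E), CSeries_RtoC.
unfold theta2_0.
rewrite (Series_ext (fun n => Rpower q ((INR n + 1 / 2) ^ 2))
  (fun n => Rpower q (1 / 4) * (q * q) ^ tri n))
  by (intros; apply Rpower_half_square; lra).
rewrite Series_scal_l, !RtoC_mult; ring.
Qed.

Lemma pow_sq_le q n m : 0 < q < 1 -> (n <= m)%nat -> q ^ m <= q ^ n.
Proof.
intros Hq H; replace m with (n + (m - n))%nat by lia; rewrite pow_add.
assert (0 < q ^ n) by (apply pow_lt; lra).
assert (q ^ (m - n) <= 1) by (rewrite <- (pow1 (m - n)); apply pow_incr; lra); nra.
Qed.

Lemma Series_geom_bounds q a : 0 < q < 1 -> (forall n, 0 <= a n <= q ^ n) ->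
  a O <= Series a /\ (q <= 1 / 4 -> Series a <= 4 / 3).
Proof.
intros Hq Ha.
assert (Hg : ex_series (fun n => q ^ n)) by (apply ex_series_geom; rewrite Rabs_right; lra).
assert (Hs : ex_series a).
{ apply (ex_series_le (V := R_CompleteNormedModule) _ (fun n => q ^ n)); [|assumption].
  intros n; unfold norm; simpl; unfold abs; simpl.
  rewrite Rabs_right; [apply Ha|apply Rle_ge, Ha]. }
split.
- rewrite Series_incr_1 by assumption.
  assert (0 <= Series (fun n => a (S n))); [|lra].
  rewrite <- (Rmult_0_l (Series (fun _ => 0))), <- Series_scal_l.
  apply Series_le; [intros n; rewrite Rmult_0_l; split; [lra|apply Ha]|].
  now apply ex_series_incr_1 in Hs.
- intros Hq4; eapply Rle_trans; [apply (Series_le _ (fun n => q ^ n)); assumption|].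
  rewrite Series_geom by (rewrite Rabs_right; lra).
  apply Rmult_le_reg_r with (1 - q); [lra|]; rewrite Rinv_l; lra.
Qed.

Lemma theta3_bounds q : 0 < q < 1 ->
  1 <= theta3_0 q /\ (q <= 1 / 4 -> theta3_0 q <= 4).
Proof.
intros Hq; destruct (Series_geom_bounds q (fun n => q ^ (S n * S n)) Hq) as [H1 H2].
- intros n; split; [apply pow_le; lra|apply pow_sq_le; [assumption|lia]].
- assert (0 < q ^ (1 * 1)) by (apply pow_lt; lra); unfold theta3_0; split; [lra|].
  intros Hq4; specialize (H2 Hq4); lra.
Qed.

Lemma theta2_bounds q : 0 < q < 1 ->
  2 * Rpower q (1 / 4) <= theta2_0 q /\
  (q <= 1 / 4 -> theta2_0 q <= 4 * Rpower q (1 / 4)).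
Proof.
intros Hq; unfold theta2_0.
rewrite (Series_ext (fun n => Rpower q ((INR n + 1 / 2) ^ 2))
  (fun n => Rpower q (1 / 4) * (q * q) ^ tri n))
  by (intros; apply Rpower_half_square; lra).
rewrite Series_scal_l.
assert (Hp : 0 < Rpower q (1 / 4)) by apply exp_pos.
destruct (Series_geom_bounds q (fun n => (q * q) ^ tri n) Hq) as [H1 H2].
- intros n; rewrite sq_pow_tri, <- pow_add; split; [apply pow_le; lra|].
  apply pow_sq_le; [assumption|lia].
- simpl in H1; split; [nra|]; intros Hq4; specialize (H2 Hq4); nra.
Qed.

Lemma theta_pos q : 0 < q < 1 -> 0 < theta2_0 q /\ 0 < theta3_0 q.
Proof.
intros Hq; assert (H2 := proj1 (theta2_bounds q Hq)); assert (H3 := proj1 (theta3_bounds q Hq)).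
assert (0 < Rpower q (1 / 4)) by apply exp_pos; lra.
Qed.

Lemma Rpower_quarter_sq q : 0 < q ->
  Rpower (q * q) (1 / 4) = Rpower q (1 / 4) * Rpower q (1 / 4).
Proof. intros; now rewrite Rpower_mult_distr. Qed.

Lemma Rpower_quarter_4 q : 0 < q -> Rpower q (1 / 4) ^ 4 = q.
Proof.
intros Hq; rewrite <- Rpower_pow by apply exp_pos; rewrite Rpower_mult.
replace (1 / 4 * INR 4) with 1 by (simpl; field); now apply Rpower_1.
Qed.

(** Landen's transformation of the theta constants. *)
Lemma theta3_landen q : 0 < q < 1 ->
  theta3_0 q ^ 2 = theta3_0 (q * q) ^ 2 + theta2_0 (q * q) ^ 2.
Proof.
intros Hq; assert (Hq2 := sq_lt_1 q Hq); assert (HR := RtoC_neq_0 q ltac:(lra)).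
assert (H1 : RtoC 1 <> 0) by (apply RtoC_neq_0; lra).
apply RtoC_inj; rewrite RtoC_plus, !RtoC_pow, <- theta3_Theta, <- theta3_Theta, <- theta2_Theta
  by assumption.
simpl Cpow; rewrite !Cmult_1_r, (Theta_mult (q * q) q q) by (auto using proper_nome_sq).
assert (Hsh : Theta (q * q * (q * q)) (RtoC (q * q * (q * q))) = Theta (q * q * (q * q)) 1).
{ transitivity (Theta (q * q * (q * q)) (RtoC (q * q * (q * q)) * 1)%C); [f_equal; ring|].
  rewrite Theta_shift by (try assumption; now apply proper_nome_sq); field. }
replace (RtoC q * RtoC q)%C with (RtoC (q * q)) by now rewrite RtoC_mult.
replace (RtoC (q * q) * q / q)%C with (RtoC (q * q)) by (field; assumption).
replace (RtoC (q * q) * q * q)%C with (RtoC (q * q * (q * q))) by (rewrite !RtoC_mult; ring).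
replace (RtoC (q * q) * RtoC (q * q) * q / q)%C with (RtoC (q * q * (q * q)))
  by (rewrite !RtoC_mult; field; assumption).
rewrite !Hsh, Rpower_quarter_sq by lra.
assert (Hp : RtoC q = (RtoC (Rpower q (1 / 4)) ^ 4)%C).
{ rewrite <- RtoC_pow, Rpower_quarter_4 by lra; reflexivity. }
rewrite Hp, (RtoC_mult (Rpower q (1 / 4))); simpl Cpow; ring.
Qed.

Lemma theta2_landen q : 0 < q < 1 ->
  theta2_0 q ^ 2 = 2 * (theta2_0 (q * q) * theta3_0 (q * q)).
Proof.
intros Hq; assert (Hq2 := sq_lt_1 q Hq); assert (HR := RtoC_neq_0 q ltac:(lra)).
assert (H1 : RtoC 1 <> 0) by (apply RtoC_neq_0; lra).
apply RtoC_inj; rewrite !RtoC_mult, !RtoC_pow, <- theta3_Theta, <- !theta2_Theta by assumption.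
rewrite Cpow_mult_l; replace (Theta (q * q) 1 ^ 2)%C
  with (Theta (q * q) 1 * Theta (q * q) 1)%C by (simpl; ring).
rewrite (Theta_mult (q * q) 1 1) by (auto using proper_nome_sq).
assert (Hsh : Theta (q * q * (q * q)) (RtoC (q * q * (q * q))) = Theta (q * q * (q * q)) 1).
{ transitivity (Theta (q * q * (q * q)) (RtoC (q * q * (q * q)) * 1)%C); [f_equal; ring|].
  rewrite Theta_shift by (try assumption; now apply proper_nome_sq); field. }
replace (1 * 1)%C with (RtoC 1) by ring.
replace (RtoC (q * q) * 1 / 1)%C with (RtoC (q * q)) by field.
replace (RtoC (q * q) * 1 * 1)%C with (RtoC (q * q)) by ring.
replace (RtoC (q * q) * RtoC (q * q) * 1 / 1)%C with (RtoC (q * q * (q * q)))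
  by (rewrite !RtoC_mult; field).
rewrite Hsh, Rpower_quarter_sq, (RtoC_mult (Rpower q (1 / 4))) by lra.
simpl Cpow; ring.
Qed.

Lemma modulus_le_1 q : 0 < q < 1 -> modulus q <= 1.
Proof.
intros Hq; destruct (theta_pos q Hq) as [P2 P3].
unfold modulus; apply Rle_div_l; [apply pow_lt; lra|].
rewrite Rmult_1_l, theta2_landen, theta3_landen by assumption.
generalize (pow2_ge_0 (theta3_0 (q * q) - theta2_0 (q * q))); nra.
Qed.

(** With [t = theta2_0 (q^2) / theta3_0 (q^2)] in [(0, 1]], Landen's
    transformation reads [modulus q = 2 t / (1 + t^2)] and
    [modulus (q^2) = t^2]. *)
Lemma modulus_descent q p : 0 < q < 1 -> 0 < p < 1 -> modulus q = modulus p ->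
  modulus (q * q) = modulus (p * p).
Proof.
intros Hq Hp; assert (Hq2 := sq_lt_1 q Hq); assert (Hp2 := sq_lt_1 p Hp).
assert (Lq := modulus_le_1 _ Hq2); assert (Lp := modulus_le_1 _ Hp2).
destruct (theta_pos _ Hq2) as [A2 A3], (theta_pos _ Hp2) as [B2 B3].
unfold modulus at 1 2; rewrite (theta2_landen q), (theta2_landen p), (theta3_landen q),
  (theta3_landen p) by assumption.
unfold modulus in *.
set (t := theta2_0 (q * q) / theta3_0 (q * q)).
set (s := theta2_0 (p * p) / theta3_0 (p * p)).
assert (Ht : 0 < t) by now apply Rdiv_lt_0_compat.
assert (Hs : 0 < s) by now apply Rdiv_lt_0_compat.
replace (theta2_0 (q * q) ^ 2 / theta3_0 (q * q) ^ 2) with (t * t) in *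
  by (unfold t; field; lra).
replace (theta2_0 (p * p) ^ 2 / theta3_0 (p * p) ^ 2) with (s * s) in *
  by (unfold s; field; lra).
assert (Ht1 : t <= 1) by nra; assert (Hs1 : s <= 1) by nra.
replace (theta2_0 (q * q)) with (t * theta3_0 (q * q)) by (unfold t; field; lra).
replace (theta2_0 (p * p)) with (s * theta3_0 (p * p)) by (unfold s; field; lra).
replace (2 * (t * theta3_0 (q * q) * theta3_0 (q * q)) /
  (theta3_0 (q * q) ^ 2 + (t * theta3_0 (q * q)) ^ 2)) with (2 * t / (1 + t * t))
  by (field; split; nra).
replace (2 * (s * theta3_0 (p * p) * theta3_0 (p * p)) /
  (theta3_0 (p * p) ^ 2 + (s * theta3_0 (p * p)) ^ 2)) with (2 * s / (1 + s * s))
  by (field; split; nra).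
intros E; assert (E' : t * (1 + s * s) = s * (1 + t * t)).
{ apply (f_equal (fun v => v * ((1 + t * t) * (1 + s * s)) / 2)) in E.
  transitivity (2 * t / (1 + t * t) * ((1 + t * t) * (1 + s * s)) / 2); [field; nra|].
  rewrite E; field; nra. }
assert (F : (t - s) * (1 - t * s) = 0) by lra.
apply Rmult_integral in F; destruct F as [F|F].
- replace t with s by lra; reflexivity.
- nra.
Qed.

Lemma modulus_sq_bounds q : 0 < q < 1 ->  q <= 1 / 4 ->
  q / 16 <= modulus q ^ 2 <= 256 * q.
Proof.
intros Hq Hq4; destruct (theta2_bounds q Hq) as [L2 U2], (theta3_bounds q Hq) as [L3 U3].
specialize (U2 Hq4); specialize (U3 Hq4).
assert (Hp : 0 < Rpower q (1 / 4)) by apply exp_pos.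
assert (E := Rpower_quarter_4 q ltac:(lra)); set (p := Rpower q (1 / 4)) in *.
unfold modulus; replace ((theta2_0 q ^ 2 / theta3_0 q ^ 2) ^ 2)
  with (theta2_0 q ^ 4 / theta3_0 q ^ 4) by (field; lra).
assert (H3 : 1 <= theta3_0 q ^ 4) by (apply pow_R1_Rle; lra).
assert (H3' : theta3_0 q ^ 4 <= 4 ^ 4) by (apply pow_incr; lra).
assert (H2 : (2 * p) ^ 4 <= theta2_0 q ^ 4) by (apply pow_incr; lra).
assert (H2' : theta2_0 q ^ 4 <= (4 * p) ^ 4) by (apply pow_incr; lra).
rewrite Rpow_mult_distr, E in H2, H2'.
split.
- assert (H30 : 0 < theta3_0 q ^ 4) by lra; apply (proj1 (Rle_div_r _ _ _ H30)).
  apply Rle_trans with (q / 16 * 4 ^ 4); [apply Rmult_le_compat_l; lra|lra].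
- apply Rle_div_l; [lra|]; apply Rle_trans with (256 * q * 1); [lra|].
  apply Rmult_le_compat_l; lra.
Qed.

(** Equal moduli at [q] and [p] stay equal at [q^N] and [p^N] for every power [N]
    of 2, but [modulus] is comparable to the square root of the nome near 0, and
    [(p / q)^N] is unbounded. *)
Lemma modulus_inj_lt q p : 0 < q -> q < p -> p < 1 -> modulus q <> modulus p.
Proof.
intros Hq Hqp Hp E.
assert (Hpow : forall x n, 0 < x < 1 -> 0 < x ^ 2 ^ n < 1).
{ intros x n Hx; split; [apply pow_lt; lra|].
  destruct (2 ^ n)%nat eqn:En; [exfalso; revert En; apply Nat.pow_nonzero; lia|].
  apply Rle_lt_trans with (x ^ 1); [apply pow_sq_le; [assumption|lia]|simpl; lra]. }
assert (Hn : forall n, modulus (q ^ 2 ^ n) = modulus (p ^ 2 ^ n)).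
{ induction n as [|n IH]; [simpl; now rewrite !Rmult_1_r|].
  replace (2 ^ S n)%nat with (2 ^ n + 2 ^ n)%nat by (simpl; lia).
  rewrite !pow_add; apply modulus_descent; try (apply Hpow; lra); assumption. }
destruct (pow_lt_1_zero p ltac:(rewrite Rabs_right; lra) (1 / 4) ltac:(lra)) as [n1 H1].
destruct (Pow_x_infinity (p / q)) with (b := 4097) as [n2 H2].
{ rewrite Rabs_right; [apply Rlt_div_r; lra|].
  apply Rle_ge, Rlt_le, Rdiv_lt_0_compat; lra. }
set (n := max n1 n2); assert (Hbig : (n <= 2 ^ n)%nat)
  by (apply Nat.lt_le_incl, Nat.pow_gt_lin_r; lia).
specialize (H1 (2 ^ n)%nat ltac:(lia)); specialize (H2 (2 ^ n)%nat ltac:(lia)).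
specialize (Hn n); set (N := (2 ^ n)%nat) in *.
assert (PN : 0 < p ^ N) by (apply pow_lt; lra).
assert (QN : 0 < q ^ N) by (apply pow_lt; lra).
rewrite Rabs_right in H1 by lra.
assert (Hle : q ^ N <= p ^ N) by (apply pow_incr; lra).
rewrite Rabs_right in H2
  by (apply Rle_ge, pow_le, Rlt_le, Rdiv_lt_0_compat; lra).
unfold Rdiv in H2; rewrite Rpow_mult_distr, pow_inv in H2.
destruct (modulus_sq_bounds (q ^ N)) as [_ Bq]; [lra|lra|].
destruct (modulus_sq_bounds (p ^ N)) as [Bp _]; [lra|lra|].
rewrite Hn in Bq.
assert (p ^ N * / q ^ N <= 4096); [|lra].
apply Rmult_le_reg_r with (q ^ N); [assumption|].
rewrite Rmult_assoc, Rinv_l by lra; lra.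
Qed.

Theorem nome_modulus q : 0 < q < 1 -> nome (modulus q) = q.
Proof.
intros Hq; unfold nome.
destruct (epsilon_spec (inhabits 0) (fun p => 0 < p < 1 /\ modulus p = modulus q)) as [H1 H2].
{ now exists q. }
set (p := epsilon _ _) in *.
destruct (Rtotal_order p q) as [H|[H|H]]; [exfalso|assumption|exfalso].
- apply (modulus_inj_lt p q); try lra; assumption.
- apply (modulus_inj_lt q p); try lra; now symmetry.
Qed.

(** * The exponential and the elliptic sine *)

(** [exp (i z)]. *)
Definition Ce (z : C) : C :=
  (exp (- Im z) * cos (Re z), exp (- Im z) * sin (Re z)).

Lemma Ce_plus z w : Ce (z + w) = (Ce z * Ce w)%C.
Proof.
destruct z as [x y], w as [s t]; unfold Ce, Cplus, Cmult; simpl.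
rewrite Ropp_plus_distr, exp_plus, cos_plus, sin_plus; f_equal; ring.
Qed.

Lemma Ce_0 : Ce 0 = 1.
Proof. unfold Ce, RtoC; simpl; rewrite Ropp_0, exp_0, cos_0, sin_0; f_equal; ring. Qed.

Lemma Cmod_Ce z : Cmod (Ce z) = exp (- Im z).
Proof.
unfold Ce.
replace (exp (- Im z) * cos (Re z), exp (- Im z) * sin (Re z))
  with (RtoC (exp (- Im z)) * (cos (Re z), sin (Re z)))%C
  by (unfold Cmult, RtoC; simpl; f_equal; ring).
rewrite Cmod_mult, Cmod_R, Rabs_right by (apply Rle_ge, Rlt_le, exp_pos).
unfold Cmod; simpl.
replace (cos (Re z) * (cos (Re z) * 1) + sin (Re z) * (sin (Re z) * 1)) with 1.
- rewrite sqrt_1; ring.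
- generalize (sin2_cos2 (Re z)); unfold Rsqr; lra.
Qed.

Lemma Ce_neq_0 z : Ce z <> 0.
Proof. apply Cmod_gt_0; rewrite Cmod_Ce; apply exp_pos. Qed.

Lemma Ce_opp z : Ce (- z) = (/ Ce z)%C.
Proof.
assert (H := Ce_plus z (- z)); replace (z + - z)%C with (RtoC 0) in H by ring.
rewrite Ce_0 in H; assert (Hz := Ce_neq_0 z).
transitivity (Ce z * Ce (- z) / Ce z)%C; [field; assumption|].
rewrite <- H; field; assumption.
Qed.

Lemma Ce_nat n z : Ce (RtoC (INR n) * z) = (Ce z ^ n)%C.
Proof.
induction n as [|n IH].
- simpl; rewrite Cmult_0_l; apply Ce_0.
- rewrite S_INR, RtoC_plus, Cmult_plus_distr_r, Ce_plus, IH, Cmult_1_l; simpl; ring.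
Qed.

Lemma Csin_Ce z : Csin z = ((Ce z - / Ce z) / (2 * Ci))%C.
Proof.
rewrite <- Ce_opp; destruct z as [x y].
unfold Csin, Ce, Ci, Cdiv, Cminus, Cplus, Copp, Cinv, Cmult, RtoC; simpl.
rewrite cos_neg, sin_neg, Ropp_involutive; unfold cosh, sinh; f_equal; field.
Qed.

Lemma Ccos_Ce z : Ccos z = ((Ce z + / Ce z) / 2)%C.
Proof.
rewrite <- Ce_opp; destruct z as [x y].
unfold Ccos, Ce, Cdiv, Cminus, Cplus, Copp, Cinv, Cmult, RtoC; simpl.
rewrite cos_neg, sin_neg, Ropp_involutive; unfold cosh, sinh; f_equal; field.
Qed.

Lemma gterm_opp r x n : gterm r (- x) n = (RtoC ((-1) ^ n) * gterm r x n)%C.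
Proof.
unfold gterm; replace (- x)%C with (RtoC (-1) * x)%C by ring.
rewrite Cpow_mult_l, (RtoC_pow (-1) n); ring.
Qed.

Lemma theta1_Theta q z : 0 < q < 1 ->
  (RtoC (Rpower q (1 / 4)) * Theta (q * q) (- (Ce z * Ce z)))%C =
  (- (Ci * (Ce z * theta1 z q)))%C.
Proof.
intros Hq; assert (Hs := proper_nome_sq q Hq); assert (HE := Ce_neq_0 z).
set (E := Ce z) in *; set (p := Rpower q (1 / 4)).
assert (HE2 : (E * E)%C <> 0) by now apply Cmult_neq_0.
assert (Hterm : forall n,
  (RtoC ((-1) ^ n * Rpower q ((INR n + 1 / 2) ^ 2)) * Csin (RtoC (2 * INR n + 1) * z))%C =
  (RtoC p / (2 * Ci) * (E * gterm (q * q) (- (E * E)) n +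
     - / E * gterm (q * q) (- / (E * E)) n))%C).
{ intros n; rewrite Csin_Ce.
  replace (2 * INR n + 1) with (INR (S (n + n))) by (rewrite S_INR, plus_INR; ring).
  rewrite Ce_nat; fold E; simpl Cpow.
  rewrite Rpower_half_square by lra; fold p.
  rewrite !gterm_opp; unfold gterm.
  rewrite (Cpow_inv (E * E)), Cpow_mult_l, Cpow_add_r, !RtoC_mult by assumption.
  assert (Hn := Cpow_nz E n HE); field; repeat split; auto using C2_neq_0, Ci_neq_0. }
unfold theta1; rewrite (CSeries_ext _ _ Hterm).
assert (C1 := gterm_conv (q * q) (- (E * E)) Hs).
assert (C2 := gterm_conv (q * q) (- / (E * E)) Hs).
rewrite (CSeries_scal _ (fun n => _ + _)%C)
  by (apply abs_conv_plus; now apply abs_conv_scal).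
rewrite CSeries_plus by now apply abs_conv_scal.
rewrite (CSeries_scal E), (CSeries_scal (- / E)) by assumption.
unfold Theta; replace (/ - (E * E))%C with (- / (E * E))%C by (field; assumption).
fold (half_Theta (q * q) (- (E * E))) (half_Theta (q * q) (- / (E * E))).
field; repeat split; auto using C2_neq_0, Ci_neq_0.
Qed.

Lemma theta4_Theta q z : 0 < q < 1 ->
  Theta (q * q) (- (q * (Ce z * Ce z))) = theta4 z q.
Proof.
intros Hq; assert (Hs := proper_nome_sq q Hq); assert (HE := Ce_neq_0 z).
assert (HR := RtoC_neq_0 q ltac:(lra)).
set (E := Ce z) in *.
assert (HE2 : (E * E)%C <> 0) by now apply Cmult_neq_0.
set (x := (q * (E * E))%C); assert (Hx : x <> 0) by now apply Cmult_neq_0.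
assert (Hterm : forall n,
  (RtoC ((-1) ^ S n * q ^ (S n * S n)) * Ccos (RtoC (2 * INR (S n)) * z))%C =
  (/ 2 * (gterm (q * q) (- / x) (S n) + - x * gterm (q * q) (- x) n))%C).
{ intros n; rewrite Ccos_Ce.
  replace (2 * INR (S n)) with (INR (S n + S n)) by (rewrite plus_INR; ring).
  rewrite Ce_nat; fold E.
  rewrite !gterm_opp; unfold gterm.
  assert (E1 : RtoC ((q * q) ^ tri (S n)) = (RtoC (q ^ (S n * S n)) * RtoC q ^ S n)%C)
    by (rewrite sq_pow_tri, RtoC_mult, <- RtoC_pow; reflexivity).
  assert (E2 : (RtoC ((q * q) ^ tri n) * (RtoC q ^ S n))%C = RtoC (q ^ (S n * S n))).
  { rewrite sq_pow_tri, <- RtoC_pow, <- RtoC_mult; f_equal.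
    rewrite <- !pow_add; f_equal; lia. }
  rewrite E1, (Cpow_inv x) by assumption.
  replace (- x * (RtoC ((-1) ^ n) * (RtoC ((q * q) ^ tri n) * x ^ n)))%C
    with (RtoC ((-1) ^ S n) * (RtoC ((q * q) ^ tri n) * x ^ S n))%C
    by (rewrite Cpow_S, <- tech_pow_Rmult, RtoC_mult; ring).
  unfold x; rewrite !Cpow_mult_l.
  replace (RtoC ((q * q) ^ tri n) * (RtoC q ^ S n * (E ^ S n * E ^ S n)))%C
    with (RtoC ((q * q) ^ tri n) * RtoC q ^ S n * (E ^ S n * E ^ S n))%C by ring.
  rewrite E2, RtoC_mult, Cpow_add_r.
  assert (Hn := Cpow_nz E (S n) HE); assert (Hn' := Cpow_nz (RtoC q) (S n) HR).
  set (e := (E ^ S n)%C) in *; set (k := (RtoC q ^ S n)%C) in *.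
  field; repeat split; auto using C2_neq_0. }
assert (C1 : abs_conv (fun n => gterm (q * q) (- / x) (S n))).
{ assert (H := gterm_conv (q * q) (- / x)%C Hs).
  exact (proj1 (ex_series_incr_1 _) H). }
assert (C2 : abs_conv (fun n => - x * gterm (q * q) (- x) n)%C)
  by (apply abs_conv_scal; now apply gterm_conv).
unfold theta4; rewrite (CSeries_ext _ _ Hterm), CSeries_scal, CSeries_plus; try assumption.
2: now apply abs_conv_plus.
unfold Theta, half_Theta; replace (/ - x)%C with (- / x)%C by (field; assumption).
rewrite (CSeries_incr_1 (gterm (q * q) (- / x))), CSeries_scal by now apply gterm_conv.
replace (gterm (q * q) (- / x) 0) with (RtoC 1) by (unfold gterm; simpl; ring).
field; apply C2_neq_0.
Qed.

Lemma Ce_deriv_0 : is_Cderiv Ce 0 Ci.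
Proof.
assert (Hlim : forall f l e, derivable_pt_lim f 0 l -> 0 < e -> exists d, 0 < d /\
  forall h, Rabs h < d -> Rabs (f h - f 0 - l * h) <= e * Rabs h).
{ intros f l e Hf He; destruct (Hf e He) as [d Hd]; exists d; split; [apply cond_pos|].
  intros h Hh; destruct (Req_dec h 0) as [->|Hh0].
  - replace (f 0 - f 0 - l * 0) with 0 by ring; rewrite Rabs_R0; lra.
  - specialize (Hd h Hh0 Hh); rewrite Rplus_0_l in Hd.
    replace (f h - f 0 - l * h) with (((f h - f 0) / h - l) * h) by (field; assumption).
    rewrite Rabs_mult; apply Rmult_le_compat_r; [apply Rabs_pos|lra]. }
intros e He.
assert (Hex : exists e1, 0 < e1 /\ e1 <= e / 20 /\ e1 <= 1)
  by (exists (Rmin (e / 20) 1); rmin).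
destruct Hex as (e1 & He1 & He1e & He11).
destruct (Hlim exp _ e1 (derivable_pt_lim_exp 0) He1) as [d1 [Hd1 H1]].
destruct (Hlim sin _ e1 (derivable_pt_lim_sin 0) He1) as [d2 [Hd2 H2]].
destruct (Hlim cos _ e1 (derivable_pt_lim_cos 0) He1) as [d3 [Hd3 H3]].
rewrite exp_0 in H1; rewrite sin_0, cos_0 in H2; rewrite cos_0, sin_0 in H3.
exists (Rmin (Rmin d1 d2) (Rmin d3 e1)); split; [rmin|].
intros w Hw; rewrite slope_at.
destruct (excluded_middle_informative (w = 0)) as [->|Hw0].
{ rewrite slope_at; replace (Ci - Ci)%C with (RtoC 0) by ring; rewrite Cmod_0; lra. }
rewrite slope_ne, Ce_0 by assumption.
replace (w - 0)%C with w in * by ring.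
assert (Hwp := proj1 (Cmod_gt_0 w) Hw0).
replace ((Ce w - 1) / w - Ci)%C with ((Ce w - 1 - Ci * w) / w)%C by (field; assumption).
rewrite Cmod_div by assumption; apply Rlt_div_l; [assumption|].
destruct w as [x y].
assert (Hx := Cmod_fst (x, y)); assert (Hy := Cmod_snd (x, y)); simpl in Hx, Hy.
set (m := Cmod (x, y)) in *.
assert (Hm : m < d1 /\ m < d2 /\ m < d3 /\ m < e1) by (repeat split; rmin).
specialize (H1 (- y)); rewrite Rabs_Ropp in H1; specialize (H1 ltac:(lra)).
specialize (H2 x ltac:(lra)); specialize (H3 x ltac:(lra)).
assert (Hle : forall t, Rabs t <= m -> e1 * Rabs t <= e1 * m)
  by (intros; apply Rmult_le_compat_l; lra).
assert (Lx := Hle x Hx); assert (Ly := Hle y Hy).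
assert (Hem : e1 * m <= m) by nra.
(* First-order remainders of the two factors [exp (- y)] and [cos x + i sin x]. *)
set (A := exp (- y) - 1 - 1 * - y) in *.
set (b := (cos x - 1 - - 0 * x, sin x - 0 - 1 * x)).
replace (Ce (x, y) - 1 - Ci * (x, y))%C
  with (RtoC A + b + RtoC (A + - y) * (b + Ci * RtoC x))%C.
2:{ unfold Ce, A, b, Cminus, Cplus, Copp, Cmult, Ci, RtoC; simpl; f_equal; ring. }
assert (Hb : Cmod b <= 2 * (e1 * m)) by (eapply Rle_trans; [apply Cmod_le_sum|simpl; lra]).
assert (HA : Rabs (A + - y) <= 2 * m)
  by (eapply Rle_trans; [apply Rabs_triang|]; rewrite Rabs_Ropp; lra).
assert (Hbx : Cmod (b + Ci * RtoC x) <= 3 * m).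
{ eapply Rle_trans; [apply Cmod_triangle|]; rewrite Cmod_mult, Cmod_Ci, Cmod_R; lra. }
eapply Rle_lt_trans; [apply Cmod_triangle|]; rewrite Cmod_mult, Cmod_R.
eapply Rle_lt_trans; [apply Rplus_le_compat_r, Cmod_triangle|]; rewrite Cmod_R.
assert (Rabs (A + - y) * Cmod (b + Ci * RtoC x) <= 2 * m * (3 * m))
  by (apply Rmult_le_compat; auto using Rabs_pos, Cmod_ge_0).
nra.
Qed.

Lemma Ce_diff z : Cdiff Ce z.
Proof.
apply (Cdiff_ext_near (fun w => Ce z * Ce (w - z))%C).
- apply near_all; intros w; rewrite <- Ce_plus; f_equal; ring.
- apply Cdiff_mult; [apply Cdiff_const|].
  apply (Cdiff_comp Ce (fun w => w - z)%C).
  + apply Cdiff_minus; [apply Cdiff_id|apply Cdiff_const].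
  + replace (z - z)%C with (RtoC 0) by ring; exists Ci; apply Ce_deriv_0.
Qed.

(** * The conformal map of the rectangle onto the disk *)

(** The exponential coordinate [exp (i pi z / (2 T))]; it maps the closed
    rectangle into the closed annulus of the nome and the half-plane
    [0 <= Re]. *)
Definition expo (T : R) (z : C) : C := Ce (RtoC (PI / (2 * T)) * z).

Definition theta_quot (r : R) (x : C) : C := (Theta r (- x) / Theta r x)%C.

Definition disk_map (q T : R) (z : C) : C := (Ci * theta_quot (- q) (expo T z))%C.

Lemma proper_nome_opp q : 0 < q < 1 -> proper_nome (- q).
Proof. intros Hq; split; [lra|rewrite Rabs_left; lra]. Qed.

Lemma expo_0 T : expo T 0 = 1.
Proof. unfold expo; rewrite Cmult_0_r; apply Ce_0. Qed.

Lemma expo_diff T z : Cdiff (expo T) z.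
Proof.
apply (Cdiff_comp Ce (fun w => RtoC (PI / (2 * T)) * w)%C); [|apply Ce_diff].
apply Cdiff_mult; [apply Cdiff_const|apply Cdiff_id].
Qed.

Lemma expo_arg T z : (RtoC (PI / (2 * T)) * z)%C = (PI / (2 * T) * Re z, PI / (2 * T) * Im z).
Proof. destruct z; unfold Cmult, RtoC, Re, Im; simpl; f_equal; ring. Qed.

Lemma expo_Re T B z : 0 < T -> crect T B z -> 0 <= Re (expo T z).
Proof.
intros HT [Hx _]; unfold expo; rewrite expo_arg; unfold Ce; simpl.
apply Rmult_le_pos; [apply Rlt_le, exp_pos|].
assert (Hpi := PI_RGT_0).
assert (Hc : 0 < PI / (2 * T)) by (apply Rdiv_lt_0_compat; lra).
assert (Hh : PI / (2 * T) * T = PI / 2) by (field; lra).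
apply cos_ge_0; unfold Re; nra.
Qed.

Lemma Cmod_expo_sq T z : 0 < T -> Cmod (expo T z) ^ 2 = exp (- (PI * Im z / T)).
Proof.
intros HT; unfold expo; rewrite Cmod_Ce, expo_arg; simpl; rewrite Rmult_1_r, <- exp_plus.
f_equal; field; lra.
Qed.

Lemma expo_annulus T B z : 0 < T -> 0 < B -> crect T B z ->
  annulus (- exp (- PI * B / T)) (expo T z).
Proof.
intros HT HB [_ Hy]; unfold annulus; rewrite Rabs_Ropp, Rabs_right
  by (apply Rle_ge, Rlt_le, exp_pos).
rewrite Cmod_expo_sq, <- exp_plus by assumption.
assert (Hpi := PI_RGT_0).
assert (Hm : forall a b, a <= b -> exp a <= exp b).
{ intros a b [H| ->]; [apply Rlt_le, exp_increasing, H|lra]. }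
assert (Hd : forall a b, a <= b -> PI * a / T <= PI * b / T).
{ intros a b H; apply Rmult_le_compat_r; [apply Rlt_le, Rinv_0_lt_compat, HT|].
  apply Rmult_le_compat_l; lra. }
assert (E : - PI * B / T = - (PI * B / T)) by (field; lra).
assert (D1 := Hd (Im z) B (proj2 Hy)).
assert (D2 := Hd (- B) (Im z) (proj1 Hy)).
replace (PI * - B / T) with (- (PI * B / T)) in D2 by (field; lra).
rewrite E; split; [apply Hm; lra|rewrite <- exp_0; apply Hm; lra].
Qed.

Lemma annulus_opp r x : annulus r x -> annulus r (- x).
Proof. unfold annulus; now rewrite Cmod_opp. Qed.

Lemma nome_range T B : 0 < T -> 0 < B -> 0 < exp (- PI * B / T) < 1.
Proof.
intros HT HB; split; [apply exp_pos|]; rewrite <- exp_0; apply exp_increasing.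
assert (0 < PI * B / T) 
  by (apply Rdiv_lt_0_compat; [apply Rmult_lt_0_compat; [apply PI_RGT_0|]|]; assumption).
replace (- PI * B / T) with (- (PI * B / T)) by (field; lra); lra.
Qed.

Lemma expo_eq_1 T B z : 0 < T -> crect T B z -> expo T z = 1 -> z = 0.
Proof.
intros HT Hz E; assert (Hpi := PI_RGT_0).
assert (Hc : 0 < PI / (2 * T)) by (apply Rdiv_lt_0_compat; lra).
assert (Hh : PI / (2 * T) * T = PI / 2) by (field; lra).
assert (Hm := Cmod_expo_sq T z HT); rewrite E, Cmod_1, pow1 in Hm.
assert (Hy : Im z = 0).
{ rewrite <- exp_0 in Hm; apply exp_inv in Hm.
  assert (PI * Im z = 0); [|nra].
  replace (PI * Im z) with (PI * Im z / T * T) by (field; lra); nra. }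
unfold expo in E; rewrite expo_arg, Hy in E; unfold Ce in E; simpl in E.
rewrite Rmult_0_r, Ropp_0, exp_0, !Rmult_1_l in E.
apply (f_equal snd) in E; simpl in E.
destruct Hz as [Hx _]; unfold Re in *.
assert (Hx0 : fst z = 0).
{ destruct (Rtotal_order (fst z) 0) as [H|[H|H]]; [exfalso|assumption|exfalso].
  - assert (0 < sin (- (PI / (2 * T) * fst z))) by (apply sin_gt_0; nra).
    rewrite sin_neg in H0; lra.
  - assert (0 < sin (PI / (2 * T) * fst z)) by (apply sin_gt_0; nra); lra. }
destruct z as [x y]; unfold Im in Hy; simpl in *; subst; reflexivity.
Qed.

Lemma disk_map_den T B z : 0 < T -> 0 < B -> crect T B z ->
  Theta (- exp (- PI * B / T)) (expo T z) <> 0.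
Proof.
intros HT HB Hz; assert (Hq := nome_range T B HT HB).
apply (proj1 (Theta_simple_zeros _ (proper_nome_opp _ Hq))); [now apply expo_annulus|].
intros E; assert (H := expo_Re T B z HT Hz); rewrite E in H; simpl in H; lra.
Qed.

Lemma disk_map_num T B z : 0 < T -> 0 < B -> crect T B z -> z <> 0 ->
  Theta (- exp (- PI * B / T)) (- expo T z) <> 0.
Proof.
intros HT HB Hz Hz0; assert (Hq := nome_range T B HT HB).
apply (proj1 (Theta_simple_zeros _ (proper_nome_opp _ Hq)));
  [now apply annulus_opp, expo_annulus|].
intros E; apply Hz0, (expo_eq_1 T B); try assumption.
replace (expo T z) with (- - expo T z)%C by ring; rewrite E.
unfold Copp, RtoC; simpl; f_equal; ring.
Qed.

Lemma expo_neq_0 T z : expo T z <> 0.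
Proof. apply Ce_neq_0. Qed.

Lemma Theta_expo_diff q T z : 0 < q < 1 ->
  Cdiff (fun z => Theta (- q) (expo T z)) z /\ Cdiff (fun z => Theta (- q) (- expo T z)) z.
Proof.
intros Hq; assert (Hr := proper_nome_opp q Hq); assert (HE := expo_neq_0 T z); split.
- apply (Cdiff_comp (Theta (- q)) (expo T)); [apply expo_diff|now apply Theta_diff].
- apply (Cdiff_comp (Theta (- q)) (fun z => - expo T z)%C).
  + apply Cdiff_opp, expo_diff.
  + apply Theta_diff; [assumption|now apply Copp_neq_0].
Qed.

Lemma disk_map_diff T B z : 0 < T -> 0 < B -> crect T B z ->
  Cdiff (disk_map (exp (- PI * B / T)) T) z.
Proof.
intros HT HB Hz; assert (Hq := nome_range T B HT HB).
destruct (Theta_expo_diff _ T z Hq) as [D1 D2].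
apply Cdiff_mult; [apply Cdiff_const|].
apply (Cdiff_div (fun z => Theta _ (- expo T z)) (fun z => Theta _ (expo T z)));
  [assumption..|now apply (disk_map_den T B)].
Qed.

Lemma disk_map_0 q T : 0 < q < 1 -> disk_map q T 0 = 0.
Proof.
intros Hq; unfold disk_map, theta_quot; rewrite expo_0.
replace (- (1))%C with (RtoC (-1)) by (unfold Copp, RtoC; simpl; f_equal; ring).
rewrite Theta_m1 by now apply proper_nome_opp.
unfold Cdiv; ring.
Qed.

Lemma disk_map_zero T B z : 0 < T -> 0 < B -> crect T B z ->
  disk_map (exp (- PI * B / T)) T z = 0 -> z = 0.
Proof.
intros HT HB Hz E.
destruct (excluded_middle_informative (z = 0)) as [|Hz0]; [assumption|exfalso].
assert (H1 := disk_map_den T B z HT HB Hz); assert (H2 := disk_map_num T B z HT HB Hz Hz0).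
revert E; unfold disk_map, theta_quot, Cdiv; repeat apply Cmult_neq_0; try assumption.
- apply Ci_neq_0.
- now apply Cinv_neq_0.
Qed.

Lemma disk_map_deriv T B d : 0 < T -> 0 < B ->
  is_Cderiv (disk_map (exp (- PI * B / T)) T) 0 d -> d <> 0.
Proof.
intros HT HB Hd; assert (Hq := nome_range T B HT HB).
set (q := exp (- PI * B / T)) in *; assert (Hr := proper_nome_opp q Hq).
assert (H0 : crect T B 0) by (unfold crect, in_rect; simpl; lra).
set (c := RtoC (PI / (2 * T))).
assert (Hc : c <> 0).
{ apply RtoC_neq_0; assert (Hpi := PI_RGT_0).
  assert (0 < PI / (2 * T)) by (apply Rdiv_lt_0_compat; lra); lra. }
assert (Hlin := is_Cderiv_scal c _ 0 _ (is_Cderiv_id 0)).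
rewrite Cmult_1_r in Hlin.
assert (HE : is_Cderiv (expo T) 0 (Ci * c)).
{ apply (is_Cderiv_comp Ce (fun w => c * w)%C 0 c Ci Hlin).
  rewrite Cmult_0_r; apply Ce_deriv_0. }
assert (HEo : is_Cderiv (fun w => -1 * expo T w)%C 0 (-1 * (Ci * c))).
{ exact (is_Cderiv_scal (-1) _ 0 _ HE). }
assert (Em : (-1 * expo T 0)%C = RtoC (-1)) by (rewrite expo_0; ring).
destruct (Theta_diff (- q) (-1) Hr Cm1_neq_0) as [e He].
assert (He0 := proj2 (Theta_simple_zeros _ Hr) e He).
rewrite <- Em in He.
assert (HN := is_Cderiv_comp (Theta (- q)) _ 0 _ _ HEo He).
assert (DQ : Cdiff (fun w => Ci / Theta (- q) (expo T w))%C 0).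
{ apply Cdiff_div; [apply Cdiff_const|apply (Theta_expo_diff q T 0 Hq)|].
  now apply (disk_map_den T B). }
destruct DQ as [f Hf].
assert (HU := is_Cderiv_mult _ _ 0 _ _ HN Hf).
assert (Ed : d = (e * (-1 * (Ci * c)) * (Ci / Theta (- q) (expo T 0)) +
  Theta (- q) (-1 * expo T 0) * f)%C).
{ eapply is_Cderiv_unique; [exact Hd|].
  revert HU; apply is_Cderiv_ext_near, near_all; intros w; unfold disk_map, theta_quot.
  replace (-1 * expo T w)%C with (- expo T w)%C by ring; unfold Cdiv; ring. }
rewrite Em, Theta_m1 in Ed by assumption; rewrite Ed.
replace (e * (-1 * (Ci * c)) * (Ci / Theta (- q) (expo T 0)) + 0 * f)%C
  with (e * (-1 * (Ci * c)) * (Ci / Theta (- q) (expo T 0)))%C by ring.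
unfold Cdiv; repeat apply Cmult_neq_0; try assumption; try apply Ci_neq_0;
  try apply Cm1_neq_0.
apply Cinv_neq_0; now apply (disk_map_den T B).
Qed.

Lemma Cconj_Ci : Cconj Ci = (- Ci)%C.
Proof. unfold Cconj, Ci, Copp; simpl; f_equal; ring. Qed.

Lemma theta_quot_opp r x : Theta r x <> 0 -> Theta r (- x) <> 0 ->
  theta_quot r (- x) = (/ theta_quot r x)%C.
Proof.
intros H1 H2; unfold theta_quot; replace (- - x)%C with x by ring; field; now split.
Qed.

Lemma theta_quot_inv r (x : C) : proper_nome r -> x <> 0 -> Theta r x <> 0 ->
  theta_quot r (/ x) = (- theta_quot r x)%C.
Proof.
intros Hr Hx HJ; assert (Hx' := Copp_neq_0 x Hx); unfold theta_quot.
replace (- / x)%C with (/ - x)%C by (field; assumption).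
rewrite !Theta_inv by assumption; field; now split.
Qed.

Lemma theta_quot_shift r (x : C) : proper_nome r -> x <> 0 -> Theta r x <> 0 ->
  theta_quot r (r * x) = (- theta_quot r x)%C.
Proof.
intros Hr Hx HJ; assert (Hx' := Copp_neq_0 x Hx); unfold theta_quot.
replace (- (r * x))%C with (r * - x)%C by ring.
rewrite !Theta_shift by assumption; field; now split.
Qed.

Lemma disk_map_conj q T z : 0 < q < 1 -> Theta (- q) (expo T z) <> 0 ->
  Cconj (disk_map q T z) = (- Ci * theta_quot (- q) (Cconj (expo T z)))%C.
Proof.
intros Hq Hd; unfold disk_map, theta_quot; assert (HE := expo_neq_0 T z).
rewrite Cmult_conj, Cdiv_conj, Cconj_Ci by assumption.
rewrite <- !Theta_conj, Copp_conj by (try apply Copp_neq_0; assumption); reflexivity.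
Qed.

Lemma expo_conj T z : 0 < T ->
  Cconj (expo T z) = (RtoC (exp (- (PI * Im z / T))) / expo T z)%C.
Proof.
intros HT; assert (HE := expo_neq_0 T z).
rewrite <- Cmod_expo_sq, Cmod2_conj by assumption; field; assumption.
Qed.

Lemma disk_map_real T B x : 0 < T -> 0 < B -> - T <= x <= T ->
  Im (disk_map (exp (- PI * B / T)) T (RtoC x)) = 0.
Proof.
intros HT HB Hx; assert (Hq := nome_range T B HT HB).
assert (Hz : crect T B (RtoC x)) by (unfold crect, in_rect; simpl; lra).
assert (Hd := disk_map_den T B _ HT HB Hz); assert (HE := expo_neq_0 T (RtoC x)).
assert (Hc := disk_map_conj _ T _ Hq Hd).
rewrite expo_conj in Hc by assumption; simpl Im in Hc.
replace (- (PI * 0 / T)) with 0 in Hc by (field; lra); rewrite exp_0 in Hc.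
replace (1 / expo T (RtoC x))%C with (/ expo T (RtoC x))%C in Hc by (unfold Cdiv; ring).
rewrite theta_quot_inv in Hc by (try apply proper_nome_opp; assumption).
assert (H := im_conj (disk_map (exp (- PI * B / T)) T (RtoC x))).
rewrite Hc in H; unfold disk_map in *.
replace (- Ci * - theta_quot (- exp (- PI * B / T)) (expo T (RtoC x)))%C
  with (Ci * theta_quot (- exp (- PI * B / T)) (expo T (RtoC x)))%C in H by ring.
lra.
Qed.

(** Reflection in a side of the rectangle acts on [E = expo T z] by [E -> - E] on
    the vertical sides, [E -> q / E] on the top and [E -> 1 / (q E)] on the
    bottom. The functional equations turn each of them into [u -> 1 / u], so
    that [u] times its conjugate is [1] where the reflection is trivial. *)
Lemma disk_map_boundary T B z : 0 < T -> 0 < B -> cbound T B z ->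
  Cmod (disk_map (exp (- PI * B / T)) T z) = 1.
Proof.
intros HT HB [Hz Hb]; assert (Hq := nome_range T B HT HB).
assert (Hz0 : z <> 0) by (intros ->; simpl in Hb; lra).
assert (Hd := disk_map_den T B _ HT HB Hz); assert (Hn := disk_map_num T B _ HT HB Hz Hz0).
assert (HqB : exp (- (PI * B / T)) = exp (- PI * B / T)) by (f_equal; field; lra).
assert (HqB' : exp (- (PI * - B / T)) = / exp (- PI * B / T))
  by (rewrite <- exp_Ropp; f_equal; field; lra).
assert (Hem := expo_conj T z HT).
set (q := exp (- PI * B / T)) in *; assert (Hr := proper_nome_opp q Hq).
assert (HE := expo_neq_0 T z); assert (Hq0 := RtoC_neq_0 q ltac:(lra)).
assert (Hso := Theta_shift (- q) _ Hr (Copp_neq_0 _ HE)).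
assert (Key : theta_quot (- q) (Cconj (expo T z)) = (/ theta_quot (- q) (expo T z))%C).
{ set (E := expo T z) in *; assert (HEo := Copp_neq_0 E HE).
  assert (Hi1 := Cinv_neq_0 _ HE).
  assert (Hside : (fst z = - T \/ fst z = T) -> Cconj E = (- E)%C).
  { intros Hsd; unfold E, expo; rewrite expo_arg; unfold Ce, Re; simpl.
    replace (cos (PI / (2 * T) * fst z)) with 0.
    - unfold Cconj, Copp; simpl; f_equal; ring.
    - destruct Hsd as [-> | ->].
      + replace (PI / (2 * T) * - T) with (- (PI / 2)) by (field; lra).
        now rewrite cos_neg, cos_PI2.
      + replace (PI / (2 * T) * T) with (PI / 2) by (field; lra); now rewrite cos_PI2. }
  destruct Hb as [Hx|[Hx|[Hy|Hy]]].
  1, 2: rewrite Hside by tauto; now apply theta_quot_opp.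
  - unfold Im in Hem; rewrite Hy, HqB', RtoC_inv in Hem by lra.
    set (y := (RtoC (- q) * - E)%C).
    assert (Hy0 : y <> 0) by (apply Cmult_neq_0; [apply RtoC_neq_0; lra|assumption]).
    assert (HJy : Theta (- q) y <> 0).
    { unfold y; rewrite Hso; unfold Cdiv; apply Cmult_neq_0; [assumption|now apply Cinv_neq_0]. }
    replace (Cconj E) with (/ y)%C
      by (rewrite Hem; unfold y; rewrite RtoC_opp; field; now split).
    rewrite theta_quot_inv by assumption; unfold y.
    rewrite theta_quot_shift, theta_quot_opp by assumption; ring.
  - unfold Im in Hem; rewrite Hy, HqB in Hem.
    replace (Cconj E) with (RtoC (- q) * / - E)%C
      by (rewrite Hem, RtoC_opp; field; assumption).
    assert (HJ : Theta (- q) (/ - E) <> 0).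
    { rewrite Theta_inv by assumption; unfold Cdiv.
      apply Cmult_neq_0; [assumption|now apply Cinv_neq_0]. }
    rewrite theta_quot_shift by (try apply Cinv_neq_0; assumption).
    rewrite theta_quot_inv, theta_quot_opp by assumption; ring. }
assert (Hu : disk_map q T z <> 0).
{ intros E; apply Hz0, (disk_map_zero T B); assumption. }
assert (Hc := disk_map_conj q T _ Hq Hd); rewrite Key in Hc.
assert (H := Cmod2_conj (disk_map q T z)); rewrite Hc in H; unfold disk_map in H at 2.
assert (Hw : theta_quot (- q) (expo T z) <> 0)
  by (intros E; apply Hu; unfold disk_map; rewrite E; ring).
set (w := theta_quot (- q) (expo T z)) in *.
replace (Ci * w * (- Ci * / w))%C with (- (Ci * Ci))%C in H by (field; assumption).
rewrite Ci_sqr in H; apply (f_equal fst) in H; simpl in H.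
assert (H0 := Cmod_ge_0 (disk_map q T z)); nra.
Qed.

(** [Theta_mult] at [x = y = E] and at [x = y = - E] gives the difference of the
    squares of [Theta r E] and [Theta r (- E)] as a multiple of [theta4];
    [Theta_opp_mult] gives their product as a multiple of [theta1]. The quotient
    is [sn = 2 u / (1 + u^2)]. *)
Lemma Phi_disk_map T B z : 0 < T -> 0 < B -> crect T B z ->
  let u := disk_map (exp (- PI * B / T)) T z in
  (1 + u * u)%C <> 0 -> (1 - u)%C <> 0 ->
  (1 + Phi T B z)%C = (((1 + u) / (1 - u)) * ((1 + u) / (1 - u)))%C.
Proof.
intros HT HB Hz u Hu1 Hu2; assert (Hq := nome_range T B HT HB).
assert (Hd := disk_map_den T B z HT HB Hz).
unfold Phi, jacobi_sn; set (q := exp (- PI * B / T)) in *.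
assert (Hr := proper_nome_opp q Hq); rewrite nome_modulus by assumption; cbv zeta.
destruct (theta_pos q Hq) as [P2 P3].
set (zeta := (RtoC (quarter_period q) * z / RtoC T / RtoC (theta3_0 q ^ 2))%C).
assert (Hzeta : zeta = (RtoC (PI / (2 * T)) * z)%C).
{ unfold zeta, quarter_period.
  replace (PI / (2 * T)) with (PI / 2 * theta3_0 q ^ 2 * / T * / (theta3_0 q ^ 2))
    by (field; lra).
  rewrite 2!(RtoC_mult _ (/ _)), !RtoC_inv by (try apply pow_nonzero; lra).
  unfold Cdiv; ring. }
assert (H1 := theta1_Theta q zeta Hq); assert (H4 := theta4_Theta q zeta Hq).
rewrite Hzeta in *; fold (expo T z) in H1, H4; fold (expo T z) in *.
set (th1 := theta1 _ q) in *; set (th4 := theta4 _ q) in *.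
assert (HE := expo_neq_0 T z); unfold u, disk_map, theta_quot in *; set (E := expo T z) in *.
clear u; set (a := Theta (- q) E) in *; set (b := Theta (- q) (- E)) in *.
set (p := RtoC (Rpower q (1 / 4))) in *.
assert (Hp : p <> 0)
  by (apply RtoC_neq_0; generalize (exp_pos (1 / 4 * ln q)); unfold Rpower; lra).
assert (T2 := RtoC_neq_0 (theta2_0 q) ltac:(lra)).
assert (T3 := RtoC_neq_0 (theta3_0 q) ltac:(lra)).
assert (HEo := Copp_neq_0 E HE).
assert (Hqq : - q * - q = q * q) by ring.
assert (I1 : (p * (a * b))%C = (- (Ci * (E * th1)) * theta3_0 q)%C).
{ unfold a, b; rewrite Theta_opp_mult, Hqq by assumption.
  replace (- RtoC (- q))%C with (RtoC q) by (rewrite RtoC_opp; ring).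
  rewrite theta3_Theta, <- H1 by assumption; ring. }
assert (Hone : Theta (q * q) (RtoC (q * q)) = Theta (q * q) 1).
{ transitivity (Theta (q * q) (RtoC (q * q) * 1)%C); [f_equal; ring|].
  rewrite Theta_shift; [field|now apply proper_nome_sq|apply RtoC_neq_0; lra]. }
assert (I2 : (p * (a * a - b * b))%C = (2 * (E * th4) * theta2_0 q)%C).
{ unfold a, b; rewrite (Theta_mult (- q) E E), (Theta_mult (- q) (- E) (- E)), Hqq by assumption.
  replace (- E * - E)%C with (E * E)%C by ring.
  replace (RtoC (- q) * - E / - E)%C with (RtoC (- q) * E / E)%C by (field; assumption).
  replace (RtoC (- q) * - E * - E)%C with (- (q * (E * E)))%C by (rewrite RtoC_opp; ring).
  replace (RtoC (- q) * E * E)%C with (- (q * (E * E)))%C by (rewrite RtoC_opp; ring).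
  replace (RtoC (- q) * RtoC (- q) * - E / - E)%C with (RtoC (q * q))
    by (rewrite RtoC_opp, RtoC_mult; field; assumption).
  replace (RtoC (- q) * RtoC (- q) * E / E)%C with (RtoC (q * q))
    by (rewrite RtoC_opp, RtoC_mult; field; assumption).
  rewrite H4, Hone, <- theta2_Theta by assumption; unfold p; ring. }
assert (Hab : (a * a - b * b)%C <> 0).
{ intros E0; apply Hu1.
  transitivity ((a * a + Ci * Ci * (b * b)) / (a * a))%C; [field; assumption|].
  rewrite Ci_sqr; replace (a * a + RtoC (-1) * (b * b))%C with (a * a - b * b)%C by ring.
  rewrite E0; unfold Cdiv; ring. }
assert (Hth4 : th4 <> 0).
{ intros E0; apply (Cmult_neq_0 _ _ Hp Hab); rewrite I2, E0; ring. }
assert (Hba : (a - Ci * b)%C <> 0).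
{ intros E0; apply Hu2; transitivity ((a - Ci * b) / a)%C; [field; assumption|].
  rewrite E0; unfold Cdiv; ring. }
assert (Hs : (RtoC (theta3_0 q / theta2_0 q) * (th1 / th4))%C =
  (2 * Ci * a * b / (a * a - b * b))%C).
{ unfold Rdiv; rewrite RtoC_mult, RtoC_inv by lra.
  transitivity (2 * (Ci * (p * (a * b))) / (p * (a * a - b * b)))%C.
  - rewrite I1, I2.
    transitivity (-1 * (Ci * Ci) * (theta3_0 q * th1) / (th4 * theta2_0 q))%C.
    + rewrite Ci_sqr; field; repeat split; assumption.
    + field; repeat split; assumption.
  - field; repeat split; assumption. }
rewrite Hs.
assert (Hsq : (a * a - b * b)%C = (a * a + (Ci * b) * (Ci * b))%C).
{ transitivity (a * a + Ci * Ci * (b * b))%C; [rewrite Ci_sqr; ring|ring]. }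
assert (Hden : (a * a - b * b - 2 * Ci * a * b)%C = ((a - Ci * b) * (a - Ci * b))%C)
  by (rewrite Hsq; ring).
assert (Hden0 : (a * a - b * b - 2 * Ci * a * b)%C <> 0)
  by (rewrite Hden; now apply Cmult_neq_0).
transitivity ((a * a - b * b + 2 * Ci * a * b) / (a * a - b * b - 2 * Ci * a * b))%C.
- field; repeat split; assumption.
- rewrite Hden, Hsq; field; repeat split; assumption.
Qed.

(** * The representation *)

Lemma disk_map_coord T B : 0 < T -> 0 < B ->
  disk_coord T B (disk_map (exp (- PI * B / T)) T).
Proof.
intros HT HB; split.
- intros z Hz; now apply disk_map_diff.
- intros z Hz; now apply disk_map_boundary.
- now apply disk_map_0, nome_range.
- intros z Hz; now apply disk_map_zero.
- intros d; now apply disk_map_deriv.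
- intros x Hx; now apply disk_map_real.
Qed.

Lemma Csqrt_of_sqr (s : C) : 0 < Re s -> Csqrt (s * s) = s.
Proof.
intros Hs.
assert (Hc : 0 < Re (Csqrt (s * s))).
{ apply Csqrt_Re_pos; intros [H1 H2]; destruct s as [a b]; simpl in *.
  assert (Hb : a * b = 0) by lra; apply Rmult_integral in Hb; nra. }
assert (Hsq := Csqrt_sqr (s * s)); set (c := Csqrt (s * s)) in *.
destruct (excluded_middle_informative (c = s)) as [|Hne]; [assumption|exfalso].
apply (Cmult_neq_0 (c - s) (c + s)).
- now apply Cminus_neq.
- intros E; apply (f_equal Re) in E; destruct c, s; simpl in *; lra.
- replace ((c - s) * (c + s))%C with (c * c - s * s)%C by ring; rewrite Hsq; ring.
Qed.

Lemma cayley_Re_pos (u : C) : Cmod u < 1 -> 0 < Re ((1 + u) / (1 - u))%C.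
Proof.
intros Hu; assert (Hd := proj1 (Cmod_gt_0 _) (one_minus_neq_0 u Hu)).
assert (Hd2 : 0 < Cmod (1 - u) ^ 2) by now apply pow_lt.
assert (Hu2 : Cmod u ^ 2 < 1) by (assert (H := Cmod_ge_0 u); nra).
rewrite Cmod2_alt in Hd2, Hu2; destruct u as [x y]; simpl in *.
replace (_ - _) with ((1 - (x * (x * 1) + y * (y * 1))) /
  ((1 + - x) * ((1 + - x) * 1) + (0 + - y) * ((0 + - y) * 1))) by (field; lra).
apply Rdiv_lt_0_compat; lra.
Qed.

Lemma Phi_rect T B z : 0 < T -> 0 < B -> rect T B z ->
  let u := disk_map (exp (- PI * B / T)) T z in
  Phi T B z = Phi_of u /\ Csqrt (1 + Phi T B z) = ((1 + u) / (1 - u))%C.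
Proof.
intros HT HB Hz u.
assert (Hu : Cmod u < 1) by exact (disk_coord_lt_1 T B _ z HT HB (disk_map_coord T B HT HB) Hz).
assert (Hm := one_minus_neq_0 u Hu).
assert (Huu : (1 + u * u)%C <> 0).
{ apply one_plus_neq_0, Cmod_mult_lt_1; lra. }
assert (E := Phi_disk_map T B z HT HB (rect_crect _ _ _ Hz) Huu Hm); fold u in E.
split.
- unfold Phi_of.
  transitivity ((1 + u) / (1 - u) * ((1 + u) / (1 - u)) - 1)%C; [rewrite <- E; ring|].
  field; assumption.
- rewrite E; apply Csqrt_of_sqr; now apply cayley_Re_pos.
Qed.

Theorem schur_algorithm T B u h : 0 < T -> 0 < B -> disk_coord T B u -> schur T B h ->
  exists (ga : nat -> R) (s : nat -> C -> C),
    (forall i, Rabs (ga i) <= 1) /\ s O = h /\ ga O = Re (h 0) /\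
    forall z, rect T B z -> schur_chain ga (u z) (fun i => s i z).
Proof.
intros HT HB Hu Hh.
set (next := fun k : {k | schur T B k} =>
  let c := constructive_indefinite_description _
    (schur_step T B u (proj1_sig k) HT HB Hu (proj2_sig k)) in
  exist (schur T B) (proj1_sig c) (proj1 (proj2_sig c))).
set (s := nat_rect (fun _ => {k | schur T B k}) (exist _ h Hh) (fun _ => next)).
exists (fun i => Re (proj1_sig (s i) 0)), (fun i => proj1_sig (s i)).
assert (Hb : forall i z, rect T B z -> Cmod (proj1_sig (s i) z) <= 1).
{ intros i z Hz; apply (proj1 (proj2_sig (s i))), Hz. }
split; [|split; [reflexivity|split; [reflexivity|]]].
- intros i; eapply Rle_trans; [apply re_le_Cmod|now apply Hb, rect_0].
- intros z Hz i; split; [now apply Hb|].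
  change (s (S i)) with (next (s i)); unfold next; simpl.
  destruct (constructive_indefinite_description _ _) as [k [Hk1 Hk2]]; simpl.
  now apply Hk2.
Qed.

Lemma analytic_class_schur M T B f : 0 < M -> analytic_class M T B f ->
  schur T B (fun z => f z / M)%C.
Proof.
intros HM (Hd & Hr & Hb).
assert (HMC : RtoC M <> 0) by (intros E; apply (f_equal fst) in E; simpl in E; lra).
split.
- intros z Hz; split.
  + apply Cdiff_div; [now apply ex_derive_Cdiff, Hd|apply Cdiff_const|assumption].
  + rewrite Cmod_div, Cmod_R, Rabs_right by (assumption || lra).
    apply Rle_div_l; [assumption|]; specialize (Hb z Hz); lra.
- intros x Hx; rewrite (real_eq _ (Hr x Hx)), <- RtoC_div by lra; reflexivity.
Qed.

Theorem mainTheorem1 :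
  forall (M T B : R) (f : C -> C),
    (0 < M)%R -> (0 < T)%R -> (0 < B)%R ->
    analytic_class M T B f ->
    exists (mu0 : R) (g : nat -> R),
      (0 < mu0)%R /\
      (forall i : nat, (1 <= i)%nat -> (0 <= g i <= 1)%R) /\
      forall z : C, rect T B z ->
        exists v : C,
          is_gfrac g (Phi T B z) v /\
          f z = (RtoC M *
                 (1 - 2 / (RtoC mu0 * Csqrt (1 + Phi T B z) * v + 1)))%C.
Proof.
intros M T B f HM HT HB Hf.
assert (HMC : RtoC M <> 0) by (intros E; apply (f_equal fst) in E; simpl in E; lra).
set (u := disk_map (exp (- PI * B / T)) T).
assert (Hu : disk_coord T B u) by now apply disk_map_coord.
destruct (schur_algorithm T B u _ HT HB Hu (analytic_class_schur M T B f HM Hf))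
  as (ga & s & Hga & Hs0 & Hga0 & Hs).
assert (Hlt : Rabs (ga O) < 1).
{ rewrite Hga0; eapply Rle_lt_trans; [apply re_le_Cmod|].
  rewrite Cmod_div, Cmod_R, Rabs_right by (assumption || lra).
  apply Rlt_div_l; [assumption|]; rewrite Rmult_1_l.
  apply Hf; now apply rect_0. }
apply Rabs_def2 in Hlt.
exists ((1 + ga O) / (1 - ga O)), (gpar ga); split; [apply Rdiv_lt_0_compat; lra|split].
{ intros i _; specialize (Hga i); apply Rabs_le_between in Hga; unfold gpar; lra. }
intros z Hz.
destruct (Phi_rect T B z HT HB Hz) as [EPhi ESqrt]; fold u in EPhi, ESqrt.
assert (Huz : Cmod (u z) < 1) by now apply (disk_coord_lt_1 T B u z).
eexists; split; [rewrite EPhi; exact (gfrac_converges ga (u z) _ Hga Huz (Hs z Hz))|].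
rewrite ESqrt; simpl.
destruct (Hs z Hz O) as [_ E0]; rewrite Hs0 in E0.
assert (Hs1 := proj1 (Hs z Hz 1%nat)); simpl in Hs1.
assert (Hx := Cmod_mult_lt_1 _ _ Huz Hs1).
assert (Hd := den_neq_0 (ga O) _ _ (Hga O) Huz Hs1).
set (x := (u z * s 1%nat z)%C) in *.
assert (D1 := one_minus_neq_0 _ Huz); assert (D2 := one_plus_neq_0 _ Huz).
assert (D3 := one_plus_neq_0 _ Hx).
assert (D4 : (1 - RtoC (ga O))%C <> 0) by (intros E; apply (f_equal fst) in E; simpl in E; lra).
assert (HF : f z = (M * ((RtoC (ga O) - x) / (1 - RtoC (ga O) * x)))%C)
  by (rewrite <- E0; field; assumption).
rewrite HF, RtoC_div, RtoC_plus, RtoC_minus by lra.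
set (c := RtoC (ga O)) in *.
assert (E1 : ((1 + c) / (1 - c) * ((1 + u z) / (1 - u z)) *
  ((1 - u z) * (1 - x) / ((1 + u z) * (1 + x))) + 1)%C =
  (2 * (1 - c * x) / ((1 - c) * (1 + x)))%C).
{ transitivity (((1 + c) * (1 - x) + (1 - c) * (1 + x)) / ((1 - c) * (1 + x)))%C.
  - field; repeat split; assumption.
  - f_equal; ring. }
rewrite E1; field; repeat split; assumption.
Qed.
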